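(* Let $m\geq 1$. The series $${}^0F^{(m)}(t)=\sum_{d\geq 0}\mathbb{L}^{-(m-1)d(d-1)/2}\cdot[{}^0{\rm Hilb}^{(m)}(\mathbb{C}^d)]\,t^d\in 1+tR[[t]]$$ is determined by the functional equation $${}^0F^{(m)}(t)=1+t\cdot\prod_{k=1}^m{}^0F^{(m)}(\mathbb{L}^{1-k}t)$$ (that is, it satisfies this equation and is the only series in $1+tR[[t]]$ doing so). Moreover, for all $d\ge 0$ there are polynomials $h_d^{(m)}(q),\,{}^0h_d^{(m)}(q)\in\mathbb{Z}[q]$ such that, in $R$, $$[{}^0{\rm Hilb}^{(m)}(\mathbb{C}^d)]={}^0h_d^{(m)}(\mathbb{L})\quad\mbox{and}\quad[{\rm Hilb}^{(m)}(\mathbb{C}^d)]=h_d^{(m)}(\mathbb{L}),$$ and these polynomials are related by $${}^0h_d^{(m)}(q)=q^{(m-1)d^2+d}\cdot h_d^{(m)}(q^{-1}).$$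
   Context: $K_0({\rm Var}_\mathbb{C})$ is the Grothendieck ring of complex varieties, $[X]$ is the class (''motive'') of $X$, $\mathbb{L}=[\mathbb{A}^1]$ is the Lefschetz motive, and $R=K_0({\rm Var}_\mathbb{C})[\mathbb{L}^{-1},(1-\mathbb{L}^i)^{-1} : i\geq 1]$ is the localized Grothendieck ring. Definition of the (punctual) noncommutative Hilbert schemes for a complex vector space $V$ of dimension $d$: the group ${\rm GL}(V)$ acts on ${\rm End}(V)^m\times V$ by $g\cdot(\varphi_1,\ldots,\varphi_m,v)=(g\varphi_1g^{-1},\ldots,g\varphi_mg^{-1},gv)$. A point $(\varphi_1,\ldots,\varphi_m,v)$ is stable if $\mathbb{C}\langle\varphi_1,\ldots,\varphi_m\rangle\cdot v=V$. The open subset of stable points $({\rm End}(V)^m\times V)_{\rm st}$ admits a geometric quotient ${\rm Hilb}^{(m)}(V)=({\rm End}(V)^m\times V)_{\rm st}/{\rm GL}(V)$, the noncommutative Hilbert scheme, whose points correspond to left ideals of codimension $d$ in the free algebra $\mathbb{C}\langle x_1,\ldots,x_m\rangle$. Let $\mathcal{N}^{(m)}(V)\subset{\rm End}(V)^m$ be the closed subvariety of simultaneously nilpotent tuples, i.e. tuples for which there is a complete flag $0=F_0\subset F_1\subset\ldots\subset F_d=V$ with $\varphi_k(F_i)\subset F_{i-1}$ for all $k,i$, and let $(\mathcal{N}^{(m)}(V)\times V)_{\rm st}$ be the open subset of stable points in $\mathcal{N}^{(m)}(V)\times V$. The punctual noncommutative Hilbert scheme is ${}^0{\rm Hilb}^{(m)}(V)=(\mathcal{N}^{(m)}(V)\times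 V)_{\rm st}/{\rm GL}(V)$; its points correspond to left ideals of codimension $d$ in $\mathbb{C}\langle\langle x_1,\ldots,x_m\rangle\rangle$. *)

(* Defs.v *)
From HB Require Import structures.
From mathcomp Require Import all_boot all_order all_algebra.
From mathcomp Require Import boolp Rstruct complex mpoly.
Set Implicit Arguments.
Unset Strict Implicit.
Unset Printing Implicit Defensive.
Import GRing.Theory.
Local Open Scope ring_scope.
Local Open Scope quotient_scope.

Notation C := (complex Rdefinitions.R).

(* Varieties are "spaces with functions": a set of closed points, a topology,
   and a sheaf of C-valued functions. Only the values of f on U matter in
   [reg U f]. The raw data carries no axioms; they are part of [is_variety]. *)
Record space := Space {
  pt :> Type;
  opn : (pt -> Prop) -> Prop;
  reg : (pt -> Prop) -> (pt -> C) -> Prop }.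

Arguments opn {s}.
Arguments reg {s}.

Definition is_closed (X : space) (Z : X -> Prop) := opn (fun x => ~ Z x).

Record ringed (X : space) : Prop := Ringed {
  opn_full : opn (fun _ : X => True);
  opn_cap : forall U V : X -> Prop, opn U -> opn V -> opn (fun x => U x /\ V x);
  opn_cup : forall S : (X -> Prop) -> Prop, (forall U, S U -> opn U) ->
    opn (fun x => exists2 U, S U & U x);
  reg_opn : forall (U : X -> Prop) f, reg U f -> opn U;
  reg_cst : forall (U : X -> Prop) c, opn U -> reg U (fun _ => c);
  reg_add : forall (U : X -> Prop) f g,
    reg U f -> reg U g -> reg U (fun x => f x + g x);
  reg_mul : forall (U : X -> Prop) f g,
    reg U f -> reg U g -> reg U (fun x => f x * g x);
  reg_res : forall (U V : X -> Prop) f g, reg U f -> opn V ->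
    (forall x, V x -> U x) -> (forall x, V x -> g x = f x) -> reg V g;
  reg_glue : forall (U : X -> Prop) f, opn U ->
    (forall x, U x ->
       exists V : X -> Prop, [/\ V x, forall y, V y -> U y & reg V f]) ->
    reg U f }.

Definition is_morphism (X Y : space) (f : X -> Y) : Prop :=
  (forall V : Y -> Prop, opn V -> opn (fun x => V (f x))) /\
  (forall (V : Y -> Prop) h, reg V h -> reg (fun x => V (f x)) (fun x => h (f x))).

Definition iso (X Y : space) : Prop :=
  exists (f : X -> Y) (g : Y -> X),
    [/\ cancel f g, cancel g f, is_morphism f & is_morphism g].

(* A subset with the induced structure; used for locally closed subsets. *)
Definition subspace (X : space) (A : X -> Prop) : space :=
  let opnA (V : {x : X | A x} -> Prop) :=
    exists2 U : X -> Prop, opn U & forall y, V y <-> U (sval y) in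
  @Space {x : X | A x} opnA
    (fun V f => opnA V /\ forall y, V y -> exists (U : X -> Prop) g,
       [/\ U (sval y), reg U g &
           forall z, V z -> U (sval z) -> f z = g (sval z)]).

(* The product variety: opens are unions of principal opens D(h) of boxes
   U x V, for h in O(U) (x) O(V), and regular functions are locally quotients
   of such h. *)
Definition tensor (X Y : space) (U : X -> Prop) (V : Y -> Prop)
    (h : X * Y -> C) : Prop :=
  exists n (f : 'I_n -> X -> C) (g : 'I_n -> Y -> C),
    [/\ forall i, reg U (f i), forall i, reg V (g i) &
        forall p, h p = \sum_(i < n) f i p.1 * g i p.2].

Definition prod_space (X Y : space) : space :=
  let opnP (W : X * Y -> Prop) :=
    forall p, W p -> exists (U : X -> Prop) (V : Y -> Prop) h,
      [/\ opn U /\ opn V, U p.1 /\ V p.2, tensor U V h, h p != 0 &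
          forall q, U q.1 -> V q.2 -> h q != 0 -> W q] in
  @Space (X * Y) opnP
    (fun W f => opnP W /\
       forall p, W p -> exists (U : X -> Prop) (V : Y -> Prop) g h,
         [/\ opn U /\ opn V, U p.1 /\ V p.2, tensor U V g /\ tensor U V h,
             h p != 0 &
             forall q, W q -> U q.1 -> V q.2 -> h q != 0 -> f q = g q / h q]).

(* The orbit space of an equivalence relation E: points are the classes E x,
   with the quotient topology and the functions whose pullback is regular.
   For the orbits of a group this is the structure of a geometric quotient. *)
Definition class_of (X : Type) (E : X -> X -> Prop) (x : X) :
    {A : X -> Prop | exists x, A = E x} :=
  exist _ (E x) (ex_intro _ x erefl).

Definition quotient_space (X : space) (E : X -> X -> Prop) : space :=
  @Space {A : X -> Prop | exists x, A = E x}
    (fun V => opn (fun x => V (class_of E x)))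
    (fun V f => reg (fun x => V (class_of E x)) (fun x => f (class_of E x))).

(* Affine space C^I, for a finite index type I, with its Zariski structure. *)
Definition polynomial_fun (I : Type) (f : (I -> C) -> C) : Prop :=
  exists n (c : 'I_n -> I) (p : {mpoly C[n]}),
    forall x, f x = p.@[fun k => x (c k)].

Definition affine_space (I : Set) : space :=
  let opnZ (U : (I -> C) -> Prop) :=
    exists2 S : ((I -> C) -> C) -> Prop,
      forall f, S f -> polynomial_fun f &
      forall x, U x <-> exists2 f, S f & f x != 0 in
  @Space (I -> C) opnZ
    (fun U f => opnZ U /\ forall x, U x -> exists g h,
       [/\ polynomial_fun g, polynomial_fun h, h x != 0 &
           forall y, U y -> h y != 0 -> f y = g y / h y]).

(* A copy of 'I_n in Set. The elements of the Grothendieck ring are built from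
   varieties, so the points of a variety must live in a universe below that of
   the MathComp structures; 'I_n, tuples and matrices do not. *)
Definition idx (n : nat) : Set := {i : nat | (i < n)%N}.
Definition to_idx n (i : 'I_n) : idx n := exist _ (nat_of_ord i) (ltn_ord i).

Definition is_affine (X : space) : Prop :=
  exists n (Z : affine_space (idx n) -> Prop), is_closed Z /\ iso X (subspace Z).

Definition is_variety (X : space) : Prop :=
  [/\ ringed X,
      exists n (U : 'I_n -> X -> Prop),
        [/\ forall i, opn (U i), forall x, exists i, U i x &
            forall i, is_affine (subspace (U i))] &
      is_closed (fun p : prod_space X X => p.1 = p.2)].

Record variety := Variety { space_of :> space; _ : is_variety space_of }.

Section PolynomialFun.
Variable I : Type.
Implicit Types f g : (I -> C) -> C.

Lemma polynomial_fun_cst (a : C) : polynomial_fun (fun _ : I -> C => a).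
Proof.
by exists 0%N, (fun k : 'I_0 => match notF (ltn_ord k) with end), a%:MP => x;
  rewrite mevalC.
Qed.

Lemma polynomial_fun_coord (i : I) : polynomial_fun (fun x : I -> C => x i).
Proof. by exists 1%N, (fun _ => i), 'X_ord0 => x; rewrite mevalXU. Qed.

Let merge_vars f g : polynomial_fun f -> polynomial_fun g ->
  exists n (c : 'I_n -> I) (p q : {mpoly C[n]}),
    forall x, f x = p.@[fun k => x (c k)] /\ g x = q.@[fun k => x (c k)].
Proof.
move=> [n1 [c1 [p1 Hp]]] [n2 [c2 [p2 Hq]]].
pose c (k : 'I_(n1 + n2)) :=
  match split k with inl i => c1 i | inr j => c2 j end.
exists (n1 + n2)%N, c, (p1 \mPo [tuple 'X_(lshift n2 i) | i < n1]),
  (p2 \mPo [tuple 'X_(rshift n1 i) | i < n2]) => x.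
rewrite Hp Hq !comp_mpoly_meval; split; apply: meval_eq => i;
  rewrite tnth_map tnth_ord_tuple mevalXU /c.
- by rewrite (unsplitK (inl i)).
- by rewrite (unsplitK (inr i)).
Qed.

Lemma polynomial_fun_add f g : polynomial_fun f -> polynomial_fun g ->
  polynomial_fun (fun x => f x + g x).
Proof.
move=> Pf Pg; have [n [c [p [q H]]]] := merge_vars Pf Pg.
by exists n, c, (p + q) => x; rewrite mevalD; have [-> ->] := H x.
Qed.

Lemma polynomial_fun_mul f g : polynomial_fun f -> polynomial_fun g ->
  polynomial_fun (fun x => f x * g x).
Proof.
move=> Pf Pg; have [n [c [p [q H]]]] := merge_vars Pf Pg.
by exists n, c, (p * q) => x; rewrite mevalM; have [-> ->] := H x.
Qed.

End PolynomialFun.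

Lemma divfMr (F : fieldType) (a b k : F) : k != 0 -> a / b = a * k / (b * k).
Proof. by move=> k0; rewrite -mulf_div divff // mulr1. Qed.

Lemma iso_refl (X : space) : iso X X.
Proof. by exists id, id; split. Qed.

Section AffineSpace.
Variable I : Set.
Notation A := (affine_space I).

Lemma opn_affine (U : A -> Prop) :
  opn U <-> forall x, U x -> exists f,
    [/\ polynomial_fun f, f x != 0 & forall y, f y != 0 -> U y].
Proof.
split=> [[S PS HU] x /HU[f Sf fx]|H].
  by exists f; split=> // [|y fy]; [exact: PS|apply/HU; exists f].
exists (fun f => polynomial_fun f /\ forall y, f y != 0 -> U y) => [f []//|x].
split=> [/H[f [Pf fx fU]]|[f [_ fU]]]; last exact: fU.
by exists f.
Qed.

Lemma ringed_affine_space : ringed A.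
Proof.
have cap (U V : A -> Prop) : opn U -> opn V -> opn (fun x => U x /\ V x).
  move=> /opn_affine oU /opn_affine oV; apply/opn_affine => x [Ux Vx].
  have [f [Pf fx fU]] := oU x Ux; have [g [Pg gx gV]] := oV x Vx.
  exists (fun y => f y * g y); split; first exact: polynomial_fun_mul.
    by rewrite mulf_neq0.
  by move=> y; rewrite mulf_eq0 negb_or => /andP[/fU ? /gV ?].
split=> //.
- apply/opn_affine => x _; exists (fun _ => 1).
  by split=> //; [exact: polynomial_fun_cst|exact: oner_neq0].
- move=> S oS; apply/opn_affine => x [U SU Ux].
  have [f [Pf fx fU]] := (opn_affine U).1 (oS U SU) x Ux.
  by exists f; split=> // y /fU Uy; exists U.
- by move=> U f [].
- move=> U c oU; split=> // x Ux; exists (fun _ => c), (fun _ => 1).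
  split; [exact: polynomial_fun_cst|exact: polynomial_fun_cst|exact: oner_neq0|].
  by move=> y _ _; rewrite divr1.
- move=> U f g [oU Hf] [_ Hg]; split=> // x Ux.
  have [a [b [Pa Pb bx fE]]] := Hf x Ux; have [c [d [Pc Pd dx gE]]] := Hg x Ux.
  exists (fun y => a y * d y + c y * b y), (fun y => b y * d y).
  split; [apply: polynomial_fun_add; exact: polynomial_fun_mul
    |exact: polynomial_fun_mul|by rewrite mulf_neq0|].
  move=> y Uy; rewrite mulf_eq0 negb_or => /andP[by0 dy0].
  by rewrite fE // gE // addf_div.
- move=> U f g [oU Hf] [_ Hg]; split=> // x Ux.
  have [a [b [Pa Pb bx fE]]] := Hf x Ux; have [c [d [Pc Pd dx gE]]] := Hg x Ux.
  exists (fun y => a y * c y), (fun y => b y * d y).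
  split; [exact: polynomial_fun_mul|exact: polynomial_fun_mul
    |by rewrite mulf_neq0|].
  move=> y Uy; rewrite mulf_eq0 negb_or => /andP[by0 dy0].
  by rewrite fE // gE // mulf_div.
- move=> U V f g [oU Hf] oV VU gf; split=> // x Vx.
  have [a [b [Pa Pb bx fE]]] := Hf x (VU x Vx).
  by exists a, b; split=> // y Vy by0; rewrite gf // fE //; exact: VU.
- move=> U f oU H; split=> // x Ux; have [V [Vx VU [oV Hf]]] := H x Ux.
  have [a [b [Pa Pb bx fE]]] := Hf x Vx.
  have [k [Pk kx kV]] := (opn_affine V).1 oV x Vx.
  exists (fun y => a y * k y), (fun y => b y * k y).
  split; [exact: polynomial_fun_mul|exact: polynomial_fun_mul
    |by rewrite mulf_neq0|].
  move=> y Uy; rewrite mulf_eq0 negb_or => /andP[by0 ky0].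
  by rewrite (fE y (kV y ky0) by0) -mulf_div (divff ky0) mulr1.
Qed.

Lemma reg_polynomial_fun (f : A -> C) :
  polynomial_fun f -> @reg A (fun _ => True) f.
Proof.
move=> Pf; split=> [|x _]; first exact: (opn_full ringed_affine_space).
exists f, (fun _ => 1).
split=> //; [exact: polynomial_fun_cst|exact: oner_neq0|].
by move=> y _ _; rewrite divr1.
Qed.

Lemma separated_affine_space : is_closed (fun p : prod_space A A => p.1 = p.2).
Proof.
move=> [x y] /= xy; have /existsNP[i xyi] : ~ forall i, x i = y i.
  by move=> H; apply: xy; exact: funext.
have oT := opn_full ringed_affine_space.
exists (fun _ => True), (fun _ => True), (fun q => q.1 i - q.2 i).
split=> //=; last first.
- by case=> a b _ _ /= ab E; case/eqP: ab; rewrite E subrr.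
- by rewrite subr_eq0; exact/eqP.
exists 2%N, (fun k z => if k == ord0 then z i else 1),
  (fun k z => if k == ord0 then 1 else - z i).
have Pc c := polynomial_fun_cst I c; have Px := polynomial_fun_coord i.
split=> [k|k|[a b]] /=; last first.
- by rewrite !big_ord_recl big_ord0 /= mulr1 mul1r addr0.
- case: (k == ord0); apply: reg_polynomial_fun; first exact: Pc.
  rewrite (_ : (fun _ => _) = (fun z : I -> C => -1 * z i)).
    exact: polynomial_fun_mul (Pc (-1)) Px.
  by apply: funext => z; rewrite mulN1r.
- by case: (k == ord0); apply: reg_polynomial_fun; [exact: Px|exact: Pc].
Qed.

End AffineSpace.

Lemma affine_space_is_variety n : is_variety (affine_space (idx n)).
Proof.
have rA := @ringed_affine_space (idx n).
split=> //; last exact: separated_affine_space.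
exists 1%N, (fun _ _ => True); split=> [_|x|_]; first exact: opn_full.
  by exists ord0.
exists n, (fun _ => True); split; last exact: iso_refl.
rewrite /is_closed; have := opn_cup rA (S := fun _ => False).
by case=> // S PS HS; exists S => // x; rewrite -HS; split=> // -[].
Qed.

Definition AA n : variety := Variety (affine_space_is_variety n).

(* The commutative ring presented by generators G and relations rel. It is only a
   comPzRingType, since 1 != 0 is not a formal consequence of a presentation. *)
Section PresentedRing.
Variable G : Type.

Inductive term :=
  Gen of G | Zero | One | Opp of term | Add of term & term | Mul of term & term.

Variable rel : term -> term -> Prop.

Inductive cong : term -> term -> Prop :=
| cong_rel x y : rel x y -> cong x y
| cong_refl x : cong x x
| cong_sym x y : cong x y -> cong y x
| cong_trans y x z : cong x y -> cong y z -> cong x z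
| cong_opp x y : cong x y -> cong (Opp x) (Opp y)
| cong_add x x' y y' : cong x x' -> cong y y' -> cong (Add x y) (Add x' y')
| cong_mul x x' y y' : cong x x' -> cong y y' -> cong (Mul x y) (Mul x' y')
| cong_addA x y z : cong (Add x (Add y z)) (Add (Add x y) z)
| cong_addC x y : cong (Add x y) (Add y x)
| cong_add0 x : cong (Add Zero x) x
| cong_addN x : cong (Add (Opp x) x) Zero
| cong_mulA x y z : cong (Mul x (Mul y z)) (Mul (Mul x y) z)
| cong_mulC x y : cong (Mul x y) (Mul y x)
| cong_mul1 x : cong (Mul One x) x
| cong_mulDl x y z : cong (Mul (Add x y) z) (Add (Mul x z) (Mul y z)).

HB.instance Definition _ := gen_eqMixin term.
HB.instance Definition _ := gen_choiceMixin term.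

Definition congb (x y : term) : bool := `[< cong x y >].

Lemma congb_equiv : equiv_class_of congb.
Proof.
split=> [x|x y|y x z]; rewrite /congb.
- by apply/asboolP; exact: cong_refl.
- by apply: asbool_equiv_eq; split; exact: cong_sym.
- by move=> /asboolP xy /asboolP yz; apply/asboolP; exact: cong_trans xy yz.
Qed.

Canonical congb_rel := EquivRelPack congb_equiv.

Definition presented : Type := {eq_quot congb_rel}.
HB.instance Definition _ := Choice.on presented.
HB.instance Definition _ := Quotient.on presented.

Definition generator (g : G) : presented := \pi_presented (Gen g).

Lemma presentedP (x y : term) :
  \pi_presented x = \pi_presented y <-> cong x y.
Proof. by split=> [/eqquotP/asboolP|xy] //; apply/eqquotP/asboolP. Qed.

Definition pres_opp (a : presented) : presented := \pi_presented (Opp (repr a)).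
Definition pres_add (a b : presented) : presented :=
  \pi_presented (Add (repr a) (repr b)).
Definition pres_mul (a b : presented) : presented :=
  \pi_presented (Mul (repr a) (repr b)).

Lemma repr_pi (x : term) : cong (repr (\pi_presented x)) x.
Proof. by apply/presentedP; rewrite reprK. Qed.

Lemma pi_opp x : pres_opp (\pi_presented x) = \pi_presented (Opp x).
Proof. by apply/presentedP/cong_opp/repr_pi. Qed.
Lemma pi_add x y : pres_add (\pi_presented x) (\pi_presented y) =
  \pi_presented (Add x y).
Proof. by apply/presentedP/cong_add; exact: repr_pi. Qed.
Lemma pi_mul x y : pres_mul (\pi_presented x) (\pi_presented y) =
  \pi_presented (Mul x y).
Proof. by apply/presentedP/cong_mul; exact: repr_pi. Qed.

Fact pres_addA : associative pres_add.
Proof.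
elim/quotW=> x; elim/quotW=> y; elim/quotW=> z; rewrite (pi_add y z) (pi_add x y) !pi_add.
apply/presentedP; exact: cong_addA.
Qed.
Fact pres_addC : commutative pres_add.
Proof.
elim/quotW=> x; elim/quotW=> y; rewrite !pi_add; apply/presentedP; exact: cong_addC.
Qed.
Fact pres_add0 : left_id (\pi_presented Zero) pres_add.
Proof. elim/quotW=> x; rewrite pi_add; apply/presentedP; exact: cong_add0. Qed.
Fact pres_addN : left_inverse (\pi_presented Zero) pres_opp pres_add.
Proof. elim/quotW=> x; rewrite pi_opp pi_add; apply/presentedP; exact: cong_addN. Qed.

HB.instance Definition _ :=
  GRing.isZmodule.Build presented pres_addA pres_addC pres_add0 pres_addN.

Fact pres_mulA : associative pres_mul.
Proof.
elim/quotW=> x; elim/quotW=> y; elim/quotW=> z; rewrite (pi_mul y z) (pi_mul x y) !pi_mul.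
apply/presentedP; exact: cong_mulA.
Qed.
Fact pres_mulC : commutative pres_mul.
Proof.
elim/quotW=> x; elim/quotW=> y; rewrite !pi_mul; apply/presentedP; exact: cong_mulC.
Qed.
Fact pres_mul1 : left_id (\pi_presented One) pres_mul.
Proof. elim/quotW=> x; rewrite pi_mul; apply/presentedP; exact: cong_mul1. Qed.
Fact pres_mulDl : left_distributive pres_mul pres_add.
Proof.
elim/quotW=> x; elim/quotW=> y; elim/quotW=> z.
rewrite (pi_add x y) (pi_mul x z) (pi_mul y z) pi_mul pi_add.
apply/presentedP; exact: cong_mulDl.
Qed.

HB.instance Definition _ := GRing.Zmodule_isComPzRing.Build presented
  pres_mulA pres_mulC pres_mul1 pres_mulDl.

End PresentedRing.

Arguments Zero {G}.
Arguments One {G}.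

(* The relations of K0(Var). Closed subvarieties, their complements and products
   only need to be given up to isomorphism. *)
Inductive motivic_rel : term variety -> term variety -> Prop :=
| motivic_iso (X Y : variety) : iso X Y -> motivic_rel (Gen X) (Gen Y)
| motivic_scissor (X Z U : variety) (A : X -> Prop) :
    is_closed A -> iso Z (subspace A) -> iso U (subspace (fun x => ~ A x)) ->
    motivic_rel (Gen X) (Add (Gen Z) (Gen U))
| motivic_prod (X Y P : variety) :
    iso P (prod_space X Y) -> motivic_rel (Gen P) (Mul (Gen X) (Gen Y))
| motivic_point : motivic_rel (Gen (AA 0)) One.

Notation K0 := (presented motivic_rel).

(* The localization of A at the elements satisfying S. *)
Section Localization.
Variables (A : comPzRingType) (S : A -> Prop).

Inductive loc_rel :
    term (A + {s : A | S s}) -> term (A + {s : A | S s}) -> Prop :=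
| loc_one : loc_rel (Gen (inl 1)) One
| loc_add a b :
    loc_rel (Gen (inl (a + b))) (Add (Gen (inl a)) (Gen (inl b)))
| loc_mul a b :
    loc_rel (Gen (inl (a * b))) (Mul (Gen (inl a)) (Gen (inl b)))
| loc_inv s : loc_rel (Mul (Gen (inl (sval s))) (Gen (inr s))) One.

End Localization.

Notation localization S := (presented (@loc_rel _ S)).

Definition lefschetz0 : K0 := generator motivic_rel (AA 1).

Definition inverted (x : K0) : Prop :=
  x = lefschetz0 \/ exists2 i, (1 <= i)%N & x = 1 - lefschetz0 ^+ i.

Notation K0loc := (localization inverted).

Definition motive (X : variety) : K0loc :=
  generator _ (inl (generator motivic_rel X)).

Definition lefschetz : K0loc := motive (AA 1).
Definition lefschetz_inv : K0loc :=
  generator _ (inr (exist inverted lefschetz0 (or_introl erefl))).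

Definition eval_int (A : pzRingType) (p : {poly int}) (x : A) : A :=
  \sum_(i < size p) x ^+ i *~ p`_i.

(* Power series over A, as coefficient sequences. *)
Section PowerSeries.
Variable A : pzRingType.
Implicit Types f g : nat -> A.

Definition ps_one : nat -> A := fun n => (n == 0%N)%:R.
Definition ps_t : nat -> A := fun n => (n == 1%N)%:R.
Definition ps_add f g : nat -> A := fun n => f n + g n.
Definition ps_mul f g : nat -> A := fun n => \sum_(i < n.+1) f i * g (n - i)%N.
(* f(ct) *)
Definition ps_scale (c : A) f : nat -> A := fun n => c ^+ n * f n.

End PowerSeries.

(* F(t) = 1 + t * \prod_(k = 1..m) F(L^(1 - k) t) *)
Definition functional_equation (m : nat) (F : nat -> K0loc) : Prop :=
  F = ps_add (ps_one K0loc) (ps_mul (ps_t K0loc)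
        (\big[@ps_mul K0loc/ps_one K0loc]_(1 <= k < m.+1)
            ps_scale (lefschetz_inv ^+ k.-1) F)).

(* The representation space End(C^d)^m x C^d, with matrix entries and vector
   entries as coordinates. *)
Definition rep (m d : nat) : space :=
  affine_space (idx m * idx d * idx d + idx d).

Section NCHilbert.
Variables m d : nat.
Implicit Types x y : rep m d.

Definition rep_op x (k : 'I_m) : 'M[C]_d :=
  \matrix_(i, j) x (inl (to_idx k, to_idx i, to_idx j)).
Definition rep_vec x : 'cV[C]_d := \col_i x (inr (to_idx i)).

Definition rep_word x (w : seq 'I_m) : 'M[C]_d :=
  \big[mulmx/1%:M]_(k <- w) rep_op x k.

(* C<phi_1, ..., phi_m> v = V *)
Definition stable x : Prop :=
  forall u : 'cV[C]_d, exists (s : seq (seq 'I_m)) (c : seq 'I_m -> C),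
    u = (\sum_(w <- s) c w *: rep_word x w) *m rep_vec x.

Definition simul_nilpotent x : Prop :=
  exists F : nat -> {vspace 'cV[C]_d},
    [/\ F 0%N = 0%VS, F d = fullv,
        forall i, (i < d)%N -> (F i <= F i.+1)%VS,
        forall i, (i <= d)%N -> \dim (F i) = i &
        forall k i u, (i < d)%N -> u \in F i.+1 -> rep_op x k *m u \in F i].

Definition same_orbit x y : Prop :=
  exists2 g : 'M[C]_d, g \in unitmx &
    (forall k, rep_op y k = g *m rep_op x k *m invmx g) /\
    rep_vec y = g *m rep_vec x.

Definition orbit_space (A : rep m d -> Prop) : space :=
  quotient_space (fun x y : subspace A => same_orbit (sval x) (sval y)).

Definition Hilb : space := orbit_space stable.
Definition Hilb0 : space := orbit_space (fun x => simul_nilpotent x /\ stable x).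

End NCHilbert.

(* Main.v *)
(* Index the vectors obtained from v by the words in the letters 1, ..., m. For
   a prefix-closed set S of d words (an m-ary tree with d nodes), the points for
   which the vectors indexed by S form a basis make up an open subset of the
   Hilbert scheme, isomorphic to an affine space whose coordinates are the
   coefficients of the vectors at the corners c of S (the minimal words outside
   of S) along the words s of S. Order the words lexicographically. A greedy choice
   of S shows that the Hilbert scheme is the disjoint union of the cells where
   only the coordinates with s < c survive. The punctual Hilbert scheme is the
   disjoint union of the cells where only those with s > c survive: a set chosen
   greedily from the largest word down is prefix-closed because the operators
   are nilpotent. Since a tree with d >= 1 nodes has (m-1)d + 1 corners, the
   dimensions of the two cells of S add up to (m-1)d^2 + d, which relates the
   two polynomials. Cutting a tree at its root gives the functional equation. *)
From HB Require Import structures.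
From mathcomp Require Import all_boot all_order all_algebra.
From mathcomp Require Import boolp Rstruct complex mpoly.
From mathcomp Require Import zify ring.
Require Import Defs.
Set Implicit Arguments.
Unset Strict Implicit.
Unset Printing Implicit Defensive.
Import GRing.Theory.
Local Open Scope ring_scope.

(** * Spaces with functions *)

(** A partition into cells determines a class in $K_0$ only if the cells can be split off one at a
    time as closed pieces. The trees are therefore ordered so that a cell misses the charts of all
    earlier trees; a cell is then exactly what its chart adds to the union of the earlier charts.
    For the full scheme the sorted node lists are compared from the smallest word up, for the
    punctual one from the largest word down. The charts also make the orbit spaces varieties: moving
    the basis indexed by $S$ to the standard basis selects one point of each orbit in the chart and
    identifies the chart with a closed subset of the representation space. The twist
    $\mathbb{L}^{-(m-1)d(d-1)/2}$ compensates an interaction inside a forest: each of the $(m-1)i+1$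
    corners of a tree with $i$ nodes precedes all $j$ nodes below larger letters, which adds
    $((m-1)i+1)j$ to the dimension. The part $(m-1)ij$ is absorbed by
    $\binom{i+j}{2}=\binom{i}{2}+\binom{j}{2}+ij$. The remaining $j$, set against the $(m-1)d$ in
    $\binom{d+1}{2}=\binom{d}{2}+d$ that comes from the root, leaves the shifts
    $\mathbb{L}^{1-k}$. *)

Lemma predext (T : Type) (P Q : T -> Prop) : (forall x, P x <-> Q x) -> P = Q.
Proof. by move=> PQ; apply: funext => x; apply: propext. Qed.

Lemma sval_inj_Prop (T : Type) (P : T -> Prop) (x y : {x | P x}) :
  sval x = sval y -> x = y.
Proof.
by case: x y => x Px [y Py] /= xy; subst y; congr exist; exact: Prop_irrelevance.
Qed.

(* Nonvanishing loci of regular functions are open and their inverses are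
   regular there; [ringed] alone does not say so. *)
Record lringed (X : space) : Prop := LRinged {
  lringed_ringed :> ringed X;
  reg_nz : forall (U : X -> Prop) f, reg U f -> opn (fun x => U x /\ f x != 0);
  reg_inv : forall (U : X -> Prop) f, reg U f -> (forall x, U x -> f x != 0) ->
    reg U (fun x => (f x)^-1) }.


Section Ringed.
Variables (X : space) (rX : ringed X).
Implicit Types (U V : X -> Prop) (f g : X -> C).

Lemma opn_local U :
  (forall x, U x -> exists V, [/\ opn V, V x & forall y, V y -> U y]) -> opn U.
Proof.
move=> H; rewrite (_ : U = fun x => exists2 V, (opn V /\ forall y, V y -> U y) & V x).
  by apply: (opn_cup rX) => V [].
apply: predext => x; split=> [/H[V [oV Vx VU]]|[V [_ VU] /VU]//].
by exists V.
Qed.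

Lemma reg_eq U f g : reg U f -> (forall x, U x -> g x = f x) -> reg U g.
Proof. by move=> rf gf; apply: (reg_res rX rf) => //; exact: (reg_opn rX rf). Qed.

Lemma reg_sub U V f : reg U f -> opn V -> (forall x, V x -> U x) -> reg V f.
Proof. by move=> rf oV VU; exact: (reg_res rX rf). Qed.

Lemma reg_local U f : opn U ->
  (forall x, U x -> exists V g, [/\ V x, reg V g &
     forall y, U y -> V y -> f y = g y]) -> reg U f.
Proof.
move=> oU H; apply: (reg_glue rX) => // x Ux; have [V [g [Vx rg fg]]] := H x Ux.
exists (fun y => U y /\ V y); split=> // [y []//|].
apply: (reg_res rX rg) => [|y []//|y [Uy Vy]]; last exact: fg.
by apply: opn_cap => //; exact: (reg_opn rX rg).
Qed.

Lemma reg_opp U f : reg U f -> reg U (fun x => - f x).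
Proof.
move=> rf; apply: (reg_eq (reg_mul rX (reg_cst rX (-1) (reg_opn rX rf)) rf)) => x _.
by rewrite mulN1r.
Qed.

Lemma reg_sum U (I : Type) (r : seq I) (P : pred I) (F : I -> X -> C) : opn U ->
  (forall i, P i -> reg U (F i)) -> reg U (fun x => \sum_(i <- r | P i) F i x).
Proof.
move=> oU rF; elim: r => [|i r IHr].
  by apply: (reg_eq (reg_cst rX 0 oU)) => x _; rewrite big_nil.
case Pi: (P i); last by apply: (reg_eq IHr) => x _; rewrite big_cons Pi.
by apply: (reg_eq (reg_add rX (rF i Pi) IHr)) => x _; rewrite big_cons Pi.
Qed.

Lemma reg_prod U (I : Type) (r : seq I) (P : pred I) (F : I -> X -> C) : opn U ->
  (forall i, P i -> reg U (F i)) -> reg U (fun x => \prod_(i <- r | P i) F i x).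
Proof.
move=> oU rF; elim: r => [|i r IHr].
  by apply: (reg_eq (reg_cst rX 1 oU)) => x _; rewrite big_nil.
case Pi: (P i); last by apply: (reg_eq IHr) => x _; rewrite big_cons Pi.
by apply: (reg_eq (reg_mul rX (rF i Pi) IHr)) => x _; rewrite big_cons Pi.
Qed.

Lemma reg_exp U f n : reg U f -> reg U (fun x => f x ^+ n).
Proof.
move=> rf; elim: n => [|n IHn].
  exact: (reg_cst rX 1 (reg_opn rX rf)).
by apply: (reg_eq (reg_mul rX rf IHn)) => x _; rewrite exprS.
Qed.

Lemma reg_polynomial_fun_comp U (I : Type) (p : (I -> C) -> C) (f : X -> I -> C) :
  opn U -> polynomial_fun p -> (forall i, reg U (fun x => f x i)) ->
  reg U (fun x => p (f x)).
Proof.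
move=> oU [n [c [q pE]]] rf.
apply: (@reg_eq _ (fun x => \sum_(k <- msupp q) q@_k * \prod_i f x (c i) ^+ k i)).
  apply: reg_sum => // k _; apply: reg_mul => //; first exact: reg_cst.
  by apply: reg_prod => // i _; apply: reg_exp.
by move=> x _; rewrite pE mevalE.
Qed.

Lemma closed_all (T : Type) (P : T -> X -> Prop) :
  (forall t, is_closed (P t)) -> is_closed (fun x => forall t, P t x).
Proof.
move=> cP; rewrite /is_closed.
rewrite (_ : (fun x => _) =
  fun x => exists2 V, (exists t, V = fun x => ~ P t x) & V x).
  by apply: (opn_cup rX) => V [t ->]; exact: cP.
apply: predext => x; split=> [/existsNP[t Pt]|[V [t ->] Vx] /(_ t)//].
by exists (fun x => ~ P t x) => //; exists t.
Qed.

Lemma closed_cst (P : Prop) : is_closed (fun _ : X => P).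
Proof.
rewrite /is_closed; apply: opn_local => x NP.
by exists (fun _ => True); split=> //; exact: (opn_full rX).
Qed.

Lemma closed_and (P Q : X -> Prop) :
  is_closed P -> is_closed Q -> is_closed (fun x => P x /\ Q x).
Proof.
move=> cP cQ; rewrite (_ : (fun x => _) = fun x => forall b : bool, if b then P x else Q x).
  by apply: closed_all => -[].
by apply: predext => x; split=> [[Px Qx] []|H] //; split; [apply: (H true)|apply: (H false)].
Qed.

End Ringed.

Lemma closed_eq0 (X : space) (rX : lringed X) (f : X -> C) :
  reg (fun _ => True) f -> is_closed (fun x => f x = 0).
Proof.
move=> rf; rewrite /is_closed (_ : (fun x => _) = fun x => True /\ f x != 0).
  exact: reg_nz.
by apply: predext => x; split=> [/eqP|[_ /eqP]].
Qed.

Lemma lringed_affine_space (I : Set) : lringed (affine_space I).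
Proof.
have rA := @ringed_affine_space I; split=> // U f [oU Hf] => [|f0].
  apply/opn_affine => x [Ux fx0]; have [g [h [Pg Ph hx fE]]] := Hf x Ux.
  have [k [Pk kx kU]] := (opn_affine U).1 oU x Ux.
  exists (fun y => k y * (g y * h y)); split.
  - by apply: polynomial_fun_mul => //; apply: polynomial_fun_mul.
  - rewrite !mulf_neq0 //; apply: contraNneq fx0 => gx.
    by rewrite fE // gx mul0r.
  - move=> y; rewrite !mulf_eq0 !negb_or => /and3P[/kU Uy gy hy].
    by split=> //; rewrite fE // mulf_neq0 // invr_neq0.
split=> // x Ux; have [g [h [Pg Ph hx fE]]] := Hf x Ux.
have gx : g x != 0.
  by apply: contraNneq (f0 x Ux) => gx; rewrite fE // gx mul0r.
(* The inverse of $g/h$ is written $h^2/(gh)$ and not $h/g$: the denominator has to force $h \neq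
   0$, since only there is [f] known to equal $g/h$. *)
exists (fun y => h y * h y), (fun y => g y * h y); split.
- exact: polynomial_fun_mul.
- exact: polynomial_fun_mul.
- by rewrite mulf_neq0.
- move=> y Uy; rewrite mulf_eq0 negb_or => /andP[gy hy].
  by rewrite fE // invf_div -divfMr.
Qed.

Section Subspace.
Variables (X : space) (rX : ringed X) (A : X -> Prop).
Notation Y := (subspace A).

Lemma opn_subspace (V : Y -> Prop) :
  (forall y, V y -> exists U : X -> Prop,
     [/\ opn U, U (sval y) & forall z : Y, U (sval z) -> V z]) -> opn V.
Proof.
move=> H.
pose S (U : X -> Prop) := opn U /\ forall z : Y, U (sval z) -> V z.
exists (fun x => exists2 U, S U & U x); first by apply: (opn_cup rX) => U [].
move=> y; split=> [/H[U [oU Uy UV]]|[U [_ UV] /UV]//].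
by exists U.
Qed.

Lemma ringed_subspace : ringed Y.
Proof.
have cap (U V : Y -> Prop) : opn U -> opn V -> opn (fun x => U x /\ V x).
  move=> [U' oU' UE] [V' oV' VE]; exists (fun x => U' x /\ V' x).
    exact: (opn_cap rX).
  by move=> y; rewrite UE VE.
split=> //.
- by exists (fun _ => True) => //; exact: (opn_full rX).
- move=> S oS; apply: opn_subspace => y [U SU Uy]; have [U' oU' UE] := oS U SU.
  by exists U'; split=> // [|z /UE Uz]; [exact/UE|exists U].
- by move=> U f [].
- move=> U c oU; split=> // y Uy; exists (fun _ => True), (fun _ => c); split=> //.
  exact: (reg_cst rX c (opn_full rX)).
- move=> U f g [oU Hf] [_ Hg]; split=> // y Uy.
  have [V [f' [Vy rf fE]]] := Hf y Uy; have [W [g' [Wy rg gE]]] := Hg y Uy.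
  have oVW : opn (fun x => V x /\ W x).
    by apply: (opn_cap rX); [exact: (reg_opn rX rf)|exact: (reg_opn rX rg)].
  exists (fun x => V x /\ W x), (fun x => f' x + g' x); split=> //.
    apply: (reg_add rX).
      by apply: (reg_sub rX rf) => // x [].
    by apply: (reg_sub rX rg) => // x [].
  by move=> z Uz [Vz Wz]; rewrite fE // gE.
- move=> U f g [oU Hf] [_ Hg]; split=> // y Uy.
  have [V [f' [Vy rf fE]]] := Hf y Uy; have [W [g' [Wy rg gE]]] := Hg y Uy.
  have oVW : opn (fun x => V x /\ W x).
    by apply: (opn_cap rX); [exact: (reg_opn rX rf)|exact: (reg_opn rX rg)].
  exists (fun x => V x /\ W x), (fun x => f' x * g' x); split=> //.
    apply: (reg_mul rX).
      by apply: (reg_sub rX rf) => // x [].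
    by apply: (reg_sub rX rg) => // x [].
  by move=> z Uz [Vz Wz]; rewrite fE // gE.
- move=> U V f g [oU Hf] oV VU gf; split=> // y Vy.
  have [W [f' [Wy rf fE]]] := Hf y (VU y Vy).
  by exists W, f'; split=> // z Vz Wz; rewrite gf // fE //; exact: VU.
- move=> U f oU H; split=> // y Uy; have [V [Vy VU [[V' oV' VE] Hf]]] := H y Uy.
  have [W [f' [Wy rf fE]]] := Hf y Vy; exists (fun x => V' x /\ W x), f'; split=> //.
  + by split=> //; exact/VE.
  + apply: (reg_sub rX rf) => [|x []//]; apply: (opn_cap rX) => //.
    exact: (reg_opn rX rf).
  + by move=> z Uz [/VE Vz Wz]; exact: fE.
Qed.

End Subspace.

Lemma lringed_subspace (X : space) (rX : lringed X) (A : X -> Prop) :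
  lringed (subspace A).
Proof.
split=> [|U f [oU Hf]|U f [oU Hf] f0]; first exact: (ringed_subspace rX).
  apply: (opn_subspace rX) => y [Uy fy]; have [V [g [Vy rg fE]]] := Hf y Uy.
  have [U' oU' UE] := oU.
  exists (fun x => U' x /\ (V x /\ g x != 0)); split.
  - by apply: (opn_cap rX) => //; exact: reg_nz.
  - by split; [exact/UE|rewrite -fE].
  - by move=> z [/UE Uz [Vz gz]]; rewrite fE.
split=> // y Uy; have [V [g [Vy rg fE]]] := Hf y Uy.
exists (fun x => V x /\ g x != 0), (fun x => (g x)^-1); split.
- by split=> //; rewrite -fE // f0.
- apply: reg_inv => // [|x []//]; apply: (reg_sub rX rg) => [|x []//].
  exact: reg_nz.
- by move=> z Uz [Vz gz]; rewrite fE.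
Qed.

Lemma ringed_quotient (X : space) (rX : ringed X) (E : X -> X -> Prop) :
  ringed (quotient_space E).
Proof.
split.
- exact: (opn_full rX).
- by move=> U V; exact: (opn_cap rX).
- move=> S oS; apply: (opn_local rX) => x [U SU Ux].
  exists (fun y => U (class_of E y)); split=> //; first exact: oS.
  by move=> y Uy; exists U.
- by move=> U f; exact: (reg_opn rX).
- by move=> U c; exact: (reg_cst rX).
- by move=> U f g; exact: (reg_add rX).
- by move=> U f g; exact: (reg_mul rX).
- move=> U V f g rf oV VU gf; apply: (reg_res rX rf) => // x; first exact: VU.
  exact: gf.
- move=> U f oU H; apply: (reg_glue rX) => // x Ux.
  have [V [Vx VU rf]] := H _ Ux.
  by exists (fun y => V (class_of E y)); split=> // y; exact: VU.
Qed.

Lemma lringed_quotient (X : space) (rX : lringed X) (E : X -> X -> Prop) :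
  lringed (quotient_space E).
Proof.
split; first exact: (ringed_quotient rX).
- by move=> U f; exact: (reg_nz rX).
- by move=> U f rf f0; apply: (reg_inv rX) => // x; exact: f0.
Qed.

Section Morphisms.

(* f may take junk values outside of the open set U. *)
Definition morphism_on (X Y : space) (U : X -> Prop) (f : X -> Y) : Prop :=
  (forall V : Y -> Prop, opn V -> opn (fun x => U x /\ V (f x))) /\
  (forall (V : Y -> Prop) h, reg V h ->
     reg (fun x => U x /\ V (f x)) (fun x => h (f x))).

Lemma andTP (T : Type) (U P : T -> Prop) :
  (forall x, U x) -> (fun x => U x /\ P x) = P.
Proof. by move=> HU; apply: predext => x; split=> [[]|]. Qed.


Lemma morphism_onT (X Y : space) (U : X -> Prop) (f : X -> Y) :
  (forall x, U x) -> morphism_on U f <-> is_morphism f.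
Proof.
move=> HU; rewrite /morphism_on /is_morphism.
by split=> -[oF rF]; split=> V; move: (oF V) (rF V); rewrite andTP.
Qed.

Lemma morphism_on_eq (X Y : space) (rX : ringed X) (U : X -> Prop) (f g : X -> Y) :
  (forall x, U x -> f x = g x) -> morphism_on U g -> morphism_on U f.
Proof.
move=> fg [og rg].
have E (V : Y -> Prop) : (fun x => U x /\ V (f x)) = (fun x => U x /\ V (g x)).
  by apply: predext => x; split=> -[Ux]; rewrite fg.
split=> V; first by rewrite E; exact: og.
by move=> h /rg; rewrite E => r; apply: (reg_eq rX r) => x [Ux _]; rewrite fg.
Qed.

Lemma morphism_on_comp (X Y Z : space) (f : X -> Y) (V : Y -> Prop) (g : Y -> Z) :
  is_morphism f -> morphism_on V g -> morphism_on (fun x => V (f x)) (fun x => g (f x)).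
Proof.
move=> [of_ rf] [og rg]; split=> W; first by move=> /og /of_.
by move=> h /rg /rf.
Qed.

Lemma morphism_comp (X Y Z : space) (f : X -> Y) (g : Y -> Z) :
  is_morphism f -> is_morphism g -> is_morphism (fun x => g (f x)).
Proof.
move=> [of_ rf] [og rg]; split=> W; first by move=> /og /of_.
by move=> h /rg /rf.
Qed.

Lemma morphism_id (X : space) : is_morphism (fun x : X => x).
Proof. by split. Qed.

Lemma iso_sym (X Y : space) : iso X Y -> iso Y X.
Proof. by move=> [f [g [fK gK mf mg]]]; exists g, f; split. Qed.

Lemma iso_trans (Y X Z : space) : iso X Y -> iso Y Z -> iso X Z.
Proof.
move=> [f [g [fK gK mf mg]]] [f' [g' [fK' gK' mf' mg']]].
exists (fun x => f' (f x)), (fun x => g (g' x)); split.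
- by move=> x; rewrite fK' fK.
- by move=> x; rewrite gK gK'.
- exact: morphism_comp mf mf'.
- exact: morphism_comp mg' mg.
Qed.

Lemma morphism_on_affine (X : space) (rX : lringed X) (I : Set) (U : X -> Prop)
    (f : X -> affine_space I) : opn U ->
  (forall i, reg U (fun x => f x i)) -> morphism_on U f.
Proof.
move=> oU rf; have rp p : polynomial_fun p -> reg U (fun x => p (f x)).
  by move=> Pp; exact: (reg_polynomial_fun_comp rX oU Pp rf).
have oV V : opn V -> opn (fun x => U x /\ V (f x)).
  move=> /opn_affine H; apply: (opn_local rX) => x [Ux /H[p [Pp px pV]]].
  exists (fun y => U y /\ p (f y) != 0); split=> // [|y [Uy /pV]//].
  by apply: reg_nz => //; exact: rp.
split=> // V h [/oV oUV H]; apply: (reg_local rX) => // x [Ux Vx].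
have [a [b [Pa Pb bx hE]]] := H _ Vx.
have oB : opn (fun y => U y /\ b (f y) != 0) by apply: reg_nz => //; exact: rp.
exists (fun y => U y /\ b (f y) != 0), (fun y => a (f y) * (b (f y))^-1).
split=> // [|y [Uy Vy] [_ byn]]; last exact: hE.
apply: (reg_mul rX); first by apply: (reg_sub rX (rp a Pa)) => // y [].
apply: reg_inv => // [|y []//].
by apply: (reg_sub rX (rp b Pb)) => // y [].
Qed.

Lemma morphism_affine (X : space) (rX : lringed X) (I : Set)
    (f : X -> affine_space I) :
  (forall i, reg (fun _ => True) (fun x => f x i)) -> is_morphism f.
Proof.
move=> rf; apply/(@morphism_onT _ _ (fun _ => True)) => //.
by apply: morphism_on_affine => //; exact: (opn_full rX).
Qed.

Lemma morphism_sval (X : space) (rX : ringed X) (A : X -> Prop) :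
  @is_morphism (subspace A) X (fun y => sval y).
Proof.
split=> [V oV|V h rh]; first by exists V.
split; first by exists V => //; exact: (reg_opn rX rh).
by move=> y Vy; exists V, h; split.
Qed.

Lemma morphism_to_subspace (X Y : space) (rX : ringed X) (rY : ringed Y)
    (A : X -> Prop) (f : Y -> X) (fA : forall y, A (f y)) :
  is_morphism f -> @is_morphism Y (subspace A) (fun y => exist A (f y) (fA y)).
Proof.
move=> [of_ rf].
have oV (V : subspace A -> Prop) :
    opn V -> opn (fun y => V (exist A (f y) (fA y))).
  move=> [U oU VE]; rewrite (_ : (fun y => _) = fun y => U (f y)); first exact: of_.
  by apply: predext => y; rewrite VE.
split=> // V h [/oV oVf H]; apply: (reg_local rY) => // y Vy.
have [U [g [Uy rg hE]]] := H _ Vy.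
exists (fun y => U (f y)), (fun y => g (f y)); split=> //; first exact: rf.
by move=> z Vz Uz; exact: hE.
Qed.

Lemma morphism_class (X : space) (E : X -> X -> Prop) :
  @is_morphism X (quotient_space E) (class_of E).
Proof. by split. Qed.

Lemma iso_subspaces (X Y : space) (rX : ringed X) (rY : ringed Y)
    (A : X -> Prop) (B : Y -> Prop)
    (f : subspace A -> Y) (g : subspace B -> X)
    (fB : forall x, B (f x)) (gA : forall y, A (g y)) :
  is_morphism f -> is_morphism g ->
  (forall x, g (exist B (f x) (fB x)) = sval x) ->
  (forall y, f (exist A (g y) (gA y)) = sval y) ->
  iso (subspace A) (subspace B).
Proof.
move=> mf mg gf fg.
exists (fun x => exist B (f x) (fB x)), (fun y => exist A (g y) (gA y)); split.
- by move=> x; apply: sval_inj_Prop; exact: gf.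
- by move=> y; apply: sval_inj_Prop; exact: fg.
- apply: morphism_to_subspace => //; exact: ringed_subspace.
- apply: morphism_to_subspace => //; exact: ringed_subspace.
Qed.

Lemma iso_subspace_subspace (X : space) (rX : ringed X) (A B : X -> Prop) :
  (forall x, B x -> A x) ->
  iso (subspace (fun y : subspace A => B (sval y))) (subspace B).
Proof.
move=> BA; have rA := @ringed_subspace X rX A; have rB := @ringed_subspace X rX B.
pose g (z : subspace B) : subspace A := exist A (sval z) (BA _ (svalP z)).
apply: (@iso_subspaces (subspace A) X rA rX _ B
  (fun y => sval (sval y)) g (fun y => svalP y) (fun z => svalP z)) => //.
- exact: (morphism_comp (morphism_sval rA _) (morphism_sval rX _)).
- by apply: morphism_to_subspace => //; exact: morphism_sval.
- by move=> x; apply: sval_inj_Prop.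
Qed.

Lemma iso_subspace (X Y : space) (rX : ringed X) (rY : ringed Y)
    (f : X -> Y) (g : Y -> X) (A : X -> Prop) :
  cancel f g -> cancel g f -> is_morphism f -> is_morphism g ->
  iso (subspace A) (subspace (fun y => A (g y))).
Proof.
move=> fK gK mf mg.
have fA (x : subspace A) : A (g (f (sval x))) by rewrite fK; exact: svalP.
apply: (@iso_subspaces _ _ rX rY _ _ (fun x => f (sval x)) (fun y => g (sval y)) fA
  (fun y => svalP y)).
- exact: (morphism_comp (morphism_sval rX _) mf).
- exact: (morphism_comp (morphism_sval rY _) mg).
- by move=> x /=; rewrite fK.
- by move=> y /=; rewrite gK.
Qed.

Lemma iso_subspaceT (X : space) (rX : ringed X) (A : X -> Prop) :
  (forall x, A x) -> iso (subspace A) X.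
Proof.
move=> AT; exists (fun x => sval x), (fun x => exist A x (AT x)); split=> //.
- by move=> x; apply: sval_inj_Prop.
- exact: morphism_sval.
- by apply: morphism_to_subspace => //; exact: morphism_id.
Qed.

(** The function that separates [f y] from [f z] is pulled back in each factor. With an inclusion as
    [f], separatedness passes to subspaces. *)
Lemma separated_inj (X Y : space) (f : Y -> X) : is_morphism f -> injective f ->
  is_closed (fun p : prod_space X X => p.1 = p.2) ->
  is_closed (fun p : prod_space Y Y => p.1 = p.2).
Proof.
move=> [of_ rf] f_inj sX; rewrite /is_closed /= => -[y z] yz.
have {sX} /= [U [V [h [[oU oV] [Uy Vz] [n [a [b [ra rb hE]]]] hyz H]]]] :=
  sX (f y, f z) (fun e => yz (f_inj _ _ e)).
exists (fun y => U (f y)), (fun y => V (f y)), (fun p => h (f p.1, f p.2)).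
split=> //; last by move=> [y' z'] /= Uy' Vz' /(H (f y', f z') Uy' Vz') /= + yz'; rewrite yz'.
  by split; exact: of_.
exists n, (fun i y => a i (f y)), (fun i y => b i (f y)).
by split=> [i|i|[y' z']]; [exact: rf|exact: rf|exact: hE].
Qed.

End Morphisms.

(** * Products, motives and stratifications *)

Lemma polynomial_fun_prod (I T : Type) (r : seq T) (P : pred T) (F : T -> (I -> C) -> C) :
  (forall t, P t -> polynomial_fun (F t)) ->
  polynomial_fun (fun x => \prod_(t <- r | P t) F t x).
Proof.
move=> PF; elim: r => [|t r IHr].
  rewrite (_ : (fun x => _) = fun _ => 1); first exact: polynomial_fun_cst.
  by apply: funext => x; rewrite big_nil.
rewrite (_ : (fun x => _) = fun x =>
  (if P t then F t x else 1) * \prod_(t <- r | P t) F t x); last first.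
  by apply: funext => x; rewrite big_cons; case: (P t); rewrite ?mul1r.
apply: polynomial_fun_mul => //; case Pt: (P t); [exact: PF|exact: polynomial_fun_cst].
Qed.

Lemma polynomial_fun_exp (I : Type) (f : (I -> C) -> C) n :
  polynomial_fun f -> polynomial_fun (fun x => f x ^+ n).
Proof.
move=> Pf; elim: n => [|n IHn]; first exact: polynomial_fun_cst.
rewrite (_ : (fun x => _) = fun x => f x * f x ^+ n); first exact: polynomial_fun_mul.
by apply: funext => x; rewrite exprS.
Qed.

Lemma reg_coord (I : Set) (i : I) :
  @reg (affine_space I) (fun _ => True) (fun x => x i).
Proof. exact/reg_polynomial_fun/polynomial_fun_coord. Qed.

Section Reindex.
Variables (I J : Set) (k : I -> C) (r : I -> option J) (e : J -> I).
Hypothesis (eK : forall j, r (e j) = Some j).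
Hypothesis (rK : forall i j, r i = Some j -> e j = i).

(** [r] sorts the coordinates: those sent to [None] are frozen at [k], the others are free and
    renamed through [e]. Every cell will be seen to have this shape. *)
Lemma iso_coordinate_subspace :
  iso (subspace (fun x : affine_space I => forall i, r i = None -> x i = k i))
    (affine_space J).
Proof.
have rI := lringed_affine_space I; have rJ := lringed_affine_space J.
pose g (y : affine_space J) : affine_space I :=
  fun i => if r i is Some j then y j else k i.
have gA y i : r i = None -> g y i = k i by rewrite /g => ->.
have me : @is_morphism (affine_space I) (affine_space J) (fun x j => x (e j)).
  by apply: (morphism_affine rI) => j; exact: reg_coord.
have mg : is_morphism g.
  apply: (morphism_affine rJ) => i; rewrite /g; case: (r i) => [j|].
    exact: reg_coord.
  exact: (reg_cst rJ _ (opn_full rJ)).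
apply: iso_trans (iso_subspaceT rJ (A := fun _ => True) _) => //.
apply: (@iso_subspaces _ _ rI rJ _ _ (fun x j => (sval x) (e j))
  (fun y => g (sval y)) (fun _ => Logic.I) (fun y => gA (sval y))).
- exact: (morphism_comp (morphism_sval rI _) me).
- exact: (morphism_comp (morphism_sval rJ _) mg).
- move=> x; apply: funext => i; rewrite /g /=; case ri: (r i) => [j|].
    by rewrite (rK ri).
  by rewrite (svalP x).
- by move=> y; apply: funext => j; rewrite /g /= eK.
Qed.

End Reindex.

Lemma morphism_reindex (I J : Set) (e : J -> I) :
  @is_morphism (affine_space I) (affine_space J) (fun x j => x (e j)).
Proof.
apply: (morphism_affine (lringed_affine_space I)) => j.
exact: (reg_coord (e j)).
Qed.

Lemma iso_reindex (I J : Set) (e : J -> I) (e' : I -> J) : cancel e e' -> cancel e' e ->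
  iso (affine_space I) (affine_space J).
Proof.
move=> eK eK'; exists (fun x j => x (e j)), (fun y i => y (e' i)).
by split; try exact: morphism_reindex; move=> x; apply: funext => i; rewrite ?eK ?eK'.
Qed.

Lemma is_affine_closed (I : Set) n (e : idx n -> I) (e' : I -> idx n)
    (Z : affine_space I -> Prop) : cancel e e' -> cancel e' e ->
  is_closed Z -> is_affine (subspace Z).
Proof.
move=> eK eK' cZ; exists n, (fun y => Z (fun i => y (e' i))); split.
  have [oF _] := @morphism_reindex (idx n) I e'; exact: (oF _ cZ).
apply: (@iso_subspace (affine_space I) (affine_space (idx n)) _ _ (fun x j => x (e j))
  (fun y i => y (e' i))); try exact: ringed_affine_space; try exact: morphism_reindex.
  by move=> x; apply: funext => i; rewrite eK'.
by move=> x; apply: funext => i; rewrite eK.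
Qed.

Lemma is_affine_iso (X Y : space) : iso X Y -> is_affine Y -> is_affine X.
Proof.
by move=> XY [n [Z [cZ YZ]]]; exists n, Z; split=> //; exact: (iso_trans XY YZ).
Qed.

Section Product.
Variables I J : Set.

Definition merge (p : (I -> C) * (J -> C)) (k : I + J) : C :=
  match k with inl i => p.1 i | inr j => p.2 j end.

(** Each monomial factors into its variables from [I] and those from [J], so there is one summand
    per monomial; the coefficient is put into the left factor. *)
Let tensor_poly (p : (I + J -> C) -> C) : polynomial_fun p ->
  @tensor (affine_space I) (affine_space J) (fun _ => True) (fun _ => True)
    (fun z => p (merge z)).
Proof.
move=> [n [c [q pE]]].
pose isl (i : 'I_n) := if c i is inl _ then true else false.
pose m0 := nth 0%MM (msupp q).
pose ci (x : I -> C) i := if c i is inl a then x a else 1.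
pose cj (x : J -> C) i := if c i is inr b then x b else 1.
exists (size (msupp q)), (fun k x => q@_(m0 k) * \prod_(i | isl i) ci x i ^+ (m0 k) i),
  (fun k y => \prod_(i | ~~ isl i) cj y i ^+ (m0 k) i).
split.
- move=> k; apply: reg_polynomial_fun; apply: polynomial_fun_mul.
    exact: polynomial_fun_cst.
  apply: polynomial_fun_prod => i; rewrite /isl /ci; case: (c i) => // a _.
  exact/polynomial_fun_exp/polynomial_fun_coord.
- move=> k; apply: reg_polynomial_fun.
  apply: polynomial_fun_prod => i; rewrite /isl /cj; case: (c i) => // b _.
  exact/polynomial_fun_exp/polynomial_fun_coord.
- move=> [x y] /=; rewrite pE mevalE (big_nth 0%MM) big_mkord; apply: eq_bigr => k _.
  rewrite -mulrA; congr (_ * _); rewrite (bigID isl) /=; congr (_ * _).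
    by apply: eq_bigr => i; rewrite /isl /ci /merge; case: (c i).
  by apply: eq_bigr => i; rewrite /isl /cj /merge; case: (c i).
Qed.

Lemma iso_affine_prod :
  iso (affine_space (I + J)) (prod_space (affine_space I) (affine_space J)).
Proof.
have oI := opn_full (@ringed_affine_space I); have oJ := opn_full (@ringed_affine_space J).
pose f (z : affine_space (I + J)) : prod_space (affine_space I) (affine_space J) :=
  (fun i => z (inl i), fun j => z (inr j)).
pose g : prod_space (affine_space I) (affine_space J) -> affine_space (I + J) := merge.
have gK : cancel f g by move=> z; apply: funext => -[].
have fK : cancel g f by case.
have rIJ := lringed_affine_space (I + J); exists f, g; split=> //.
- have tf (U : affine_space I -> Prop) (V : affine_space J -> Prop) h :
      opn U -> opn V -> tensor U V h -> let W z := U (f z).1 /\ V (f z).2 in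
      opn W /\ reg W (fun z => h (f z)).
    move=> oU oV [n [a [b [ra rb hE]]]] W.
    have [oU' rU'] := @morphism_reindex (I + J) I inl.
    have [oV' rV'] := @morphism_reindex (I + J) J inr.
    have oW : opn W by apply: (opn_cap rIJ); [exact: oU'|exact: oV'].
    split=> //; apply: (@reg_eq _ rIJ _ (fun z => \sum_(i < n) a i (f z).1 * b i (f z).2)).
      apply: (reg_sum rIJ) => // i _; apply: (reg_mul rIJ).
        by apply: (reg_sub rIJ (rU' _ _ (ra i))) => // z [].
      by apply: (reg_sub rIJ (rV' _ _ (rb i))) => // z [].
    by move=> z _; rewrite hE.
  have oF W : @opn (prod_space (affine_space I) (affine_space J)) W ->
      opn (fun z => W (f z)).
    move=> oW; apply: (opn_local rIJ) => z /oW[U [V [h [[oU oV] [Uz Vz] th hz H]]]].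
    have [oW' rh] := tf U V h oU oV th.
    exists (fun z => (U (f z).1 /\ V (f z).2) /\ h (f z) != 0).
    split=> // [|y [[Uy Vy] hy]]; last exact: H.
    exact: (reg_nz rIJ rh).
  split=> // W h [/oF oW H]; apply: (reg_local rIJ) => // z Wz.
  have [U [V [a [b [[oU oV] [Uz Vz] [ta tb] bz hE]]]]] := H _ Wz.
  have [oW' ra] := tf U V a oU oV ta; have [_ rb] := tf U V b oU oV tb.
  have oB := reg_nz rIJ rb.
  exists (fun z => (U (f z).1 /\ V (f z).2) /\ b (f z) != 0),
    (fun z => a (f z) * (b (f z))^-1).
  split=> // [|y Wy [[Uy Vy] by0]]; last exact: hE.
  apply: (reg_mul rIJ); first by apply: (reg_sub rIJ ra) => // y [].
  apply: (reg_inv rIJ) => [|y []//].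
  by apply: (reg_sub rIJ rb) => // y [].
- have oG W : opn W -> @opn (prod_space (affine_space I) (affine_space J)) (fun z => W (g z)).
    move=> /opn_affine oW; rewrite /= => z /oW[p [Pp pz pW]].
    exists (fun _ => True), (fun _ => True), (fun z => p (g z)); split=> //.
      exact: tensor_poly.
    by move=> q _ _; exact: pW.
  split=> // W h [/oG oW H]; split=> // z Wz.
  have [a [b [Pa Pb bz hE]]] := H _ Wz.
  exists (fun _ => True), (fun _ => True), (fun z => a (g z)), (fun z => b (g z)).
  split=> //; first by split; exact: tensor_poly.
  by move=> q Wq _ _; exact: hE.
Qed.

End Product.

Section Motives.
Local Open Scope quotient_scope.

Lemma generator_rel (G : Type) (rel : term G -> term G -> Prop) x y : rel x y ->
  \pi_(presented rel) x = \pi_(presented rel) y.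
Proof. by move=> xy; apply/presentedP/cong_rel. Qed.

Definition in_loc (a : K0) : K0loc := generator _ (inl a).

Lemma in_locD a b : in_loc (a + b) = in_loc a + in_loc b.
Proof.
rewrite /in_loc /generator [RHS](@pi_add _ (@loc_rel K0 inverted) _ _).
by apply: generator_rel; constructor.
Qed.

Lemma in_locM a b : in_loc (a * b) = in_loc a * in_loc b.
Proof.
rewrite /in_loc /generator [RHS](@pi_mul _ (@loc_rel K0 inverted) _ _).
by apply: generator_rel; constructor.
Qed.

Lemma in_loc1 : in_loc 1 = 1.
Proof. by apply: generator_rel; constructor. Qed.

Lemma motive_eq (X Y : variety) : iso X Y -> motive X = motive Y.
Proof. by move=> XY; congr in_loc; apply: generator_rel; constructor. Qed.

Lemma motive_scissor (X Z U : variety) (A : X -> Prop) :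
  is_closed A -> iso Z (subspace A) -> iso U (subspace (fun x => ~ A x)) ->
  motive X = motive Z + motive U.
Proof.
move=> cA ZA UA; rewrite -in_locD; congr in_loc.
rewrite [RHS](@pi_add _ motivic_rel _ _); apply: generator_rel; exact: motivic_scissor UA.
Qed.

Lemma motive_prod (X Y P : variety) : iso P (prod_space X Y) ->
  motive P = motive X * motive Y.
Proof.
move=> PXY; rewrite -in_locM; congr in_loc.
rewrite [RHS](@pi_mul _ motivic_rel _ _).
by apply: generator_rel; constructor.
Qed.

Lemma motive_point : motive (AA 0) = 1.
Proof.
rewrite -in_loc1; congr in_loc; apply: generator_rel; constructor.
Qed.

Lemma lefschetzV : lefschetz_inv * lefschetz = 1.
Proof.
rewrite mulrC [LHS](@pi_mul _ (@loc_rel K0 inverted) _ _); apply: generator_rel.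
exact: (loc_inv (exist inverted lefschetz0 (or_introl erefl))).
Qed.

Lemma of_idx_proof n (i : idx n) : (sval i < n)%N. Proof. by case: i. Qed.
Definition of_idx n (i : idx n) : 'I_n := Ordinal (of_idx_proof i).

Lemma to_idxK n : cancel (@to_idx n) (@of_idx n).
Proof. by move=> i; apply: val_inj. Qed.

Lemma of_idxK n : cancel (@of_idx n) (@to_idx n).
Proof. by move=> [i ltin]; rewrite /to_idx /=; congr exist; exact: bool_irrelevance. Qed.

Lemma motive_AA n : motive (AA n) = lefschetz ^+ n.
Proof.
elim: n => [|n IHn]; first by rewrite expr0 motive_point.
rewrite exprSr -IHn; apply: motive_prod.
pose e (k : idx n + idx 1) : idx n.+1 :=
  match k with
  | inl i => to_idx (widen_ord (leqnSn n) (of_idx i))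
  | inr _ => to_idx ord_max end.
pose e' (k : idx n.+1) : idx n + idx 1 :=
  if unlift ord_max (of_idx k) is Some i then inl (to_idx i) else inr (to_idx ord0).
have widenE (i : 'I_n) : widen_ord (leqnSn n) i = lift ord_max i.
  by apply: val_inj; rewrite /= /bump leqNgt ltn_ord.
apply: (iso_trans (@iso_reindex _ (idx n + idx 1) e e' _ _) (iso_affine_prod _ _)).
- move=> [i|i]; rewrite /e /e' to_idxK; first by rewrite widenE liftK of_idxK.
  by rewrite unlift_none -(of_idxK i); congr (inr (to_idx _)); rewrite [RHS]ord1.
- move=> k; rewrite /e /e'; case: unliftP => [i|] kE.
    by rewrite to_idxK widenE -kE of_idxK.
  by rewrite -kE of_idxK.
Qed.

End Motives.

Lemma is_closed_eq (X : space) (A B : X -> Prop) : (forall x, A x <-> B x) ->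
  is_closed A -> is_closed B.
Proof. by move=> /predext ->. Qed.

Section Stratification.
Variables (X : space) (T : eqType) (U Z : T -> X -> Prop) (N : T -> nat).
Hypotheses (rX : ringed X) (sX : is_closed (fun p : prod_space X X => p.1 = p.2)).

Let union (s : seq T) x := exists2 t, t \in s & U t x.

Lemma is_variety_union (s : seq T) :
  (forall t, t \in s -> opn (U t)) ->
  (forall t, t \in s -> is_affine (subspace (U t))) ->
  is_variety (subspace (union s)).
Proof.
move=> oU aU; split; first exact: ringed_subspace.
  pose u (i : 'I_(size s)) (y : subspace (union s)) := U (tnth (in_tuple s) i) (sval y).
  exists (size s), u; split.
  - by move=> i; exists (U (tnth (in_tuple s) i)) => //; apply: oU; exact: mem_tnth.
  - move=> [x [t ts Ut]]; have /tnthP[i tE] : t \in in_tuple s by [].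
    by exists i; rewrite /u /= -tE.
  - move=> i; have ts : tnth (in_tuple s) i \in s by exact: mem_tnth.
    apply: is_affine_iso (aU _ ts); apply: iso_subspace_subspace => // x Ux.
    by exists (tnth (in_tuple s) i).
apply: (separated_inj (morphism_sval rX _)) sX => x y; exact: sval_inj_Prop.
Qed.

(* Each cell is closed in the union of the opens listed up to it, so the cells
   can be split off one at a time from the end of the list. *)
Lemma motive_union (s : seq T) :
  (forall t, t \in s -> opn (U t)) ->
  (forall t, t \in s -> is_affine (subspace (U t))) ->
  (forall t, t \in s -> iso (subspace (Z t)) (AA (N t))) ->
  (forall s1 t s2 x, s = s1 ++ t :: s2 ->
     Z t x <-> U t x /\ forall t', t' \in s1 -> ~ U t' x) ->
  forall h : is_variety (subspace (union s)),
    motive (Variety h) = \sum_(t <- s) lefschetz ^+ N t.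
Proof.
elim/last_ind: s => [|s t IHs] oU aU cZ ZE h.
  (* The class of the empty variety vanishes because the scissor relation splits it into two copies
     of itself. *)
  rewrite big_nil; apply: (@addrI _ (motive (Variety h))); rewrite addr0; apply/esym.
  have rE := @ringed_subspace X rX (union [::]).
  have E (A : subspace (union [::]) -> Prop) x : A x by case: x => x [].
  apply: (@motive_scissor _ _ _ (fun _ => True)).
  - by apply: (opn_subspace rX) => y; case: (E (fun _ => False) y).
  - by apply: iso_sym; apply: (iso_subspaceT rE).
  - by apply: iso_sym; apply: (iso_subspaceT rE) => x; case: (E (fun _ => False) x).
have sub t' : t' \in s -> t' \in rcons s t by move=> ts; rewrite mem_rcons inE ts orbT.
have ts : t \in rcons s t by rewrite mem_rcons mem_head.
have h' : is_variety (subspace (union s)).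
  by apply: is_variety_union => t' /sub; [exact: oU|exact: aU].
have UN x : union (rcons s t) x <-> union s x \/ U t x.
  split=> [[t']|[[t' t's Ut']|Ut]]; last by exists t.
    by rewrite mem_rcons inE => /predU1P[->|t's Ut']; [right|left; exists t'].
  by exists t' => //; exact: sub.
have ZE' x : Z t x <-> U t x /\ ~ union s x.
  rewrite (ZE s t [::]) ?cats1 //; split=> -[Ut H]; split=> //.
    by move=> [t' /H].
  by move=> t' t's Ut'; apply: H; exists t'.
rewrite big_rcons /= -motive_AA -(IHs _ _ _ _ h'); first last.
- by move=> s1 t' s2 x sE; apply: (ZE s1 t' (rcons s2 t)); rewrite sE rcons_cat.
- by move=> t' /sub; exact: cZ.
- by move=> t' /sub; exact: aU.
- by move=> t' /sub; exact: oU.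
rewrite addrC.
apply: (@motive_scissor (Variety h) (AA (N t)) (Variety h')
  (fun y : subspace (union (rcons s t)) => Z t (sval y))).
- apply: (opn_subspace rX) => -[x Ux] /= Zx.
  have [t' t's Ut'x] : union s x.
    have [//|Utx] := (UN x).1 Ux.
    by apply: contrapT => nU; apply: Zx; apply/ZE'.
  exists (U t'); split=> // [|z Ut'z]; first exact/oU/sub.
  by move=> /ZE'[_]; apply; exists t'.
- apply: (iso_trans (iso_sym (cZ t ts))); apply: iso_sym.
  by apply: iso_subspace_subspace => // x /ZE'[Ux _]; exists t.
- rewrite /= (_ : (fun y => _) = fun y : subspace (union (rcons s t)) => union s (sval y)).
    apply: iso_sym; apply: iso_subspace_subspace => // x Ux.
    by apply/UN; left.
  apply: predext => -[x Ux] /=; rewrite ZE'; split=> [nZ|Us [_]//].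
  by have [//|Ut] := (UN x).1 Ux; apply: contrapT => nU; apply: nZ.
Qed.

End Stratification.

(** * Trees of words *)

Section StrictLexicographic.
Variables (T : eqType) (r : rel T).

Fixpoint slt (s t : seq T) : bool :=
  match s, t with
  | _, [::] => false
  | [::], _ :: _ => true
  | x :: s', y :: t' => r x y || (x == y) && slt s' t'
  end.

Lemma slt_irr : irreflexive r -> irreflexive slt.
Proof. by move=> irr; elim=> //= x s ->; rewrite irr andbF. Qed.

Lemma slt_trans : transitive r -> transitive slt.
Proof.
move=> tr; elim=> [|y t IHt] [|x s] [|z u] //=.
case/orP=> [xy|/andP[/eqP-> st]]; case/orP=> [yz|/andP[/eqP<- tu]].
- by rewrite (tr _ _ _ xy yz).
- by rewrite xy.
- by rewrite yz.
- by rewrite eqxx (IHt _ _ st tu) orbT.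
Qed.

Lemma slt_total : (forall x y, x != y -> r x y || r y x) ->
  forall s t, s != t -> slt s t || slt t s.
Proof.
move=> tot; elim=> [|x s IHs] [|y t] //=; rewrite eqseq_cons.
have [->|xy _] := eqVneq x y; first by move=> /IHs /orP[] ->; rewrite !orbT.
by case/orP: (tot _ _ xy) => ->; rewrite ?orbT.
Qed.

(* s and t have the same length, so neither can be a proper prefix. *)
Lemma slt_split x0 s t : size s = size t -> slt s t -> exists i,
  [/\ (i < size s)%N, take i s = take i t & r (nth x0 s i) (nth x0 t i)].
Proof.
elim: s t => [|x s IHs] [|y t] //= [st] /orP[xy|/andP[/eqP-> /(IHs t st)]].
  by exists 0%N.
by case=> i [lti E rE]; exists i.+1; rewrite /= E.
Qed.

End StrictLexicographic.

(** [sort] works with a total relation, here the negation of the reversed strict order. Distinct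
    entries have distinct keys, which turns it back into [r]. *)
Lemma sorted_key (T K : eqType) (r : rel K) (key : T -> K) (s : seq T) :
  irreflexive r -> transitive r -> (forall x y, x != y -> r x y || r y x) ->
  {in s &, injective key} -> uniq s ->
  exists2 s', perm_eq s' s & pairwise (relpre key r) s'.
Proof.
move=> irr tr tot inj us; pose le x y := ~~ r (key y) (key x).
have le_tot : total le.
  move=> x y; rewrite /le -negb_and; apply/negP => /andP[yx xy].
  by move: (tr _ _ _ xy yx); rewrite irr.
have le_tr : transitive le.
  move=> y x z; rewrite /le => xy yz; apply/negP => zx.
  have [E|/tot] := eqVneq (key x) (key y).
    by move: yz; rewrite -E zx.
  by rewrite (negPf xy) orbF => xy'; rewrite (tr _ _ _ zx xy') in yz.
exists (sort le s); first by rewrite perm_sort.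
have : pairwise [rel x y | (x != y) && le x y] (sort le s).
  by rewrite pairwise_relI -uniq_pairwise sort_uniq us -sorted_pairwise ?sort_sorted.
apply: (sub_in_pairwise (P := mem s)); last by apply/allP => x; rewrite mem_sort.
move=> x y xs ys /andP[xy lexy]; have /tot : key x != key y.
  by apply: contra_neq xy; exact: inj.
by rewrite (negPf lexy) orbF.
Qed.

Section Words.
Variable m : nat.
Implicit Types (k l : 'I_m) (w c s : seq 'I_m).

Definition wlt : rel (seq 'I_m) := slt (fun i j : 'I_m => (i < j)%N).
Arguments wlt : simpl never.

Lemma wlt_irr : irreflexive wlt.
Proof. by apply: slt_irr => i; rewrite ltnn. Qed.

Lemma wlt_trans : transitive wlt.
Proof. by apply: slt_trans => j i k; exact: ltn_trans. Qed.

Lemma wlt_total w c : w != c -> wlt w c || wlt c w.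
Proof. by apply: slt_total => i j; rewrite -val_eqE /=; case: ltngtP. Qed.

Lemma wlt_asym w c : wlt w c -> wlt c w = false.
Proof. by move=> wc; apply/negP => /(wlt_trans wc); rewrite wlt_irr. Qed.

Lemma wlt_cons k w c : wlt (k :: w) (k :: c) = wlt w c.
Proof. by rewrite /wlt /= ltnn eqxx. Qed.

Lemma wlt_cons_lt k l w c : (k < l)%N -> wlt (k :: w) (l :: c).
Proof. by rewrite /wlt /= => ->. Qed.

Lemma wlt_rcons w k : wlt w (rcons w k).
Proof. by elim: w => [|l w IHw] //; rewrite rcons_cons wlt_cons. Qed.

End Words.

Arguments wlt {m} : simpl never.

Section Trees.
Variables (m : nat) (m_gt0 : (0 < m)%N).
Notation word := (seq 'I_m).
Implicit Types (k l : 'I_m) (w c : word) (S W : seq word) (ls : seq 'I_m).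

(* A finite prefix-closed set of words, listed in increasing order, and its
   corners: the words outside of the set whose parent belongs to it. The empty
   set has the single corner [::]. *)
Definition tree : Type := (seq word * seq word)%type.
HB.instance Definition _ := Equality.on tree.
Implicit Types T F : tree.

(** [T] may be empty; its only corner [[::]] then becomes the corner [[:: l]], recording that
    nothing hangs below [l]. *)
Definition graft l T F : tree := ([seq l :: w | w <- T.1] ++ F.1,
  [seq l :: w | w <- T.2] ++ F.2).

(* Forests with d nodes in total, one tree for each letter of ls. *)
Fixpoint forests (Tr : nat -> seq tree) ls (d : nat) : seq tree :=
  match ls with
  | [::] => if d is 0 then [:: ([::], [::])] else [::]
  | l :: ls' => [seq graft l p.1 p.2 | i <- iota 0 d.+1,
      p <- [seq (T, F) | T <- Tr i, F <- forests Tr ls' (d - i)]]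
  end.

(** [n] is fuel: the recursion passes through [forests], which calls it at all smaller sizes. By
    [trees_uptoE] any fuel [n >= d] gives the same list. *)
Fixpoint trees_upto (n d : nat) : seq tree :=
  match d, n with
  | 0, _ => [:: ([::], [:: [::]])]
  | d'.+1, n'.+1 =>
      [seq ([::] :: F.1, F.2) | F <- forests (trees_upto n') (enum 'I_m) d']
  | _, 0 => [::]
  end.

Definition trees d := trees_upto d d.

Lemma forests_cons (Tr : nat -> seq tree) l ls d : forests Tr (l :: ls) d =
  [seq graft l p.1 p.2 | i <- iota 0 d.+1,
    p <- [seq (T, F) | T <- Tr i, F <- forests Tr ls (d - i)]].
Proof. by []. Qed.

Lemma eq_forests (Tr Tr' : nat -> seq tree) ls d :
  (forall i, (i <= d)%N -> Tr i = Tr' i) -> forests Tr ls d = forests Tr' ls d.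
Proof.
elim: ls d => // l ls IHls d E; rewrite !forests_cons.
apply: (congr1 flatten); apply/eq_in_map => i; rewrite mem_iota add0n ltnS => id.
rewrite E // (IHls (d - i)%N) // => j jd.
by rewrite E // (leq_trans jd) // leq_subr.
Qed.

Lemma trees_uptoE n d : (d <= n)%N -> trees_upto n d = trees d.
Proof.
rewrite /trees; elim/ltn_ind: n d => -[|n] IHn [|d] // dn.
have IH i : (i <= d)%N -> trees_upto n i = trees_upto d i.
  by move=> id; rewrite !IHn //; lia.
by congr map; exact: eq_forests.
Qed.

Lemma trees_rec d : trees d.+1 =
  [seq ([::] :: F.1, F.2) | F <- forests trees (enum 'I_m) d].
Proof. by congr map; apply: eq_forests => i id; exact: trees_uptoE. Qed.

Definition parent_in S c := if c is l :: w then belast l w \in S else true.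

Lemma parent_in_rcons S w k : parent_in S (rcons w k) = (w \in S).
Proof. by case: w => [|l w] //=; rewrite belast_rcons. Qed.

(* The same for a forest, whose root [::] is not listed. *)
Definition parent_inF S c := if c is l :: y :: w then l :: belast y w \in S else true.

(** Origin of the number of corners: the [d >= 1] nodes have $md$ children, of which $d-1$ are nodes
    and the rest are corners. The resulting formula $(m-1)d+1$ is also right for the empty tree. *)
Record tree_spec d T : Prop := TreeSpec {
  ts_size : size T.1 = d;
  ts_corners : size T.2 = (m.-1 * d + 1)%N;
  ts_uniq : uniq T.2;
  ts_lt : pairwise (wlt) T.1;
  ts_closed : forall w, w \in T.1 -> parent_in T.1 w;
  ts_cornerE : forall c, (c \in T.2) = parent_in T.1 c && (c \notin T.1) }.

Record forest_spec ls d F : Prop := ForestSpec {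
  fs_size : size F.1 = d;
  fs_corners : size F.2 = (m.-1 * d + size ls)%N;
  fs_uniq : uniq F.2;
  fs_lt : pairwise (wlt) F.1;
  fs_nil1 : [::] \notin F.1;
  fs_nil2 : [::] \notin F.2;
  fs_closed : forall l w, l :: w \in F.1 -> (l \in ls) && parent_inF F.1 (l :: w);
  fs_cornerE : forall l w, (l :: w \in F.2) =
    [&& l \in ls, parent_inF F.1 (l :: w) & l :: w \notin F.1] }.

Definition heads_increase ls := pairwise (fun k l : 'I_m => (k < l)%N) ls.

Lemma mem_graft l (S S' : seq word) k w : (k :: w \in [seq l :: x | x <- S] ++ S') =
  (k == l) && (w \in S) || (k :: w \in S').
Proof.
rewrite mem_cat; congr (_ || _); apply/mapP/andP.
  by case=> x Sx [-> ->].
by case=> /eqP-> Sw; exists w.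
Qed.

(** Words are separated by their first letter and [l] lies below every letter of [ls]. Parents,
    corners and the increasing order can thus be checked on [T] and on [F] separately. *)
Lemma graft_spec l ls i j T F : heads_increase (l :: ls) ->
  tree_spec i T -> forest_spec ls j F -> forest_spec (l :: ls) (i + j) (graft l T F).
Proof.
case/andP=> lls _ sT sF; have llsF k w : k :: w \in F.1 -> (l < k)%N.
  by case/(fs_closed sF)/andP => kls _; exact: (allP lls).
have nl w : (l :: w \in F.1) = false by apply/negP => /llsF; rewrite ltnn.
have lls' : l \in ls = false by apply/negP => /(allP lls); rewrite ltnn.
have nl2 w : (l :: w \in F.2) = false by rewrite (fs_cornerE sF) lls'.
have pE k w : parent_inF (graft l T F).1 (k :: w) =
    if k == l then parent_in T.1 w else parent_inF F.1 (k :: w).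
  case: w => [|y w] /=; first by case: ifP.
  by rewrite mem_graft; have [->|kl] /= := eqVneq k l; rewrite ?nl ?orbF.
have [n0 n02] := (fs_nil1 sF, fs_nil2 sF).
split.
- by rewrite size_cat size_map (ts_size sT) (fs_size sF).
- by rewrite size_cat size_map (ts_corners sT) (fs_corners sF) /=; lia.
- rewrite cat_uniq map_inj_uniq ?(ts_uniq sT) ?(fs_uniq sF) ?andbT /=; last by move=> ? ? [].
  by apply/hasPn => -[|k w] Fw; apply/mapP => -[x _ //] [kl _]; rewrite kl nl2 in Fw.
- rewrite /= pairwise_cat (fs_lt sF) andbT; apply/andP; split; last first.
    rewrite pairwise_map; apply: etrans (ts_lt sT).
    by apply: eq_pairwise => w c; exact: wlt_cons.
  apply/allrelP => w c /mapP[x _ ->]; case: c => [|k c]; first by rewrite (negPf n0).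
  by move=> /llsF; exact: wlt_cons_lt.
- by rewrite mem_cat negb_or n0 andbT; apply/mapP => -[].
- by rewrite mem_cat negb_or n02 andbT; apply/mapP => -[].
- move=> k w; rewrite mem_graft pE inE; have [->|kl] /= := eqVneq k l.
    by rewrite nl orbF; exact: (ts_closed sT).
  exact: (fs_closed sF).
- move=> k w; rewrite !mem_graft pE inE; have [->|kl] /= := eqVneq k l.
    by rewrite nl nl2 !orbF (ts_cornerE sT).
  by rewrite (fs_cornerE sF).
Qed.

Lemma root_spec d F : forest_spec (enum 'I_m) d F ->
  tree_spec d.+1 ([::] :: F.1, F.2).
Proof.
move=> sF; have pE k w : parent_in ([::] :: F.1) (k :: w) = parent_inF F.1 (k :: w).
  by case: w.
split=> /=.
- by rewrite (fs_size sF).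
- by rewrite (fs_corners sF) size_enum_ord; lia.
- exact: (fs_uniq sF).
- rewrite (fs_lt sF) andbT; apply/allP => -[|l w] //.
  by rewrite (negPf (fs_nil1 sF)).
- by move=> [|l w] //; rewrite pE inE => /(fs_closed sF)/andP[].
- move=> [|l w]; first by rewrite (negPf (fs_nil2 sF)).
  by rewrite pE (fs_cornerE sF) mem_enum inE.
Qed.

Lemma heads_increase_enum : heads_increase (enum 'I_m).
Proof.
rewrite /heads_increase; have := iota_ltn_sorted 0 m; rewrite -val_enum_ord.
by rewrite (sorted_pairwise ltn_trans) pairwise_map.
Qed.

Lemma heads_increase_cons l ls : heads_increase (l :: ls) -> heads_increase ls.
Proof. by case/andP. Qed.

Lemma forestsP l ls d F : reflect
  (exists i T F', [/\ (i <= d)%N, T \in trees i, F' \in forests trees ls (d - i)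
     & F = graft l T F']) (F \in forests trees (l :: ls) d).
Proof.
apply: (iffP allpairsPdep) => [[i [p [id /allpairsP[[T F'] /= [Ti F'i ->]] ->]]]|].
  by exists i, T, F'; split=> //; move: id; rewrite mem_iota add0n ltnS.
move=> [i [T [F' [id Ti F'i ->]]]]; exists i, (T, F'); split=> //.
  by rewrite mem_iota add0n ltnS.
by apply/allpairsP; exists (T, F').
Qed.

Lemma forests_spec n : (forall i T, (i <= n)%N -> T \in trees i -> tree_spec i T) ->
  forall ls d F, (d <= n)%N -> heads_increase ls ->
  F \in forests trees ls d -> forest_spec ls d F.
Proof.
move=> IH; elim=> [|l ls IHls] d F dn hls.
  by case: d dn => // _; rewrite inE => /eqP->; split=> //=; rewrite muln0.
case/forestsP=> i [T [F' [id Ti F'i ->]]].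
have -> : d = (i + (d - i))%N by lia.
apply: graft_spec => //; first by apply: IH => //; lia.
by apply: (IHls _ _ _ (heads_increase_cons hls) F'i); lia.
Qed.

Lemma trees_spec d T : T \in trees d -> tree_spec d T.
Proof.
elim/ltn_ind: d T => -[|d] IHd T.
  by rewrite inE => /eqP->; split=> //=; try (by rewrite muln0); case.
rewrite trees_rec => /mapP[F Fd ->]; apply: root_spec.
apply: (@forests_spec d) Fd => //; last exact: heads_increase_enum.
by move=> i T' id; apply: IHd.
Qed.

(** Undoes grafting by cutting [W] at the first letters. It turns a set of words found by a greedy
    choice, in whatever order, into an entry of the explicit list [trees d]. *)
Lemma trees_complete d W : uniq W -> size W = d -> (forall w, w \in W -> parent_in W w) ->
  exists2 T, T \in trees d & T.1 =i W.
Proof.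
elim/ltn_ind: d W => d IHd W uW sW cW.
case: d IHd sW => [|d] IHd sW.
  by case: W uW sW cW => // *; exists ([::], [:: [::]]).
(* An induction on the letters inside the strong induction on [d]: what hangs below each letter has
   at most [d] nodes, one less than [W], because the root is not part of it. *)
have forests_complete ls V e : (e <= d)%N -> uniq ls -> uniq V -> size V = e ->
    [::] \notin V ->
    (forall l w, l :: w \in V -> (l \in ls) && parent_inF V (l :: w)) ->
    exists2 F, F \in forests trees ls e & F.1 =i V.
  elim: ls V e => [|l ls IHls] V e ed uls uV sV nV cV.
    case: e sV ed => [|e] sV _.
      by case: V sV {uV nV cV} => //; exists ([::], [::]); rewrite ?inE.
    case: V sV nV cV {uV} => // -[|l w] V _; first by rewrite mem_head.
    by move=> _ /(_ l w (mem_head _ _)).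
  pose a w := ohead w == Some l.
  pose V1 := [seq behead w | w <- V & a w]; pose V2 := [seq w <- V | ~~ a w].
  have V1E w : (w \in V1) = (l :: w \in V).
    apply/mapP/idP => [[[|k x]]|lw]; first by rewrite mem_filter.
      by rewrite mem_filter /a /= => /andP[/eqP[->] Vx] ->.
    by exists (l :: w); rewrite // mem_filter /a /= eqxx.
  have V2E k w : (k :: w \in V2) = (k != l) && (k :: w \in V).
    by rewrite mem_filter /a /= (inj_eq Some_inj).
  have szE : (size V1 + size V2 = e)%N.
    by rewrite size_map !size_filter -sV -(count_predC a V).
  case/andP: (uls) => nls uls'.
  have [T Ti TE] : exists2 T, T \in trees (size V1) & T.1 =i V1.
    apply: IHd => //; first by lia.
      rewrite map_inj_in_uniq ?filter_uniq // => -[|x u] [|y v]; rewrite !mem_filter /a //=.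
      by case/andP=> /eqP[->] _ /andP[/eqP[->] _] ->.
    by move=> [|y w] //; rewrite V1E => /cV /andP[_] /=; rewrite V1E.
  have [F Fi FE] : exists2 F, F \in forests trees ls (e - size V1) & F.1 =i V2.
    apply: IHls; rewrite ?filter_uniq //; first by rewrite (leq_trans (leq_subr _ _)).
        by rewrite -szE addKn.
      by rewrite mem_filter (negPf nV) andbF.
    move=> k w; rewrite V2E => /andP[kl /cV]; rewrite inE (negPf kl) /=.
    by case: w => [|y w] //=; rewrite V2E kl.
  exists (graft l T F); first by apply/forestsP; exists (size V1), T, F; split=> //; lia.
  case=> [|k w] /=.
    by rewrite mem_cat FE mem_filter (negPf nV) andbF orbF; apply/mapP => -[].
  by rewrite mem_graft TE V1E FE V2E; have [->|] := eqVneq k l; rewrite ?orbF.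
have W0 : [::] \in W.
  have [w] : exists w, w \in W by case: W sW {cW uW} => // w W _; exists w; exact: mem_head.
  elim: {w}(size w) {-2}w (erefl (size w)) => [|n IHn] w; first by case: w.
  by case: w => // l w [sw] /cW /IHn; apply; rewrite size_belast.
have [F Fd FE] : exists2 F, F \in forests trees (enum 'I_m) d & F.1 =i rem [::] W.
  apply: forests_complete; rewrite ?enum_uniq ?rem_uniq //.
  - by rewrite size_rem // sW.
  - by rewrite mem_rem_uniq // inE eqxx.
  - move=> l w; rewrite mem_rem_uniq // inE mem_enum => /andP[_ /cW].
    by case: w => [|y w] //= Wy; rewrite mem_rem_uniq // inE.
exists ([::] :: F.1, F.2); first by rewrite trees_rec; apply/mapP; exists F.
by move=> w; rewrite inE FE mem_rem_uniq // !inE; case: eqVneq => [->|].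
Qed.

End Trees.

Section TreeSums.
Variables (m : nat) (m_gt0 : (0 < m)%N).
Notation word := (seq 'I_m).
Notation tree := (tree m).
Implicit Types (k l : 'I_m) (w c : word) (S W : seq word) (ls : seq 'I_m).
Implicit Types T F : tree.

(** Only words of [T] receive the first letter [l], so filtering on the first letter recovers both
    parts. Only nodes are compared, as is needed to show that a tree is determined by its nodes. *)
Lemma graft_inj l ls j j' T T' F F' : heads_increase (l :: ls) ->
  forest_spec ls j F -> forest_spec ls j' F' ->
  (graft l T F).1 = (graft l T' F').1 -> T.1 = T'.1 /\ F.1 = F'.1.
Proof.
case/andP=> lls _ sF sF'; pose a w := ohead w == Some l.
have fT S : filter a [seq l :: w | w <- S] = [seq l :: w | w <- S].
  by apply/all_filterP/allP => _ /mapP[w _ ->]; rewrite /a /=.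
have fT' S : filter (predC a) [seq l :: w | w <- S] = [::].
  by rewrite -fT -filter_predI (eq_filter (a2 := pred0)) ?filter_pred0 // => w /=; rewrite andNb.
have aF e (X : tree) : forest_spec ls e X -> all (predC a) X.1.
  move=> sX; apply/allP => -[|k w] // /(fs_closed sX)/andP[kls _].
  by rewrite /a /= (inj_eq Some_inj) -val_eqE /= gtn_eqF //; exact: (allP lls).
move=> /= E; split.
  apply: (@inj_map _ _ (cons l)) => [? ? []//|].
  have := congr1 (filter a) E; rewrite !filter_cat !fT.
  have f0 e (X : tree) : forest_spec ls e X -> filter a X.1 = [::].
    move=> /aF aX; apply/eqP; rewrite -size_eq0 size_filter; apply/eqP.
    by apply/eqP; rewrite -leqn0 leqNgt -has_count -all_predC.
  by rewrite (f0 _ _ sF) (f0 _ _ sF') !cats0.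
have := congr1 (filter (predC a)) E; rewrite !filter_cat !fT' /=.
by move/all_filterP: (aF _ _ sF) => ->; move/all_filterP: (aF _ _ sF') => ->.
Qed.

Lemma forests_uniq n :
  (forall i, (i <= n)%N -> uniq (trees m i) /\ {in trees m i &, injective fst}) ->
  forall ls d, (d <= n)%N -> heads_increase ls ->
  uniq (forests (@trees m) ls d) /\ {in forests (@trees m) ls d &, injective fst}.
Proof.
move=> IH; elim=> [|l ls IHls] d dn hls.
  by case: d dn => // _; split=> // T T'; rewrite !inE => /eqP-> /eqP->.
have hls' := heads_increase_cons hls.
have FE e F : (e <= n)%N -> F \in forests (@trees m) ls e -> forest_spec ls e F.
  by move=> en; apply: (@forests_spec m m_gt0 n) => // i T _; exact: trees_spec.
have inj i T F i' T' F' : (i <= d)%N -> T \in trees m i ->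
    F \in forests (@trees m) ls (d - i) ->
    (i' <= d)%N -> T' \in trees m i' -> F' \in forests (@trees m) ls (d - i') ->
    (graft l T F).1 = (graft l T' F').1 -> [/\ i = i', T = T' & F = F'].
  move=> id Ti Fi i'd T'i F'i E.
  have [|//||TT FF] := graft_inj (l := l) (ls := ls) (j := (d - i)%N) (j' := (d - i')%N)
    _ _ _ E => //; try by apply: FE => //; lia.
  have ii' : i = i'.
    by rewrite -(ts_size (trees_spec m_gt0 Ti)) TT (ts_size (trees_spec m_gt0 T'i)).
  subst i'; split=> //; first by have [_ /(_ T T' Ti T'i)] := IH i (leq_trans id dn); apply.
  by have [_ /(_ F F' Fi F'i)] := IHls (d - i)%N (leq_trans (leq_subr _ _) dn) hls'; apply.
split; last first.
  move=> X X' /forestsP[i [T [F [id Ti Fi ->]]]] /forestsP[i' [T' [F' [id' Ti' Fi' ->]]]].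
  by move=> /(inj _ _ _ _ _ _ id Ti Fi id' Ti' Fi')[_ -> ->].
rewrite forests_cons; apply: allpairs_uniq_dep; first exact: iota_uniq.
  move=> i; rewrite mem_iota add0n ltnS => id; apply: allpairs_uniq.
  - by have [] := IH i (leq_trans id dn).
  - by have [] := IHls (d - i)%N (leq_trans (leq_subr _ _) dn) hls'.
  - by move=> [? ?] [? ?] _ _ [-> ->].
move=> x y /allpairsPdep[i [p [id pi ->]]] /allpairsPdep[i' [p' [id' pi' ->]]] /(congr1 fst).
case/allpairsP: pi => -[T F] /= [Ti Fi pE]; case/allpairsP: pi' => -[T' F'] /= [Ti' Fi' p'E].
rewrite {}pE {}p'E /=.
move: id id'; rewrite !mem_iota !add0n !ltnS => id id'.
by move=> /(inj _ _ _ _ _ _ id Ti Fi id' Ti' Fi')[-> -> ->].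
Qed.

Lemma trees_uniq d : uniq (trees m d) /\ {in trees m d &, injective fst}.
Proof.
elim/ltn_ind: d => -[|d] IHd.
  by split=> // T T'; rewrite !inE => /eqP-> /eqP->.
have [u inj] : uniq (forests (@trees m) (enum 'I_m) d) /\
    {in forests (@trees m) (enum 'I_m) d &, injective fst}.
  apply: (@forests_uniq d) => //; exact: heads_increase_enum.
rewrite (trees_rec m_gt0); split.
  by rewrite map_inj_in_uniq // => -[? ?] [? ?] _ _ [-> ->].
by move=> _ _ /mapP[F Fd ->] /mapP[F' F'd ->] /= [] /(inj _ _ Fd F'd) ->.
Qed.

Definition weight (r : rel word) T : nat := \sum_(c <- T.2) count (r c) T.1.

(* The dimensions of the cells of the punctual Hilbert scheme and of the full one. *)
Definition weight_gt := weight (wlt).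
Definition weight_lt := weight (fun c w => wlt w c).

Lemma weight_gt_lt d T : T \in trees m d ->
  (weight_gt T + weight_lt T = m.-1 * d ^ 2 + d)%N.
Proof.
move=> /(trees_spec m_gt0) sT; rewrite /weight_gt /weight_lt /weight -big_split /=.
rewrite (eq_big_seq (fun _ => d)) => [|c cT].
  by rewrite big_const_seq count_predT iter_addn_0 (ts_corners sT); lia.
rewrite -(ts_size sT) -(count_predC (wlt c) T.1); congr (_ + _)%N.
apply: eq_in_count => w wT /=; have ne : c != w.
  by move: cT; rewrite (ts_cornerE sT) => /andP[_]; apply: contraNneq => ->.
by have := wlt_total ne; case cw: (wlt c w) => // _; rewrite (wlt_asym cw).
Qed.

(** Each of the $(m-1)i+1$ corners coming from [T] precedes each of the [j] nodes of [F], which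
    gives the mixed term; no corner of [F] precedes a node of [T]. *)
Lemma weight_gt_graft l ls i j T F : heads_increase (l :: ls) -> tree_spec i T ->
  forest_spec ls j F ->
  weight_gt (graft l T F) = (weight_gt T + (m.-1 * i + 1) * j + weight_gt F)%N.
Proof.
case/andP=> lls _ sT sF; rewrite /weight_gt /weight /= big_cat /= big_map.
have hF (X : word) : X != [::] -> (forall k w, X = k :: w -> k \in ls) ->
    forall w, wlt (l :: w) X /\ wlt X (l :: w) = false.
  case: X => // k w _ /(_ k w erefl) kls w'; have lk : (l < k)%N by exact: (allP lls).
  by have lt := wlt_cons_lt w' w lk; split=> //; exact: wlt_asym.
congr (_ + _)%N.
  under eq_bigr => c _ do rewrite count_cat count_map.
  rewrite big_split /=; congr (_ + _)%N.
    by apply: eq_bigr => c _; apply: eq_count => w /=; rewrite wlt_cons.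
  rewrite (eq_bigr (fun _ => j)) => [|c _].
    by rewrite big_const_seq count_predT iter_addn_0 (ts_corners sT) mulnC.
  rewrite -(fs_size sF); apply/eqP; rewrite -all_count; apply/allP => w wF.
  have [|k w' wE|] // := hF w _ _ c; first by apply: contraNneq (fs_nil1 sF) => <-.
  by move: wF; rewrite wE => /(fs_closed sF)/andP[].
apply: eq_big_seq => c cF; rewrite count_cat count_map; apply/eqP.
rewrite -[eqbRHS]add0n eqn_add2r -leqn0 leqNgt -has_count; apply/hasPn => w _ /=.
have [|k c' cE|] := hF c _ _ w; last by move=> _ ->.
  by apply: contraNneq (fs_nil2 sF) => <-.
by move: cF; rewrite cE (fs_cornerE sF) => /andP[].
Qed.

End TreeSums.

(** * Power series and the functional equation for sums over trees *)

Section Series.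
Variable A : comPzRingType.
Implicit Types f g G : nat -> A.

Lemma ps_mul_eq n f f' g g' : (forall i, (i <= n)%N -> f i = f' i) ->
  (forall i, (i <= n)%N -> g i = g' i) -> ps_mul f g n = ps_mul f' g' n.
Proof.
move=> ff gg; apply: eq_bigr => i _; congr (_ * _); first by apply: ff; rewrite -ltnS.
by apply: gg; exact: leq_subr.
Qed.

Lemma ps_mulC f g : ps_mul f g =1 ps_mul g f.
Proof.
move=> n; rewrite /ps_mul (reindex_inj rev_ord_inj) /=; apply: eq_bigr => i _.
by rewrite mulrC subSS subKn // -ltnS.
Qed.

Lemma ps_mulA f g h : ps_mul f (ps_mul g h) =1 ps_mul (ps_mul f g) h.
Proof.
move=> n; pose u j k := f j * (g (n - j - k)%N * h k).
transitivity (\sum_(j < n.+1) \sum_(k < n.+1 | (k <= n - j)%N) u j k).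
  apply: eq_bigr => j _; rewrite ps_mulC /ps_mul big_distrr /=.
  rewrite (big_ord_narrow_leq (leq_subr _ _)); apply: eq_bigr => k _ /=.
  by rewrite /u [h k * _]mulrC.
rewrite ps_mulC /ps_mul (exchange_big_dep predT) //=; apply: eq_bigr => k _.
have kn : (k <= n)%N by rewrite -ltnS.
rewrite big_distrr /= (eq_bigl (fun j : 'I_n.+1 => (j <= n - k)%N)) => [|j];
  last by have := ltn_ord j; lia.
rewrite (big_ord_narrow_leq (leq_subr _ _)); apply: eq_bigr => j _ /=.
by rewrite /u mulrA mulrC; congr (_ * (_ * g _)); lia.
Qed.

Lemma ps_mul1 f : ps_mul (ps_one A) f =1 f.
Proof.
move=> n; rewrite /ps_mul big_ord_recl /ps_one mul1r subn0 big1 ?addr0 // => i _.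
by rewrite mul0r.
Qed.

HB.instance Definition _ := Monoid.isComLaw.Build (nat -> A) (ps_one A) (@ps_mul A)
  (fun f g h => funext (ps_mulA f g h)) (fun f g => funext (ps_mulC f g))
  (fun f => funext (ps_mul1 f)).

Lemma ps_tM f n : ps_mul (ps_t A) f n = if n is n'.+1 then f n' else 0.
Proof.
case: n => [|n]; first by rewrite /ps_mul big_ord1 /ps_t mul0r.
rewrite /ps_mul 2!big_ord_recl /ps_t mul0r add0r mul1r /bump /= subn1 /= big1 ?addr0 // => i _.
by rewrite mul0r.
Qed.

Variables (L Li : A) (LiL : Li * L = 1).

Definition scaled_prod k G : nat -> A :=
  \big[@ps_mul A/ps_one A]_(1 <= i < k.+1) ps_scale (Li ^+ i.-1) G.

Lemma scaled_prod_eq n k G G' : (forall i, (i <= n)%N -> G i = G' i) ->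
  scaled_prod k G n = scaled_prod k G' n.
Proof.
rewrite /scaled_prod /index_iota; elim: (iota _ _) n => [|i s IHs] n E.
  by rewrite !big_nil.
rewrite !big_cons; apply: ps_mul_eq => j jn; first by rewrite /ps_scale E.
by apply: IHs => i' i'j; rewrite E // (leq_trans i'j).
Qed.

(** Because of the factor $t$, the coefficient of $t^{d+1}$ on the right involves only the
    coefficients of [G] up to degree $d$. *)
Lemma functional_equation_uniq k G G' : G 0%N = G' 0%N ->
  G = ps_add (ps_one A) (ps_mul (ps_t A) (scaled_prod k G)) ->
  G' = ps_add (ps_one A) (ps_mul (ps_t A) (scaled_prod k G')) -> G =1 G'.
Proof.
move=> E0 GE G'E; elim/ltn_ind=> -[//|d] IHd.
rewrite GE G'E /ps_add !ps_tM; congr (_ + _); exact: scaled_prod_eq.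
Qed.

Variables (m : nat) (m_gt0 : (0 < m)%N).

Definition tree_sum d : A := \sum_(T <- trees m d) L ^+ weight_gt T.

Definition tree_series d : A := Li ^+ (m.-1 * (d * d.-1)./2) * tree_sum d.

Let forest_sum ls d : A :=
  \sum_(F <- forests (@trees m) ls d) L ^+ weight_gt F.

Let LiK n : Li ^+ n * L ^+ n = 1.
Proof. by rewrite -exprMn LiL expr1n. Qed.

Lemma forest_sum_cons l ls d : heads_increase (l :: ls) -> forest_sum (l :: ls) d =
  \sum_(i < d.+1) tree_sum i * forest_sum ls (d - i) * L ^+ ((m.-1 * i + 1) * (d - i)).
Proof.
move=> hls; rewrite /forest_sum forests_cons big_allpairs_dep.
have -> : iota 0 d.+1 = index_iota 0 d.+1 by rewrite /index_iota subn0.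
rewrite big_mkord.
apply: eq_bigr => i _; rewrite big_allpairs_dep /= !mulr_suml; apply: eq_big_seq => T Ti.
rewrite mulr_sumr mulr_suml; apply: eq_big_seq => F Fi.
have sF : forest_spec ls (d - i) F.
  apply: (@forests_spec m m_gt0 d) Fi; rewrite ?leq_subr //.
    by move=> i' T' _; exact: trees_spec.
  exact: heads_increase_cons hls.
rewrite (weight_gt_graft hls (trees_spec m_gt0 Ti) sF) !exprD.
by rewrite mulrAC.
Qed.

(* The twist is m-1 times the binomial coefficient, plus the shift accumulated
   by the factors F(L^(1-k) t) already taken. *)
Lemma scaled_prod_forest ls d : heads_increase ls ->
  scaled_prod (size ls) tree_series d =
    Li ^+ (m.-1 * 'C(d, 2) + (size ls).-1 * d) * forest_sum ls d.
Proof.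
elim: ls d => [|l ls IHls] d hls.
  rewrite /scaled_prod big_geq // /forest_sum /ps_one /=.
  case: d => [|d]; last by rewrite big_nil mulr0.
  by rewrite big_seq1 /weight_gt /weight big_nil !muln0 mul1r.
have hls' := heads_increase_cons hls.
(* The last factor, which has the largest shift $\mathbb{L}^{-|ls|}$, is matched with the tree below
   the smallest letter [l]. *)
rewrite forest_sum_cons // mulr_sumr /scaled_prod /= big_nat_recr //= ps_mulC.
apply: eq_bigr => i _; rewrite -/(scaled_prod _ _) IHls // /ps_scale /tree_series -bin2.
have id : (i <= d)%N by rewrite -ltnS.
move: (nat_of_ord i) id => {}i id; pose j := (d - i)%N.
have dE : d = (i + j)%N by rewrite subnKC.
rewrite -/j -exprM.
have binE : 'C(d, 2) = ('C(i, 2) + 'C(j, 2) + i * j)%N.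
  apply/eqP; rewrite dE -(eqn_pmul2l (isT : 0 < 2)%N) !mulnDr !mul2n.
  have bE n : ('C(n, 2)).*2 = (n * n.-1)%N.
    by elim: n => // n IHn; rewrite binS bin1 doubleD IHn; 
      case: n {IHn} => [|n] /=; rewrite ?bin0n //; nia.
  by rewrite !bE; case: (i) (j) => [|i'] [|j'] /=; apply/eqP; rewrite ?muln0 ?addn0; nia.
(* For empty [ls] the predecessor truncates and the identity of exponents fails when [j > 0]. There
   is then no forest with [j] nodes, and both sides vanish. *)
have [sls|] := boolP ((0 < size ls)%N || (j == 0%N)).
  have -> : (m.-1 * 'C(d, 2) + size ls * d = (m.-1 * 'C(j, 2) + (size ls).-1 * j)
      + (size ls * i + m.-1 * 'C(i, 2)) + (m.-1 * i + 1) * j)%N.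
    rewrite binE dE; case: (size ls) sls => [/eqP->|s _]; last by ring.
    by rewrite bin0n; ring.
  rewrite !exprD; have K := LiK ((m.-1 * i + 1) * j).
  move: K; set x := Li ^+ ((m.-1 * i + 1) * j); set y := L ^+ ((m.-1 * i + 1) * j) => K.
  by rewrite -[LHS]mulr1 -K; ring.
rewrite negb_or -eqn0Ngt => /andP[/nilP ls0 j0].
by rewrite /forest_sum ls0 /=; case: (j) j0 => // j' _; rewrite big_nil !(mulr0, mul0r).
Qed.

Lemma tree_series0 : tree_series 0 = 1.
Proof.
by rewrite /tree_series /tree_sum muln0 mul1r big_seq1 /weight_gt /weight big_seq1.
Qed.

Lemma tree_series_functional : tree_series =
  ps_add (ps_one A) (ps_mul (ps_t A) (scaled_prod m tree_series)).
Proof.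
apply: funext => -[|d]; rewrite /ps_add ps_tM /ps_one.
  by rewrite tree_series0 addr0.
rewrite add0r -[m in scaled_prod m](size_enum_ord m).
rewrite scaled_prod_forest ?heads_increase_enum // /tree_series /tree_sum (trees_rec m_gt0).
(* Pascal's rule $\binom{d+1}{2}=\binom{d}{2}+d$ yields the exponent $(m-1)d$ that
   [scaled_prod_forest] has for $m$ letters. *)
rewrite big_map /= -bin2 binS bin1 size_enum_ord mulnDr; congr (_ * _).
apply: eq_bigr => F _; congr (_ ^+ _); rewrite /weight_gt /weight /=.
(* No word precedes the root [[::]], so adding the root as a node does not change the weight. *)
by apply: eq_bigr => -[].
Qed.

End Series.

(** * Representations and normal forms *)

Section RegularMatrices.
Variables (X : space) (rX : lringed X) (U : X -> Prop) (oU : opn U).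
Let rX0 : ringed X := lringed_ringed rX.

Definition reg_mx p q (M : X -> 'M[C]_(p, q)) := forall i j, reg U (fun x => M x i j).

Lemma reg_mx_eq p q (M N : X -> 'M_(p, q)) :
  reg_mx M -> (forall x, U x -> N x = M x) -> reg_mx N.
Proof. by move=> rM NM i j; apply: (reg_eq rX (rM i j)) => x Ux; rewrite NM. Qed.

Lemma reg_mx_mul p q r (M : X -> 'M_(p, q)) (N : X -> 'M_(q, r)) :
  reg_mx M -> reg_mx N -> reg_mx (fun x => M x *m N x).
Proof.
move=> rM rN i j.
apply: (reg_eq rX (f := fun x => \sum_k M x i k * N x k j)) => [|x _]; last by rewrite mxE.
by apply: reg_sum => // k _; apply: reg_mul.
Qed.

Lemma reg_det p (M : X -> 'M_p) : reg_mx M -> reg U (fun x => \det (M x)).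
Proof.
move=> rM; apply: reg_sum => // s _; apply: reg_mul => //; first exact: reg_cst.
by apply: reg_prod.
Qed.

Lemma reg_mx_inv p (M : X -> 'M_p) : reg_mx M -> (forall x, U x -> M x \in unitmx) ->
  reg_mx (fun x => invmx (M x)).
Proof.
move=> rM uM i j.
apply: (reg_eq rX (f := fun x => (\det (M x))^-1 * \adj (M x) i j)); last first.
  by move=> x Ux; rewrite /invmx uM // mxE.
apply: (reg_mul rX).
  by apply: (reg_inv rX (reg_det rM)) => x /uM; rewrite unitmxE unitfE.
apply: (reg_eq rX (f := fun x => cofactor (M x) j i)) => [|x _]; last by rewrite mxE.
apply: (reg_mul rX); first exact: reg_cst.
by apply: reg_det => k l; apply: (reg_eq rX (rM (lift j k) (lift i l))) => x _; rewrite !mxE.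
Qed.

End RegularMatrices.

Section Representations.
Variables m d : nat.
Notation R := (rep m d).
Notation word := (seq 'I_m).
Implicit Types (x y : R) (w c : word) (S : seq word) (g h : 'M[C]_d).

Definition rep_of_mx (ops : 'I_m -> 'M[C]_d) (v : 'cV[C]_d) : R := fun i =>
  match i with
  | inl (k, i, j) => ops (of_idx k) (of_idx i) (of_idx j)
  | inr i => v (of_idx i) 0
  end.

Lemma rep_op_of_mx ops v k : rep_op (rep_of_mx ops v) k = ops k.
Proof. by apply/matrixP => i j; rewrite mxE /= !to_idxK. Qed.

Lemma rep_vec_of_mx ops v : rep_vec (rep_of_mx ops v) = v.
Proof. by apply/matrixP => i j; rewrite mxE /= !to_idxK ord1. Qed.

Lemma rep_of_mxK x : rep_of_mx (rep_op x) (rep_vec x) = x.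
Proof. by apply: funext => -[[[k i] j]|i]; rewrite /= mxE !of_idxK. Qed.

Lemma rep_eq x y : (forall k, rep_op x k = rep_op y k) -> rep_vec x = rep_vec y -> x = y.
Proof. by move=> /funext xy xyv; rewrite -(rep_of_mxK x) xy xyv rep_of_mxK. Qed.

Definition conj_rep g x : R :=
  rep_of_mx (fun k => g *m rep_op x k *m invmx g) (g *m rep_vec x).

Lemma rep_op_conj g x k : rep_op (conj_rep g x) k = g *m rep_op x k *m invmx g.
Proof. exact: rep_op_of_mx. Qed.

Lemma rep_vec_conj g x : rep_vec (conj_rep g x) = g *m rep_vec x.
Proof. exact: rep_vec_of_mx. Qed.

Lemma same_orbitP x y : same_orbit x y <-> exists2 g, g \in unitmx & y = conj_rep g x.
Proof.
split=> [[g ug [H Hv]]|[g ug ->]].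
  by exists g => //; apply: rep_eq => [k|]; rewrite ?rep_op_of_mx ?rep_vec_of_mx.
by exists g => //; split=> [k|]; rewrite ?rep_op_of_mx ?rep_vec_of_mx.
Qed.

Lemma conj_rep_comp g h x : g \in unitmx -> h \in unitmx ->
  conj_rep g (conj_rep h x) = conj_rep (g *m h) x.
Proof.
move=> ug uh; have E : invmx (g *m h) = invmx h *m invmx g.
  have ugh : g *m h \in unitmx by rewrite unitmx_mul ug.
  by apply: (can_inj (mulKmx ugh)); rewrite mulmxV // mulmxA (mulmxK uh) mulmxV.
apply: rep_eq => [k|]; rewrite ?rep_op_of_mx ?rep_vec_of_mx; last by rewrite mulmxA.
by rewrite E !mulmxA.
Qed.

Lemma conj_rep1 x : conj_rep 1%:M x = x.
Proof.
apply: rep_eq => [k|]; rewrite ?rep_op_of_mx ?rep_vec_of_mx ?mul1mx //.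
by rewrite invmx1 mulmx1.
Qed.

Lemma same_orbit_refl x : same_orbit x x.
Proof. by apply/same_orbitP; exists 1%:M; rewrite ?unitmx1 ?conj_rep1. Qed.

Lemma same_orbit_sym x y : same_orbit x y -> same_orbit y x.
Proof.
move=> /same_orbitP[g ug ->]; apply/same_orbitP; exists (invmx g); rewrite ?unitmx_inv //.
by rewrite conj_rep_comp ?unitmx_inv // mulVmx // conj_rep1.
Qed.

Lemma same_orbit_trans x y z : same_orbit x y -> same_orbit y z -> same_orbit x z.
Proof.
move=> /same_orbitP[g ug ->] /same_orbitP[h uh ->]; apply/same_orbitP.
by exists (h *m g); rewrite ?unitmx_mul ?ug ?uh ?conj_rep_comp.
Qed.

(* Words are read from the root of a tree: the first letter acts first. *)
Definition act x w (u : 'cV[C]_d) := foldl (fun u k => rep_op x k *m u) u w.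
Definition vec x w := act x w (rep_vec x).

Lemma act_rcons x w k u : act x (rcons w k) u = rep_op x k *m act x w u.
Proof. by rewrite /act foldl_rcons. Qed.

Lemma act_cat x w w' u : act x (w ++ w') u = act x w' (act x w u).
Proof. by rewrite /act foldl_cat. Qed.

Lemma vec_rcons x w k : vec x (rcons w k) = rep_op x k *m vec x w.
Proof. exact: act_rcons. Qed.

Lemma act_rep_word x w u : act x w u = rep_word x (rev w) *m u.
Proof.
rewrite /rep_word; elim/last_ind: w => [|w k IHw]; first by rewrite big_nil mul1mx.
by rewrite act_rcons rev_rcons big_cons -mulmxA IHw.
Qed.

Lemma vec_conj g x w : g \in unitmx -> vec (conj_rep g x) w = g *m vec x w.
Proof.
move=> ug; elim/last_ind: w => [|w k IHw]; first by rewrite /vec /= rep_vec_of_mx.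
by rewrite !vec_rcons IHw rep_op_of_mx -!mulmxA (mulKmx ug).
Qed.

Definition basis_mx x S : 'M[C]_d := \matrix_(i, j) vec x (nth [::] S j) i 0.

Lemma basis_mx_conj g x S : g \in unitmx -> basis_mx (conj_rep g x) S = g *m basis_mx x S.
Proof.
move=> ug; apply/matrixP => i j; rewrite !mxE vec_conj // mxE.
by apply: eq_bigr => k _; rewrite !mxE.
Qed.

Lemma basis_mx_delta x S (j : 'I_d) : vec x (nth [::] S j) = basis_mx x S *m delta_mx j 0.
Proof. by rewrite -colE; apply/matrixP => i k; rewrite !mxE ord1. Qed.

(** The point of the orbit at which the words of [S] yield the standard basis. Such points form a
    slice for the action of ${\rm GL}_d$ on the chart of [S]. *)
Definition normal_form S x := conj_rep (invmx (basis_mx x S)) x.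

Section Chart.
Variable S : seq word.

Lemma basis_mx_normal_form x : basis_mx x S \in unitmx ->
  basis_mx (normal_form S x) S = 1%:M.
Proof. by move=> ux; rewrite basis_mx_conj ?unitmx_inv // mulVmx. Qed.

Lemma normal_form_id x : basis_mx x S = 1%:M -> normal_form S x = x.
Proof. by move=> x1; rewrite /normal_form x1 invmx1 conj_rep1. Qed.

Lemma same_orbit_normal_form x : basis_mx x S \in unitmx -> same_orbit x (normal_form S x).
Proof.
by move=> ux; apply/same_orbitP; exists (invmx (basis_mx x S)); rewrite ?unitmx_inv.
Qed.

Lemma basis_mx_orbit x y : same_orbit x y ->
  (basis_mx y S \in unitmx) = (basis_mx x S \in unitmx).
Proof. by move=> /same_orbitP[g ug ->]; rewrite basis_mx_conj // unitmx_mul ug. Qed.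

Lemma normal_form_orbit x y : same_orbit x y -> basis_mx x S \in unitmx ->
  normal_form S y = normal_form S x.
Proof.
move=> /same_orbitP[g ug ->] ux; rewrite /normal_form basis_mx_conj //.
have ugx : g *m basis_mx x S \in unitmx by rewrite unitmx_mul ug.
rewrite conj_rep_comp ?unitmx_inv //; congr conj_rep.
apply: (canLR (mulKmx ugx)).
by rewrite -mulmxA (mulmxV ux) mulmx1.
Qed.

Lemma stable_basis x : uniq S -> size S = d -> basis_mx x S \in unitmx -> stable x.
Proof.
move=> uS sS ux u; pose b := invmx (basis_mx x S) *m u.
pose c w := if insub (index (rev w) S) is Some i then b i 0 else 0.
exists [seq rev w | w <- S], c; rewrite -[LHS](mulKVmx ux) -/b mulmx_suml big_map.
under eq_bigr => w _ do rewrite -scalemxAl -act_rep_word.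
rewrite (big_nth [::]) big_mkord sS; apply/matrixP => i j; rewrite ord1 mxE summxE.
apply: eq_bigr => k _; rewrite !mxE /c revK index_uniq ?sS //.
by rewrite (valK k) /b mxE mulrC.
Qed.

Lemma stable_full x (V : {vspace 'cV[C]_d}) : stable x -> rep_vec x \in V ->
  (forall k u, u \in V -> rep_op x k *m u \in V) -> forall u, u \in V.
Proof.
move=> sx vV opV u; have [s [c ->]] := sx u; rewrite mulmx_suml.
apply: memv_suml => w _; rewrite -scalemxAl memvZ //.
rewrite -[w]revK -act_rep_word; elim/last_ind: (rev w) => // w' k IHw.
by rewrite act_rcons; exact: opV.
Qed.

End Chart.

Let lrR : lringed R := lringed_affine_space _.

Lemma reg_rep_op k : reg_mx (fun _ : R => True) (fun x : R => rep_op x k).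
Proof.
move=> i j; apply: (reg_eq lrR (reg_coord _)) => x _; by rewrite mxE.
Qed.

Lemma reg_rep_vec : reg_mx (fun _ : R => True) (fun x : R => rep_vec x).
Proof. by move=> i j; apply: (reg_eq lrR (reg_coord _)) => x _; rewrite mxE. Qed.

Lemma reg_vec w : reg_mx (fun _ : R => True) (fun x : R => vec x w).
Proof.
elim/last_ind: w => [|w k IHw]; first exact: reg_rep_vec.
apply: (reg_mx_eq lrR (reg_mx_mul lrR (opn_full lrR) (reg_rep_op k) IHw)) => x _.
exact: vec_rcons.
Qed.

Lemma reg_basis_mx S : reg_mx (fun _ : R => True) (fun x : R => basis_mx x S).
Proof. by move=> i j; apply: (reg_eq lrR (reg_vec (nth [::] S j) i 0)) => x _; rewrite mxE. Qed.

Lemma opn_chart S : @opn R (fun x => basis_mx x S \in unitmx).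
Proof.
have := reg_nz lrR (reg_det lrR (opn_full lrR) (reg_basis_mx S)).
by rewrite andTP //; congr opn; apply: predext => x; rewrite unitmxE unitfE.
Qed.

Lemma reg_normal_form S (U : R -> Prop) : U = (fun x => basis_mx x S \in unitmx) ->
  [/\ forall k, reg_mx U (fun x => rep_op (normal_form S x) k),
      reg_mx U (fun x => rep_vec (normal_form S x)) &
      forall w, reg_mx U (fun x => vec (normal_form S x) w)].
Proof.
move=> UE; have oU : opn U by rewrite UE; exact: opn_chart.
have sub p q (M : R -> 'M_(p, q)) : reg_mx (fun _ => True) M -> reg_mx U M.
  by move=> rM i j; apply: (reg_sub lrR (rM i j)).
have rB := sub _ _ _ (reg_basis_mx S).
have rI : reg_mx U (fun x => invmx (basis_mx x S)).
  by apply: (reg_mx_inv lrR oU rB) => x; rewrite UE.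
have rO k : reg_mx U (fun x => rep_op (normal_form S x) k).
  apply: (reg_mx_eq lrR (reg_mx_mul lrR oU
    (reg_mx_mul lrR oU rI (sub _ _ _ (reg_rep_op k))) rB)) => x _.
  by rewrite rep_op_of_mx invmxK.
have rV : reg_mx U (fun x => rep_vec (normal_form S x)).
  apply: (reg_mx_eq lrR (reg_mx_mul lrR oU rI (sub _ _ _ reg_rep_vec))) => x _.
  exact: rep_vec_of_mx.
split=> //; elim/last_ind => [|w k IHw]; first exact: rV.
apply: (reg_mx_eq lrR (reg_mx_mul lrR oU (rO k) IHw)) => x _.
exact: vec_rcons.
Qed.

Lemma morphism_on_normal_form S :
  @morphism_on R R (fun x => basis_mx x S \in unitmx) (normal_form S).
Proof.
have [rO rV _] := reg_normal_form (erefl (fun x => is_true (basis_mx x S \in unitmx))).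
apply: (morphism_on_affine lrR); first exact: opn_chart.
case=> [[[k i] j]|i].
  apply: (reg_eq lrR (rO (of_idx k) (of_idx i) (of_idx j))) => x _.
  by rewrite -{1}(rep_of_mxK (normal_form S x)).
apply: (reg_eq lrR (rV (of_idx i) 0)) => x _.
by rewrite -{1}(rep_of_mxK (normal_form S x)).
Qed.

End Representations.

(** * Charts of the orbit spaces *)

Section OrbitSpace.
Variables m d : nat.
Notation R := (rep m d).
Notation word := (seq 'I_m).
Variable Z : R -> Prop.
Hypotheses (Zinv : forall x y, same_orbit x y -> Z x -> Z y) (cZ : is_closed Z).
Let A x := Z x /\ stable x.
Let Y := subspace A.
Let X : space := orbit_space A.
Implicit Types (S : seq word) (q : X).

Let lrR : lringed R := lringed_affine_space _.
Let rR : ringed R := lringed_ringed lrR.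
Let lrY : lringed Y := lringed_subspace lrR A.
Let rY : ringed Y := lringed_ringed lrY.

Lemma lringed_orbit_space : lringed X.
Proof. exact: lringed_quotient. Qed.
Let lrX := lringed_orbit_space.
Let rX : ringed X := lringed_ringed lrX.

Let cls (y : Y) : X := class_of (fun x y : Y => same_orbit (sval x) (sval y)) y.

Definition orbit_rep q : Y := sval (cid (svalP q)).

Lemma cls_eq (x y : Y) : same_orbit (sval x) (sval y) -> cls x = cls y.
Proof.
move=> xy; apply: sval_inj_Prop; apply: predext => z /=.
split; [exact/same_orbit_trans/same_orbit_sym|exact: same_orbit_trans].
Qed.

Lemma orbit_repK q : cls (orbit_rep q) = q.
Proof. by apply: sval_inj_Prop; rewrite /orbit_rep; case: cid. Qed.

Lemma orbit_rep_cls (x : Y) : same_orbit (sval x) (sval (orbit_rep (cls x))).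
Proof.
rewrite /orbit_rep; case: cid => y /= E.
rewrite -[same_orbit _ _]/((fun z : Y => same_orbit (sval x) (sval z)) y) E.
exact: same_orbit_refl.
Qed.

(** Both notions go through an arbitrarily chosen representative, but are constant on orbits.
    Openness and regularity are therefore verified after pulling back along [cls], where the choice
    disappears. *)
Definition in_chart S q := basis_mx (sval (orbit_rep q)) S \in unitmx.
Definition coords S q : R := normal_form S (sval (orbit_rep q)).

Lemma in_chart_cls S (x : Y) : in_chart S (cls x) = (basis_mx (sval x) S \in unitmx).
Proof. exact/basis_mx_orbit/orbit_rep_cls. Qed.

Lemma coords_cls S (x : Y) : basis_mx (sval x) S \in unitmx ->
  coords S (cls x) = normal_form S (sval x).
Proof. exact/normal_form_orbit/orbit_rep_cls. Qed.

Lemma opn_in_chart S : opn (in_chart S : X -> Prop).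
Proof.
suff H : @opn Y (fun y => in_chart S (cls y)) by exact: H.
have -> : (fun y => is_true (in_chart S (cls y))) = (fun y : Y => basis_mx (sval y) S \in unitmx).
  by apply: predext => y; rewrite in_chart_cls.
by have [oF _] := @morphism_sval _ rR A; exact: (oF _ (opn_chart d S)).
Qed.

Lemma morphism_on_coords S : @morphism_on X R (in_chart S) (coords S).
Proof.
suff H : @morphism_on Y R (fun y => in_chart S (cls y)) (fun y => coords S (cls y)) by exact: H.
have -> : (fun y => is_true (in_chart S (cls y))) = (fun y : Y => basis_mx (sval y) S \in unitmx).
  by apply: predext => y; rewrite in_chart_cls.
apply: (morphism_on_eq rY (g := fun y => normal_form S (sval y))).
  by move=> x; exact: coords_cls.
exact: (morphism_on_comp (morphism_sval rR _) (morphism_on_normal_form d S)).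
Qed.

Lemma coords_spec S q : in_chart S q ->
  [/\ basis_mx (coords S q) S = 1%:M, Z (coords S q) & stable (sval (orbit_rep q))].
Proof.
move=> uq; split; first exact: basis_mx_normal_form.
  by apply: (Zinv (same_orbit_normal_form uq)); case: (svalP (orbit_rep q)).
by case: (svalP (orbit_rep q)).
Qed.

Section Chart.
Variable S : seq word.
Hypotheses (uS : uniq S) (sS : size S = d).

(** The slice meets each orbit of the chart exactly once, so taking coordinates and taking classes
    are mutually inverse. [K] is trivial for the whole chart and is the cell condition for a
    cell. *)
Lemma chart_iso (K : R -> Prop) :
  iso (subspace (fun q : X => in_chart S q /\ K (coords S q)))
      (subspace (fun y : R => [/\ basis_mx y S = 1%:M, Z y & K y])).
Proof.
pose P q := in_chart S q /\ K (coords S q).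
pose Q y := [/\ basis_mx y S = 1%:M, Z y & K y].
have AQ (y : subspace Q) : A (sval y).
  case: y => y [/= y1 Zy _]; split=> //; apply: (@stable_basis _ _ S) => //.
  by rewrite y1 unitmx1.
pose g (y : subspace Q) : X := cls (exist A (sval y) (AQ y)).
have ug (y : subspace Q) : basis_mx (sval (exist A (sval y) (AQ y))) S \in unitmx.
  by case: y => y [/= y1 _ _]; rewrite y1 unitmx1.
have gE y : coords S (g y) = sval y.
  by rewrite coords_cls // normal_form_id //; case: y => y [].
have fQ (p : subspace P) : Q (coords S (sval p)).
  by case: p => p [/= /coords_spec[? ? _] ?].
have gP y : P (g y).
  split; first by rewrite in_chart_cls.
  by rewrite gE; case: y => y [].
apply: (@iso_subspaces _ _ rX rR P Q (fun p => coords S (sval p)) g fQ gP).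
- apply/(@morphism_onT _ _ (fun q : subspace P => in_chart S (sval q))).
    by case=> q [].
  exact: (morphism_on_comp (morphism_sval rX _) (morphism_on_coords S)).
- apply: (morphism_comp (Y := Y)); last exact: morphism_class.
  by apply: morphism_to_subspace => //; [exact: ringed_subspace|exact: morphism_sval].
- case=> q [uq Kq] /=; rewrite /g /= -[RHS]orbit_repK; apply: cls_eq => /=.
  exact/same_orbit_sym/same_orbit_normal_form.
- exact: gE.
Qed.

(** The equation [basis_mx y S = 1%:M] forces stability, which is an open condition; so the slice is
    closed in the entire affine space of representations. *)
Lemma is_affine_chart : is_affine (subspace (in_chart S : X -> Prop)).
Proof.
have -> : (fun q => is_true (in_chart S q)) = fun q => in_chart S q /\ True.
  by apply: predext => q; split=> [|[]].
apply: is_affine_iso (chart_iso (fun _ => True)) _.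
pose J : finType := ('I_m * 'I_d * 'I_d + 'I_d)%type.
pose a (t : J) : idx m * idx d * idx d + idx d := match t with
  | inl (k, i, j) => inl (to_idx k, to_idx i, to_idx j) | inr i => inr (to_idx i) end.
pose b (t : idx m * idx d * idx d + idx d) : J := match t with
  | inl (k, i, j) => inl (of_idx k, of_idx i, of_idx j) | inr i => inr (of_idx i) end.
have aK : cancel a b by case=> [[[k i] j]|i]; rewrite /= !to_idxK.
have bK : cancel b a by case=> [[[k i] j]|i]; rewrite /= !of_idxK.
pose e (n : idx #|J|) := a (enum_val (of_idx n)).
pose e' t : idx #|J| := to_idx (enum_rank (b t)).
have eK : cancel e e' by move=> n; rewrite /e /e' aK enum_valK of_idxK.
have e'K : cancel e' e by move=> t; rewrite /e /e' to_idxK enum_rankK bK.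
apply: (is_affine_closed eK e'K).
have cB : is_closed (fun y : R => basis_mx y S = 1%:M).
  have -> : (fun y : R => basis_mx y S = 1%:M) =
      (fun y => forall p : 'I_d * 'I_d, basis_mx y S p.1 p.2 - (p.1 == p.2)%:R = 0).
    apply: predext => y; split=> [-> p|H]; first by rewrite mxE subrr.
    by apply/matrixP => i j; rewrite [RHS]mxE; exact: subr0_eq (H (i, j)).
  apply: (closed_all rR) => p; apply: (closed_eq0 lrR).
  by apply: (reg_add rR (reg_basis_mx S p.1 p.2)); exact: (reg_cst rR _ (opn_full rR)).
apply: is_closed_eq (closed_and rR cB cZ) => y.
by split=> [[]|[]].
Qed.

End Chart.

Lemma reg_coords S (f : R -> C) : reg (fun _ => True) f ->
  reg (in_chart S : X -> Prop) (fun q => f (coords S q)).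
Proof.
move=> rf; have [_ /(_ _ _ rf)] := morphism_on_coords S.
by rewrite (_ : (fun x => _ /\ _) = in_chart S) //; apply: predext => q; split=> [[]|].
Qed.

(** The image of [P] contains every vector that the operators of [y] produce from its vector, hence
    everything; a surjective square matrix is invertible. *)
Lemma intertwiner_unit (x y : R) (P : 'M[C]_d) : stable y ->
  (forall k, P *m rep_op x k = rep_op y k *m P) -> P *m rep_vec x = rep_vec y ->
  P \in unitmx.
Proof.
move=> sy opP vP; have actP w : act y w (rep_vec y) = P *m act x w (rep_vec x).
  elim/last_ind: w => [|w k IHw]; first by rewrite /= vP.
  by rewrite !act_rcons IHw !mulmxA opP.
have surj (u : 'cV_d) : exists u' : 'cV_d, P *m u' = u.
  have [s [c ->]] := sy u.
  exists (\sum_(w <- s) c w *: act x (rev w) (rep_vec x)).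
  rewrite mulmx_sumr mulmx_suml; apply: eq_bigr => w _.
  by rewrite -scalemxAr -actP act_rep_word revK scalemxAl.
pose N := \matrix_(i, j) sval (cid (surj (delta_mx j 0))) i 0.
suff /mulmx1_unit[] : P *m N = 1%:M by [].
apply/matrixP => i j; rewrite !mxE.
transitivity ((P *m sval (cid (surj (delta_mx j 0)))) i 0).
  by rewrite mxE; apply: eq_bigr => k _; rewrite mxE.
by case: cid => u' /= ->; rewrite mxE eqxx andbT.
Qed.

(* Points of the charts of S and T coincide exactly when basis_mx y S
   intertwines their normal forms x and y, where basis_mx x S = 1. *)
Lemma separated_orbit_space : (forall q, exists S, [/\ uniq S, size S = d & in_chart S q]) ->
  is_closed (fun p : prod_space X X => p.1 = p.2).
Proof.
move=> cover; rewrite /is_closed /= => -[q q'] /= ne.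
have [S [uS sS Sq]] := cover q; have [T [uT sT Tq']] := cover q'.
have [xB _ _] := coords_spec Sq; have [yB _ _] := coords_spec Tq'.
have sy : stable (coords T q') by apply: (stable_basis uT sT); rewrite yB unitmx1.
(* A vector equation valid on the diagonal but not at [(q, q')] separates the two points. One
   coordinate of it is a sum of [d] products and a term for [G], hence a tensor of length [d.+1]. *)
have sep (F G : R -> 'cV[C]_d) : reg_mx (fun _ => True) F -> reg_mx (fun _ => True) G ->
    (forall p, in_chart S p -> in_chart T p ->
       basis_mx (coords T p) S *m F (coords S p) = G (coords T p)) ->
    basis_mx (coords T q') S *m F (coords S q) != G (coords T q') ->
    exists (U V : X -> Prop) h,
      [/\ opn U /\ opn V, U q /\ V q', tensor U V h, h (q, q') != 0 &
          forall p, U p.1 -> V p.2 -> h p != 0 -> ~ p.1 = p.2].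
  move=> rF rG FG ne'.
  have [i nei] : exists i, (basis_mx (coords T q') S *m F (coords S q)) i 0 != G (coords T q') i 0.
    apply: contrapT => H; case/eqP: ne'; apply/matrixP => i j; rewrite ord1.
    by apply: contrapT => Hi; apply: H; exists i; apply/eqP.
  pose h (p : X * X) := (basis_mx (coords T p.2) S *m F (coords S p.1)) i 0 - G (coords T p.2) i 0.
  exists (in_chart S), (in_chart T), h; split=> //.
  - by split; exact: opn_in_chart.
  - exists d.+1, (fun t p => if unlift ord_max t is Some j then F (coords S p) j 0 else 1),
      (fun t p => if unlift ord_max t is Some j then basis_mx (coords T p) S i j
                  else - G (coords T p) i 0); split.
    + move=> t; case: (unlift _ t) => [j|]; first exact: (reg_coords _ (rF j 0)).
      exact: (reg_cst rX _ (opn_in_chart S)).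
    + move=> t; case: (unlift _ t) => [j|]; first exact: (reg_coords _ (reg_basis_mx S i j)).
      exact/(reg_opp rX)/(reg_coords _ (rG i 0)).
    + move=> p; rewrite big_ord_recr /= unlift_none mul1r /h; congr (_ - _).
      rewrite mxE; apply: eq_bigr => j _.
      have -> : widen_ord (leqnSn d) j = lift ord_max j.
        by apply: val_inj; rewrite /= /bump leqNgt ltn_ord.
      by rewrite liftK mulrC.
  - by rewrite /h /= subr_eq0.
  - move=> [p p'] /= Sp Tp' hp pp'; subst p'; case/eqP: hp.
    by rewrite /h /= FG // subrr.
have orb p : in_chart S p -> in_chart T p -> exists2 g, g \in unitmx &
    coords T p = conj_rep g (coords S p) /\ basis_mx (coords T p) S = g.
  move=> Sp Tp; have [pB _ _] := coords_spec Sp.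
  have /same_orbitP[g ug E] : same_orbit (coords S p) (coords T p).
    by apply: same_orbit_trans (same_orbit_sym (same_orbit_normal_form _))
      (same_orbit_normal_form _).
  by exists g => //; split=> //; rewrite E basis_mx_conj // pB mulmx1.
(* The intertwining relation is an equation of matrices; it is tested column by column because [sep]
   takes vectors. *)
have [opP|] := pselect (forall k l, basis_mx (coords T q') S *m col l (rep_op (coords S q) k) =
    rep_op (coords T q') k *m col l (basis_mx (coords T q') S)); last first.
  move=> /existsNP[k /existsNP[l /eqP ne']].
  apply: (sep (fun x => col l (rep_op x k)) (fun y => rep_op y k *m col l (basis_mx y S))) => //.
  - move=> i j; apply: (reg_eq rR (reg_rep_op k i l)) => x _; by rewrite mxE.
  - apply: (reg_mx_mul lrR (opn_full rR) (reg_rep_op k)) => i j.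
    by apply: (reg_eq rR (reg_basis_mx S i l)) => x _; rewrite mxE.
  - move=> p Sp Tp; have [g ug [E ->]] := orb p Sp Tp.
    by rewrite E (rep_op_conj g) !colE !mulmxA (mulmxKV ug).
have [vP|/eqP ne'] := pselect (basis_mx (coords T q') S *m rep_vec (coords S q) =
    rep_vec (coords T q')); last first.
  apply: (sep (@rep_vec m d) (@rep_vec m d)) => //; try exact: reg_rep_vec.
  by move=> p Sp Tp; have [g ug [E ->]] := orb p Sp Tp; rewrite E (rep_vec_conj g).
case: ne; have opP' k : basis_mx (coords T q') S *m rep_op (coords S q) k =
    rep_op (coords T q') k *m basis_mx (coords T q') S.
  apply/matrixP => i l; have := opP k l; rewrite !colE !mulmxA -!colE.
  by move=> /matrixP/(_ i 0); rewrite [LHS]mxE [X in _ = X -> _]mxE.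
have uP := intertwiner_unit sy opP' vP.
rewrite -(orbit_repK q) -(orbit_repK q'); apply: cls_eq.
apply: same_orbit_trans (same_orbit_normal_form Sq) _.
apply: same_orbit_trans (same_orbit_sym (same_orbit_normal_form Tq')).
apply/same_orbitP; exists (basis_mx (coords T q') S) => //.
apply: rep_eq => [k|]; last by rewrite (rep_vec_conj (basis_mx _ _)) vP.
by rewrite (rep_op_conj (basis_mx (coords T q') S)) opP' mulmxK.
Qed.

End OrbitSpace.

(** * Cells *)

Lemma root_in m (S : seq (seq 'I_m)) w :
  (forall w, w \in S -> parent_in S w) -> w \in S -> [::] \in S.
Proof.
move=> cS; elim: {w}(size w) {-2}w (erefl (size w)) => [|n IHn] w; first by case: w.
by case: w => // l w [sw] /cS /IHn; apply; rewrite size_belast.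
Qed.

Section Cells.
Variables (m d : nat) (T : tree m) (sT : tree_spec d T) (r : rel (seq 'I_m)).
Notation R := (rep m d).
Let S := T.1.
Let node (j : 'I_d) := nth [::] S j.
Implicit Types (y : R) (i j : 'I_d) (k : 'I_m).

Let sS : size S = d := ts_size sT.

Lemma tree_nodes_uniq : uniq S.
Proof.
apply: (sorted_uniq (@wlt_trans m) (@wlt_irr m)).
by rewrite (sorted_pairwise (@wlt_trans m)) (ts_lt sT).
Qed.

Lemma node_in j : node j \in S.
Proof. by rewrite mem_nth // sS. Qed.

Lemma node_eq i j : (node i == node j) = (i == j).
Proof. by rewrite nth_uniq ?sS // tree_nodes_uniq. Qed.

Lemma nodeP w : w \in S -> exists j, w = node j.
Proof.
move=> wS; have lt : (index w S < d)%N by rewrite -sS index_mem.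
by exists (Ordinal lt); rewrite /node /= nth_index.
Qed.

Lemma vec_node y j : basis_mx y S = 1%:M -> vec y (node j) = delta_mx j 0.
Proof. by move=> y1; rewrite /node basis_mx_delta y1 mul1mx. Qed.

(** Every node but the root is the child of a node, so an induction along words makes the condition
    linear: it prescribes the vector and the columns that lead to nodes, and leaves the columns that
    lead to corners free. *)
Lemma basis_mx1P y : basis_mx y S = 1%:M <->
  (forall i, rep_vec y i 0 = (node i == [::])%:R) /\
  (forall k i j, rcons (node j) k \in S -> rep_op y k i j = (node i == rcons (node j) k)%:R).
Proof.
split=> [y1|[yv yop]].
  split=> [i|k i j kjS].
    have /nodeP[j jE] := root_in (ts_closed sT) (node_in i).
    rewrite -[rep_vec y]/(vec y [::]) jE vec_node // mxE.
    by rewrite -/node node_eq andbT.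
  have [j' j'E] := nodeP kjS.
  have := vec_node j' y1; rewrite -j'E vec_rcons vec_node // -colE => /matrixP/(_ i 0).
  by rewrite !mxE j'E node_eq andbT.
have vE w j : w \in S -> vec y w j 0 = (node j == w)%:R.
  elim/last_ind: w j => [|w k IHw] j wS; first exact: yv.
  have wS' : w \in S by rewrite -(parent_in_rcons _ _ k) (ts_closed sT).
  have [j' j'E] := nodeP wS'; rewrite vec_rcons mxE (bigD1 j') //= big1 => [|l ne].
    by rewrite IHw // j'E eqxx mulr1 addr0 yop -?j'E.
  by rewrite IHw // j'E node_eq (negPf ne) mulr0.
by apply/matrixP => i j; rewrite !mxE vE ?node_in // -/(node j) node_eq.
Qed.

(** In the slice, [rep_op y k i j] is the coefficient along node [i] of the vector at the word
    [rcons (node j) k]. At a corner, it may be nonzero only if [r] relates the corner to node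
    [i]. *)
Definition cell y := forall k i j, rcons (node j) k \notin S ->
  ~~ r (rcons (node j) k) (node i) -> rep_op y k i j = 0.

Let free : pred ('I_m * 'I_d * 'I_d) := fun t =>
  let: (k, i, j) := t in (rcons (node j) k \notin S) && r (rcons (node j) k) (node i).

(** A corner of a nonempty tree is [rcons (node j) k] for exactly one pair [(j, k)]. The corner
    [[::]] of the empty tree has no parent, but there are no nodes to count with it. *)
Lemma card_free : #|free| = weight r T.
Proof.
have countE a : count a S = (\sum_(i < d) a (node i))%N.
  by rewrite -sum1_count big_mkcond (big_nth [::]) big_mkord sS; apply: eq_bigr => i _; case: ifP.
have -> : #|free| = (\sum_j \sum_k (rcons (node j) k \notin S) * count (r (rcons (node j) k)) S)%N.
  rewrite -sum1_card big_mkcond /= exchange_big /= pair_big.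
  rewrite [RHS](eq_bigr (fun p : 'I_m * 'I_d => \sum_(i < d)
     (rcons (node p.2) p.1 \notin S) && r (rcons (node p.2) p.1) (node i)))%N; last first.
    move=> [k j] _ /=; rewrite countE; case: (_ \in S) => /=; last by rewrite mul1n.
    by rewrite mul0n big1.
  rewrite pair_big /=.
  rewrite (reindex (fun q : 'I_m * 'I_d * 'I_d => (q.1.1, q.2, q.1.2))) /=; last first.
    by exists (fun q => (q.1.1, q.2, q.1.2)) => -[[]].
  by apply: eq_bigr => -[[k j] i] _; rewrite /in_mem /= /free; case: ifP.
pose f c := count (r c) S.
pose CL := [seq c <- [seq rcons w k | w <- S, k <- enum 'I_m] | c \notin S].
transitivity (\sum_(c <- CL) f c)%N.
  rewrite [RHS]big_filter [RHS]big_mkcond [RHS]big_allpairs_dep [RHS](big_nth [::]).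
  rewrite [RHS]big_mkord sS.
  apply: eq_bigr => j _; rewrite big_enum; apply: eq_bigr => k _.
  by rewrite /f -/(node j); case: (_ \in S) => /=; rewrite ?mul1n.
rewrite /weight -/S; have [S0|/eqP S0] := eqVneq S [::].
  by rewrite !big1 // => c _; rewrite /f S0.
apply: perm_big; apply: uniq_perm.
- rewrite filter_uniq // allpairs_uniq ?tree_nodes_uniq ?enum_uniq //.
  by move=> [w k] [w' k'] _ _ /= /rcons_inj[-> ->].
- exact: (ts_uniq sT).
move=> c; rewrite mem_filter (ts_cornerE sT) -/S [RHS]andbC; apply: andb_id2l => cS.
apply/allpairsP/idP => [[[w k] /= [wS _ ->]]|]; first by rewrite parent_in_rcons.
case/lastP: c cS => [|w k] cS; last first.
  by rewrite parent_in_rcons => wS; exists (w, k); rewrite mem_enum.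
have /hasP[w wS _] : has predT S by rewrite has_predT lt0n size_eq0; exact/eqP.
by rewrite (root_in (ts_closed sT) wS) in cS.
Qed.

Let enc (t : 'I_m * 'I_d * 'I_d) : idx m * idx d * idx d + idx d :=
  inl (to_idx t.1.1, to_idx t.1.2, to_idx t.2).

Lemma cell_iso :
  iso (subspace (fun y : R => basis_mx y S = 1%:M /\ cell y)) (AA (weight r T)).
Proof.
rewrite -card_free.
pose e (n : idx #|free|) := enc (enum_val (of_idx n)).
pose dec (t : idx m * idx d * idx d + idx d) : option (idx #|free|) :=
  match t with
  | inl (k, i, j) => omap (@to_idx #|free|)
      [pick n : 'I_#|free| | enum_val n == (of_idx k, of_idx i, of_idx j)]
  | inr _ => None
  end.
(* One formula serves all frozen entries: at a corner the Kronecker symbol is zero because a corner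
   is not a node, and zero is the value that [cell] prescribes. *)
pose kappa (t : idx m * idx d * idx d + idx d) : C := match t with
  | inl (k, i, j) => (node (of_idx i) == rcons (node (of_idx j)) (of_idx k))%:R
  | inr i => (node (of_idx i) == [::])%:R end.
have eK n : dec (e n) = Some n.
  rewrite /dec /e /enc; case E: (enum_val (of_idx n)) => [[k i] j] /=.
  rewrite !to_idxK; case: pickP => [n' /eqP|/(_ (of_idx n)) /=]; last by rewrite E eqxx.
  by rewrite -E => /enum_val_inj ->; rewrite /= of_idxK.
have decK t n : dec t = Some n -> e n = t.
  case: t => [[[k i] j]|i] //=; case: pickP => //= n' /eqP E [<-].
  by rewrite /e /enc to_idxK E /= !of_idxK.
have decN k i j : dec (inl (to_idx k, to_idx i, to_idx j)) = None <-> (k, i, j) \notin free.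
  rewrite /= !to_idxK; case: pickP => [n /eqP E|H]; split=> //.
    by rewrite -E enum_valP.
  by move=> _; apply/negP => F; have := H (enum_rank_in F (k, i, j)); rewrite enum_rankK_in // eqxx.
have -> : (fun y : R => basis_mx y S = 1%:M /\ cell y) =
    (fun y => forall t, dec t = None -> y t = kappa t).
  apply: predext => y; rewrite basis_mx1P; split=> [[[yv yop] cy] [[[k i] j]|i]|H].
  - rewrite -(of_idxK k) -(of_idxK i) -(of_idxK j) => /decN; rewrite /kappa !to_idxK.
    move: (of_idx k) (of_idx i) (of_idx j) => {}k {}i {}j.
    rewrite unfold_in /= negb_and negbK; have [kjS _|kjS /= nr] := boolP (_ \in S).
      by have := yop k i j kjS; rewrite mxE.
    have := cy k i j kjS nr; rewrite mxE => ->.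
    by case: eqP => // E; rewrite -E node_in in kjS.
  - by move=> _; rewrite -(of_idxK i) /kappa to_idxK -yv mxE.
  have yopE k i j : (k, i, j) \notin free -> rep_op y k i j = (node i == rcons (node j) k)%:R.
    by move=> /decN /H; rewrite mxE /kappa !to_idxK.
  split; first split.
  - by move=> i; rewrite mxE H // /kappa to_idxK.
  - by move=> k i j kjS; apply: yopE; rewrite unfold_in /= kjS.
  - move=> k i j kjS nr; rewrite yopE; last by rewrite unfold_in /= (negPf nr) andbF.
    by case: eqP => // E; rewrite -E node_in in kjS.
exact: iso_coordinate_subspace eK decK.
Qed.

End Cells.

Lemma span_ind (K : fieldType) (V : vectType K) (P : V -> Prop) (X : seq V) v :
  P 0 -> (forall a u w, P u -> P w -> P (a *: u + w)) ->
  (forall u, u \in X -> P u) -> v \in <<X>>%VS -> P v.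
Proof.
move=> P0 PD PX; rewrite -[X]in_tupleE => /coord_span ->.
apply: big_ind => [//|u w Pu Pw|i _]; first by rewrite -[u]scale1r; exact: PD.
by rewrite -[_ *: _]addr0; apply: PD => //; apply/PX/mem_nth; exact: ltn_ord.
Qed.

(** * Simultaneous nilpotency as the vanishing of long words *)

Section Nilpotency.
Variables m d : nat.
Notation R := (rep m d).
Implicit Types (x : R) (w : seq 'I_m) (V : {vspace 'cV[C]_d}).

Lemma act_linear x w a (u v : 'cV[C]_d) : act x w (a *: u + v) = a *: act x w u + act x w v.
Proof. by rewrite !act_rep_word mulmxDr scalemxAr. Qed.

Lemma rep_word0P x w : rep_word x w = 0 <-> forall u, act x (rev w) u = 0.
Proof.
split=> [E u|H]; first by rewrite act_rep_word revK E mul0mx.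
apply/matrixP => i j; have := H (delta_mx j 0); rewrite act_rep_word revK -colE.
by move=> /matrixP/(_ i 0); rewrite !mxE.
Qed.

Lemma simul_nilpotent_words x w : simul_nilpotent x -> size w = d -> rep_word x w = 0.
Proof.
case=> F [F0 Fd _ _ FE] sw; apply/rep_word0P => u.
have {}sw : size (rev w) = d by rewrite size_rev.
suff H i : (i <= d)%N -> act x (take i (rev w)) u \in F (d - i)%N.
  by have := H d (leqnn d); rewrite take_oversize ?sw // subnn F0 memv0 => /eqP.
elim: i => [_|i IHi id]; first by rewrite take0 subn0 Fd memvf.
have k0 : 'I_m by case: (rev w) sw id => [<-|k _ _ _].
rewrite (take_nth k0) ?sw // act_rcons; apply: FE; first by lia.
by rewrite -subSn // subSS IHi // ltnW.
Qed.

(** Outside any proper subspace [V] there is a vector that all operators send into [V]: otherwise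
    some vector could be moved [n] times without entering [V], although words of length [n] vanish.
    Adjoining such vectors one by one builds the flag. *)
Lemma words_simul_nilpotent x n : (forall w, size w = n -> rep_word x w = 0) ->
  simul_nilpotent x.
Proof.
move=> x0.
have step V : V != fullv -> exists2 u, u \notin V & forall k, rep_op x k *m u \in V.
  move=> VT; have [u uV] : exists u, u \notin V.
    apply: contrapT => H; case/eqP: VT; apply/eqP; rewrite eqEsubv subvf /=.
    by apply/subvP => u _; apply: contrapT => /negP uV; apply: H; exists u.
  have : forall w, size w = n -> act x w u \in V.
    by move=> w sw; rewrite act_rep_word x0 ?size_rev // mul0mx mem0v.
  elim: n {x0} u uV => [|n IHn] u uV uw; first by have := uw [::] erefl; rewrite (negPf uV).
  have [H|] := pselect (forall k, rep_op x k *m u \in V); first by exists u.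
  move=> /existsNP[k /negP kuV]; apply: IHn kuV _ => w sw.
  by apply: (uw (k :: w)); rewrite /= sw.
pose next V := if pselect (V != fullv) is left VT
  then (V + <[ sval (cid2 (step V VT)) ]>)%VS else V.
pose F i := iter i next 0%VS.
have dT : \dim {:'cV[C]_d} = d by rewrite dimvf /dim /= muln1.
have FE i : (i < d)%N -> \dim (F i) = i ->
    exists u, [/\ F i.+1 = (F i + <[u]>)%VS, u \notin F i & forall k, rep_op x k *m u \in F i].
  move=> id dF; rewrite /F /= -/(F i) /next; case: pselect => [VT|].
    by case: cid2 => u /= uV uE; exists u.
  by case; apply: contraTneq id => E; rewrite -dF E dT ltnn.
have dF i : (i <= d)%N -> \dim (F i) = i.
  elim: i => [|i IHi] id; first by rewrite dimv0.
  have [u [-> uF _]] := FE i id (IHi (ltnW id)).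
  rewrite dimv_disjoint_sum ?IHi 1?ltnW //; last first.
    apply/eqP; rewrite -subv0; apply/subvP => w; rewrite memv_cap => /andP[wF].
    case/vlineP=> a wE; have [a0|a0] := eqVneq a 0; first by rewrite wE a0 scale0r mem0v.
    by case/negP: uF; rewrite -(scalerK a0 u) -wE memvZ.
  by rewrite dim_vline (_ : u != 0) ?addn1 //; apply: contraNneq uF => ->; rewrite mem0v.
exists F; split=> //.
- by apply/eqP; rewrite eqEdim subvf /= dF // dT.
- by move=> i id; have [u [-> _ _]] := FE i id (dF i (ltnW id)); exact: addvSl.
- have FS k i u : (i < d)%N -> u \in F i.+1 -> rep_op x k *m u \in F i.
    elim: i u => [|i IHi] u id; have [u0 [-> _ u0F]] := FE _ id (dF _ (ltnW id)).
      rewrite /F /= add0v => /vlineP[a ->]; rewrite -scalemxAr memvZ //; exact: u0F.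
    case/memv_addP=> v vF [_ /vlineP[a ->] ->]; rewrite mulmxDr -scalemxAr.
    rewrite memvD ?memvZ ?u0F //; have := IHi v (ltnW id) vF; apply: subvP.
    by have [u1 [-> _ _]] := FE i (ltnW id) (dF i (ltnW (ltnW id))); exact: addvSl.
  exact: FS.
Qed.

End Nilpotency.

Section NilpotentLocus.
Variables m d : nat.
Notation R := (rep m d).
Implicit Types (x : R) (w : seq 'I_m).

Lemma rep_word_conj (g : 'M[C]_d) x w : g \in unitmx ->
  rep_word (conj_rep g x) w = g *m rep_word x w *m invmx g.
Proof.
move=> ug; rewrite /rep_word; elim: w => [|k w IHw].
  by rewrite !big_nil mulmx1 mulmxV.
by rewrite !big_cons IHw (rep_op_conj g) !mulmxA (mulmxKV ug).
Qed.

Lemma simul_nilpotent_orbit x y : same_orbit x y -> simul_nilpotent x -> simul_nilpotent y.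
Proof.
move=> /same_orbitP[g ug ->] nx; apply: (words_simul_nilpotent (n := d)) => w sw.
by rewrite rep_word_conj // simul_nilpotent_words // mulmx0 mul0mx.
Qed.

(** The existence of a flag is not an equation; the vanishing of all words of length [d] is
    equivalent to it and is a finite system of polynomial equations. *)
Lemma closed_simul_nilpotent : is_closed (fun x : R => simul_nilpotent x).
Proof.
have lrR : lringed R := lringed_affine_space _; have rR := lringed_ringed lrR.
have rW w : reg_mx (fun _ : R => True) (fun x : R => rep_word x w).
  elim: w => [|k w IHw].
    apply: (reg_mx_eq (M := fun _ => 1%:M) lrR) => [i j|x _].
      exact: (reg_cst rR _ (opn_full rR)).
    by rewrite /rep_word big_nil.
  apply: (reg_mx_eq lrR (reg_mx_mul lrR (opn_full rR) (reg_rep_op k) IHw)) => x _.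
  by rewrite /rep_word big_cons.
apply: (is_closed_eq (A := fun x => forall p : d.-tuple 'I_m * 'I_d * 'I_d,
  rep_word x p.1.1 p.1.2 p.2 = 0)).
  move=> x; split=> [H|nx [[w i] j] /=].
    apply: (words_simul_nilpotent (n := d)) => w /eqP sw.
    by apply/matrixP => i j; rewrite mxE; exact: (H (Tuple sw, i, j)).
  by rewrite simul_nilpotent_words ?size_tuple // mxE.
by apply: (closed_all rR) => p; apply: (closed_eq0 lrR); exact: rW.
Qed.

End NilpotentLocus.

(** * The charts that a cell meets *)

Section RightOf.
Variable m : nat.
Implicit Types (w s t u : seq 'I_m).

(* s branches off w through a larger letter. *)
Fixpoint right_of w s : bool := match w, s with
  | k :: w', l :: s' => (k < l)%N || (k == l) && right_of w' s'
  | _, _ => false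
  end.

Lemma right_of_wlt w s : right_of w s -> wlt w s.
Proof.
elim: w s => [|k w IHw] [|l s] //= /orP[kl|/andP[/eqP-> /IHw]]; last by rewrite wlt_cons.
exact: wlt_cons_lt.
Qed.

Lemma wlt_right_of w s : wlt w s -> right_of w s || prefix w s.
Proof.
elim: w s => [|k w IHw] [|l s] //; rewrite /wlt /= => /orP[-> //|/andP[/eqP-> ws]].
by rewrite ltnn eqxx /=; exact: IHw.
Qed.

Lemma right_of_trans : transitive right_of.
Proof.
elim=> [|l s IHs] [|k w] [|n t] //= /orP[kl|/andP[/eqP-> ws]] /orP[ln|/andP[/eqP<- st]].
- by rewrite (ltn_trans kl ln).
- by rewrite kl.
- by rewrite ln.
- by rewrite eqxx (IHs _ _ ws st) orbT.
Qed.

(** Stability under extending either word is the reason for using [right_of]: [wlt] lacks it when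
    one word is a prefix of the other. *)
Lemma right_of_catl w s u : right_of w s -> right_of (w ++ u) s.
Proof. by elim: w s => [|k w IHw] [|l s] //= /orP[-> //|/andP[-> /IHw->]]; rewrite orbT. Qed.

Lemma right_of_catr w s u : right_of w s -> right_of w (s ++ u).
Proof. by elim: w s => [|k w IHw] [|l s] //= /orP[-> //|/andP[-> /IHw->]]; rewrite orbT. Qed.

Lemma closed_prefix (S : seq (seq 'I_m)) w s : (forall w, w \in S -> parent_in S w) ->
  prefix w s -> s \in S -> w \in S.
Proof.
move=> cS /prefixP[u ->]; elim/last_ind: u => [|u k IHu]; first by rewrite cats0.
by rewrite -rcons_cat => /cS; rewrite parent_in_rcons.
Qed.

End RightOf.

Section Order.
Variables (m d : nat) (T : tree m) (sT : tree_spec d T).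
Notation R := (rep m d).
Notation node T j := (nth [::] T.1 (nat_of_ord j)).
Implicit Types (y : R) (i j : 'I_d) (k : 'I_m).

Lemma node_lt (T' : tree m) i j : tree_spec d T' -> wlt (node T' i) (node T' j) = (i < j)%N.
Proof.
move=> sT'; have lt a b : (a < d)%N -> (b < d)%N -> (a < b)%N ->
    wlt (nth [::] T'.1 a) (nth [::] T'.1 b).
  have /pairwiseP H := ts_lt sT'.
  by move=> ad bd; apply: H; rewrite inE (ts_size sT').
case: (ltngtP i j) => [ij|ji|/val_inj->]; last exact: wlt_irr.
  by rewrite lt.
by apply: wlt_asym; exact: lt.
Qed.

(** The standard basis vector [j] is the vector at node [j] of [T]. Where [T] and [T'] share that
    node it is also column [j] of [basis_mx y T'.1], so column [i] is a combination of other
    columns. *)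
Lemma singular_basis y (T' : tree m) i : basis_mx y T.1 = 1%:M ->
  (forall j, vec y (node T' i) j 0 != 0 -> j != i /\ node T' j = node T j) ->
  basis_mx y T'.1 \notin unitmx.
Proof.
move=> y1 H; apply/negP => uy; pose z := delta_mx i 0 - vec y (node T' i) : 'cV[C]_d.
have Bz : basis_mx y T'.1 *m z = 0.
  rewrite mulmxBr -basis_mx_delta; apply/eqP; rewrite subr_eq0; apply/eqP.
  rewrite -[LHS]mul1mx -y1; apply/matrixP => a b; rewrite !mxE ord1.
  apply: eq_bigr => j _; have [->|/H[_ E]] := eqVneq (vec y (node T' i) j 0) 0.
    by rewrite !mulr0.
  by rewrite !mxE E.
have : z = 0 by rewrite -(mulKmx uy z) Bz mulmx0.
move=> /matrixP/(_ i 0); rewrite !mxE !eqxx /=.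
have [->|/H[]] := eqVneq (vec y (node T' i) i 0) 0; last by rewrite eqxx.
by rewrite subr0 => /eqP; rewrite oner_eq0.
Qed.

Section CellLt.
Variables (y : R) (y1 : basis_mx y T.1 = 1%:M).

Lemma vec_child k i j : vec y (rcons (node T j) k) i 0 = rep_op y k i j.
Proof. by rewrite vec_rcons (vec_node _ y1) -colE mxE. Qed.

(** Suppose [T'] came first and differed from [T] at index [i], so that its node there is the
    smaller one. The parent of that node is shared, hence the node is a corner of [T]; in the cell
    its vector combines smaller nodes, all shared, and the chart of [T'] is missed. *)
Lemma cell_lt_order (T' : tree m) : tree_spec d T' -> cell T (fun c w => wlt w c) y ->
  basis_mx y T'.1 \in unitmx -> T.1 = T'.1 \/ slt wlt T.1 T'.1.
Proof.
move=> sT' cy uy; have [->|ne] := eqVneq T.1 T'.1; [by left|right].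
have /orP[//|lt] := slt_total (@wlt_total m) ne.
have [|i0 []] := slt_split [::] _ lt; first by rewrite (ts_size sT) (ts_size sT').
rewrite (ts_size sT') => i0d eq_take lti0; pose i := Ordinal i0d.
have eqT j : (j < i)%N -> node T' j = node T j.
  by move=> ji; rewrite -(nth_take [::] ji) eq_take nth_take.
have nT : node T' i \notin T.1.
  apply/negP => /(nodeP sT)[j jE]; have ji : (j < i)%N by rewrite -(node_lt _ _ sT) -jE.
  have := eqT j ji; rewrite -jE => /eqP; rewrite (node_eq sT') => /eqP E.
  by rewrite E ltnn in ji.
move: uy; apply: contraTT => _; apply: (singular_basis y1 (i := i)) => l vl.
suff li : (l < i)%N by split; [rewrite neq_ltn li|exact: eqT].
have := ts_closed sT' (node_in sT' i).
case/lastP wE : (node T' i) nT vl => [|w k] nT vl.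
  by rewrite (root_in (ts_closed sT) (node_in sT i)) in nT.
rewrite parent_in_rcons => /(nodeP sT')[j jE].
have ji : (j < i)%N by rewrite -(node_lt _ _ sT') -jE wE wlt_rcons.
move: nT vl; rewrite jE eqT // vec_child => nT vl.
rewrite -(node_lt _ _ sT); apply: wlt_trans lti0.
rewrite -[nth _ T'.1 i0]/(node T' i) wE jE eqT //.
by apply: contraNT vl => nlt; rewrite (cy _ _ _ nT nlt).
Qed.

(** The cell condition speaks of corners only, but when words are compared from the largest down,
    the first new node of [T'] may have a parent outside of [T]. At a corner, [wlt] improves to
    [right_of] since no node extends a corner; applying further operators preserves [right_of]. *)
Lemma cell_gt_support w j : cell T wlt y -> w \notin T.1 -> vec y w j 0 != 0 ->
  right_of w (node T j).
Proof.
move=> cy; have child k i l : rcons (node T l) k \notin T.1 -> rep_op y k i l != 0 ->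
    right_of (rcons (node T l) k) (node T i).
  move=> nT nz; have /wlt_right_of/orP[//|pre] : wlt (rcons (node T l) k) (node T i).
    by apply: contraNT nz => nlt; rewrite (cy _ _ _ nT nlt).
  by rewrite (closed_prefix (ts_closed sT) pre) ?node_in in nT.
elim/last_ind: w j => [|w k IHw] j nT.
  by rewrite (root_in (ts_closed sT) (node_in sT j)) in nT.
have [/(nodeP sT)[l wE]|wT] := boolP (w \in T.1).
  by move: nT; rewrite wE vec_child; exact: child.
rewrite vec_rcons mxE => nz.
have [l nzl] : exists l, rep_op y k j l * vec y w l 0 != 0.
  apply: contrapT => H; case/negP: nz; apply/eqP; apply: big1 => l _.
  by apply: contrapT => /eqP nzl; apply: H; exists l.
move: nzl; rewrite mulf_eq0 negb_or => /andP[opjl /(IHw l wT) wl].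
have wl' k' : right_of (rcons w k) (rcons (node T l) k').
  by rewrite -!cats1; apply/right_of_catl/right_of_catr.
have [lkT|lkT] := boolP (rcons (node T l) k \in T.1).
  have [l' l'E] := nodeP sT lkT; move: opjl.
  have [_ yop] := (basis_mx1P sT y).1 y1; rewrite yop //.
  by case: (node T j =P _) => [-> _|]; [exact: wl'|rewrite eqxx].
exact: right_of_trans (wl' k) (child _ _ _ lkT opjl).
Qed.

(** The mirror image of [cell_lt_order]: at the last index where the trees differ, the larger node,
    if it belongs to [T'], has its vector supported on still larger nodes of [T], and these are
    shared. *)
Lemma cell_gt_order (T' : tree m) : tree_spec d T' -> cell T wlt y ->
  basis_mx y T'.1 \in unitmx ->
  T.1 = T'.1 \/ slt (fun w c => wlt c w) (rev T.1) (rev T'.1).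
Proof.
move=> sT' cy uy; have [->|ne] := eqVneq T.1 T'.1; [by left|right].
have ne' : rev T.1 != rev T'.1 by rewrite (inj_eq (can_inj revK)).
have tot (w c : seq 'I_m) : w != c -> wlt c w || wlt w c.
  by rewrite orbC; exact: wlt_total.
have /orP[//|lt] := slt_total tot ne'.
have [|i0 []] := slt_split [::] _ lt; first by rewrite !size_rev (ts_size sT) (ts_size sT').
rewrite size_rev (ts_size sT') => i0d eq_take.
rewrite !nth_rev ?(ts_size sT) ?(ts_size sT') // => lti.
have id : (d - i0.+1 < d)%N by lia.
pose i := Ordinal id.
have eqT j : (i < j)%N -> node T' j = node T j.
  rewrite /= => ij; have jd := ltn_ord j.
  have revE (U : tree m) : tree_spec d U -> node U j = nth [::] (rev U.1) (d - j.+1).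
    by move=> sU; rewrite nth_rev ?(ts_size sU); [congr nth|]; lia.
  have j'd : (d - j.+1 < i0)%N by lia.
  by rewrite !revE // -(nth_take [::] j'd) eq_take nth_take.
have nT : node T' i \notin T.1.
  apply/negP => /(nodeP sT)[j jE]; have ij : (i < j)%N by rewrite -(node_lt _ _ sT) -jE.
  have := eqT j ij; rewrite -jE => /eqP; rewrite (node_eq sT') => /eqP E.
  by rewrite E ltnn in ij.
move: uy; apply: contraTT => _; apply: (singular_basis y1 (i := i)) => l.
move=> /(cell_gt_support cy nT)/right_of_wlt wl.
suff il : (i < l)%N by split; [rewrite neq_ltn il orbT|exact: eqT].
by rewrite -(node_lt _ _ sT); exact: wlt_trans lti wl.
Qed.

(** In the basis of nodes, taken in increasing order, the operators are strictly lower triangular: a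
    child node comes after its parent, and the vector at a corner is supported on nodes after the
    corner. *)
Lemma cell_gt_nilpotent : cell T wlt y -> simul_nilpotent y.
Proof.
move=> cy; apply: (words_simul_nilpotent (n := d)) => w sw.
suff H (v : seq 'I_m) i j : rep_word y v i j != 0 -> (j + size v <= i)%N.
  apply/matrixP => i j; rewrite mxE; apply: contrapT => /eqP /H; rewrite sw.
  by have := ltn_ord i; lia.
elim: v i j => [|k v IHv] i j.
  by rewrite /rep_word big_nil mxE; case: (i =P j) => [->|]; rewrite ?eqxx ?addn0.
rewrite /rep_word big_cons -/(rep_word y v) mxE => nz.
have [l nzl] : exists l, rep_op y k i l * rep_word y v l j != 0.
  apply: contrapT => H; case/negP: nz; apply/eqP; apply: big1 => l _.
  by apply: contrapT => /eqP nzl; apply: H; exists l.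
move: nzl; rewrite mulf_eq0 negb_or => /andP[opil /IHv jl].
suff li : (l < i)%N by rewrite /=; lia.
rewrite -(node_lt _ _ sT); have lt := wlt_rcons (node T l) k.
have [lkT|lkT] := boolP (rcons (node T l) k \in T.1).
  have [_ yop] := (basis_mx1P sT y).1 y1; move: opil; rewrite yop //.
  by case: (node T i =P _) => [->|]; rewrite ?eqxx.
apply: (wlt_trans lt); apply: contraNT opil => nlt.
by rewrite (cy _ _ _ lkT nlt).
Qed.

End CellLt.

End Order.

(** * Every orbit lies in a cell *)

Section Words.
Variable m : nat.
Implicit Types (w : seq 'I_m).

Fixpoint words n : seq (seq 'I_m) :=
  if n is n'.+1 then [::] :: [seq k :: w | k <- enum 'I_m, w <- words n'] else [:: [::]].

Lemma mem_words n w : (w \in words n) = (size w <= n)%N.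
Proof.
elim: n w => [|n IHn] [|k w] //=; rewrite inE /=.
apply/allpairsP/idP => [[[l u] /= [_ uW [_ ->]]]|wn]; first by rewrite ltnS -IHn.
by exists (k, w); rewrite mem_enum IHn.
Qed.

Lemma words_lt n : pairwise wlt (words n).
Proof.
elim: n => //= n IHn; apply/andP; split.
  by apply/allP => _ /allpairsP[[k w] [_ _ ->]].
have := heads_increase_enum m; elim: (enum 'I_m) => //= l ls IHls /andP[lls hls].
rewrite pairwise_cat IHls // andbT; apply/andP; split.
  apply/allrelP => _ _ /mapP[w _ ->] /allpairsP[[k u] /= [kls _ ->]].
  by apply: wlt_cons_lt; exact: (allP lls).
rewrite pairwise_map; apply: etrans IHn.
by apply: eq_pairwise => w c; exact: wlt_cons.
Qed.

End Words.

Section Greedy.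
Variables (m d : nat) (x : rep m d).
Notation word := (seq 'I_m).
Implicit Types (w c s : word) (S W acc : seq word) (k : 'I_m).
Notation vspan S := <<map (vec x) S>>%VS.

Lemma mem_vspan S w : w \in S -> vec x w \in vspan S.
Proof. by move=> wS; apply/memv_span/map_f. Qed.

Lemma vspan_sub S W : {subset S <= W} -> (vspan S <= vspan W)%VS.
Proof. by move=> SW; apply: sub_span => _ /mapP[w wS ->]; apply/map_f/SW. Qed.

Lemma free_size S : free (map (vec x) S) -> (size S <= d)%N.
Proof.
move=> /eqP fS; rewrite -(size_map (vec x)) -fS.
by apply: leq_trans (dimvS (subvf _)) _; rewrite dimvf /dim /= muln1.
Qed.

Lemma full_size S : free (map (vec x) S) -> (forall u, u \in vspan S) -> size S = d.
Proof.
move=> /eqP fS full; rewrite -(size_map (vec x)) -fS.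
have -> : vspan S = fullv by apply/eqP; rewrite eqEsubv subvf; apply/subvP => u _.
by rewrite dimvf /dim /= muln1.
Qed.

(** Common end of both greedy choices. Passing to the normal form sends the vectors at [S] to the
    standard basis, so a dependence relation at a corner becomes the vanishing of entries required
    by [cell]. *)
Lemma cell_exists (m_gt0 : (0 < m)%N) (r : rel word) S :
  uniq S -> (forall w, w \in S -> parent_in S w) -> free (map (vec x) S) ->
  (forall u, u \in vspan S) ->
  (forall w k, w \in S -> rcons w k \notin S ->
     vec x (rcons w k) \in vspan [seq s <- S | r (rcons w k) s]) ->
  exists2 T, T \in trees m d &
    basis_mx x T.1 \in unitmx /\ @cell m d T r (normal_form T.1 x).
Proof.
move=> uS cS fS full rS; have sS := full_size fS full.
have [T Td TS] := trees_complete m_gt0 uS sS cS; exists T => //.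
have sT := trees_spec m_gt0 Td.
have ux : basis_mx x T.1 \in unitmx.
  have surj (u : 'cV[C]_d) : exists b : 'cV[C]_d, basis_mx x T.1 *m b = u.
    have := full u; apply: (span_ind (P := fun v => exists b : 'cV_d, basis_mx x T.1 *m b = v))
      => [|a v w [b <-] [b' <-]|_ /mapP[w wS ->]].
    - by exists 0; rewrite mulmx0.
    - by exists (a *: b + b'); rewrite mulmxDr scalemxAr.
    - have [|j ->] := nodeP sT (w := w); first by rewrite TS.
      by exists (delta_mx j 0); rewrite -basis_mx_delta.
  pose N := \matrix_(i, j) sval (cid (surj (delta_mx j 0))) i 0.
  suff /mulmx1_unit[] : basis_mx x T.1 *m N = 1%:M by [].
  apply/matrixP => i j; rewrite [LHS]mxE.
  transitivity ((basis_mx x T.1 *m sval (cid (surj (delta_mx j 0)))) i 0).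
    by rewrite [RHS]mxE; apply: eq_bigr => k _; congr (_ * _); rewrite mxE.
  by case: cid => b /= ->; rewrite !mxE eqxx andbT.
split=> // k i j nT nr; set y := normal_form T.1 x.
have y1 : basis_mx y T.1 = 1%:M by exact: basis_mx_normal_form.
have uB : invmx (basis_mx x T.1) \in unitmx by rewrite unitmx_inv.
rewrite -(vec_child y1) (vec_conj _ _ uB).
have wS : nth [::] T.1 j \in S by rewrite -TS (node_in sT).
rewrite TS in nT; have := rS _ k wS nT.
apply: (span_ind (P := fun v => (invmx (basis_mx x T.1) *m v) i 0 = 0)) => [|a v v'|_ /mapP[s + ->]].
- by rewrite mulmx0 mxE.
- by rewrite mulmxDr -scalemxAr => E E'; rewrite mxE [X in X + _]mxE E E' mulr0 addr0.
rewrite mem_filter => /andP[rs sS']; rewrite -TS in sS'.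
have [l lE] := nodeP sT sS'; rewrite -(vec_conj _ _ uB) -/(normal_form T.1 x) -/y lE.
rewrite (vec_node _ y1) mxE andbT; case: eqP => // il.
by rewrite il -lE rs in nr.
Qed.

Lemma vspan_full S : stable x -> (forall w, w \in S -> forall k, vec x (rcons w k) \in vspan S) ->
  vec x [::] \in vspan S -> forall u, u \in vspan S.
Proof.
move=> sx opS vS; apply: (stable_full sx) => // k u.
apply: (span_ind (P := fun u => rep_op x k *m u \in vspan S)).
- by rewrite mulmx0 mem0v.
- by move=> a v w vv vw; rewrite mulmxDr -scalemxAr memvD ?memvZ.
- by move=> _ /mapP[w wS ->]; rewrite -vec_rcons; exact: opS.
Qed.

Section Tree.

(** The parent test cannot be left to independence here. If $\varphi_0 v = v$ and $\varphi_1 v$ is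
    independent of $v$, then the word $01$ precedes $1$ and would be chosen although $0$ is
    rejected. *)
Fixpoint greedy_tree acc W : seq word :=
  if W is w :: W' then
    if parent_in acc w && (vec x w \notin vspan acc) then greedy_tree (rcons acc w) W'
    else greedy_tree acc W'
  else acc.

Lemma parent_in_sub acc acc' w : {subset acc <= acc'} -> parent_in acc w -> parent_in acc' w.
Proof. by move=> sub; case: w => //= k w; exact: sub. Qed.

Lemma free_rcons acc w : free (map (vec x) acc) -> vec x w \notin vspan acc ->
  free (map (vec x) (rcons acc w)).
Proof.
by move=> f nv; rewrite map_rcons (perm_free (permEl (perm_rcons _ _))) free_cons nv.
Qed.

Lemma greedy_tree_spec W acc : pairwise wlt (acc ++ W) ->
  free (map (vec x) acc) -> (forall w, w \in acc -> parent_in acc w) ->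
  let S := greedy_tree acc W in
  [/\ {subset acc <= S} /\ {subset S <= acc ++ W}, free (map (vec x) S), uniq S,
      forall w, w \in S -> parent_in S w &
      forall w, w \in W -> w \notin S -> parent_in S w ->
        vec x w \in vspan [seq s <- S | wlt s w]].
Proof.
elim: W acc => [|w W IHW] acc /= lt fa ca.
  rewrite cats0 in lt; split=> //.
    by split=> // u; rewrite cats0.
  by apply: (sorted_uniq (@wlt_trans m) (@wlt_irr m)); rewrite (sorted_pairwise (@wlt_trans m)).
have lt' : pairwise wlt (acc ++ W) by apply: subseq_pairwise lt; rewrite cat_subseq // subseq_cons.
case: ifP => [/andP[pw nw]|no].
  have [|||[sub1 sub2] fS uS cS H] := IHW (rcons acc w); rewrite ?cat_rcons //.
  - exact: free_rcons.
  - move=> u; rewrite mem_rcons inE => /predU1P[->|/ca]; last apply: parent_in_sub.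
      by apply: parent_in_sub pw => u'; rewrite mem_rcons inE orbC => ->.
    by move=> u'; rewrite mem_rcons inE orbC => ->.
  split=> //; first split.
  - by move=> u ua; apply: sub1; rewrite mem_rcons inE ua orbT.
  - by move=> u /sub2; rewrite cat_rcons.
  - move=> u; rewrite inE => /predU1P[->|]; last exact: H.
    by rewrite sub1 // mem_rcons mem_head.
have [//|//|//|[sub1 sub2] fS uS cS H] := IHW acc.
have ltw u : u \in greedy_tree acc W -> (u \in acc) = wlt u w.
  move=> /sub2; rewrite mem_cat.
  move: lt; rewrite pairwise_cat /= => /and4P[/allrelP Hl _ /allP Hr _].
  have [ua _|na] /= := boolP (u \in acc); first by rewrite Hl // mem_head.
  by move=> /Hr /wlt_asym.
split=> //; first split=> //.
  by move=> u /sub2; rewrite !mem_cat inE => /orP[->|->]; rewrite ?orbT.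
move=> u; rewrite inE => /predU1P[->|]; last exact: H.
(* The parent of [w] precedes [w]; if it is chosen at all, it was chosen before [w] was examined. So
   [w] was rejected for being dependent. *)
move=> nS pS; have pacc : parent_in acc w.
  case/lastP: (w) pS ltw => // u' k; rewrite !parent_in_rcons => u'S ltw.
  by rewrite ltw // wlt_rcons.
move: no; rewrite pacc /= => /negbFE; apply: subvP; apply: vspan_sub => u' u'a.
by rewrite mem_filter -ltw ?u'a ?sub1.
Qed.

(** The [size w + 1] prefixes of [w] are distinct members of [S]. Consequently the children of
    chosen words have length at most [d] and are among [words m d]. *)
Lemma size_closed S w : uniq S -> (forall w, w \in S -> parent_in S w) -> w \in S ->
  (size w < size S)%N.
Proof.
move=> uS cS wS; pose P := [seq take i w | i <- iota 0 (size w).+1].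
have -> : (size w).+1 = size P by rewrite size_map size_iota.
apply: uniq_leq_size => [|_ /mapP[i _ ->]].
  rewrite map_inj_in_uniq ?iota_uniq // => i j; rewrite !mem_iota !add0n !ltnS => iw jw.
  by move/(congr1 size); rewrite !size_takel.
by apply: (closed_prefix cS) wS; apply/prefixP; exists (drop i w); rewrite cat_take_drop.
Qed.

Lemma cell_lt_exists (m_gt0 : (0 < m)%N) : stable x -> exists2 T, T \in trees m d &
  basis_mx x T.1 \in unitmx /\ @cell m d T (fun c w => wlt w c) (normal_form T.1 x).
Proof.
move=> sx; have [|//|] := @greedy_tree_spec (words m d) [::] (words_lt m d).
  by rewrite /= nil_free.
set S := greedy_tree _ _ => _ fS uS cS H.
have sub : forall w k, w \in S -> rcons w k \notin S ->
    vec x (rcons w k) \in vspan [seq s <- S | wlt s (rcons w k)].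
  move=> w k wS nS; apply: H => //; last by rewrite parent_in_rcons.
  by rewrite mem_words size_rcons (leq_trans (size_closed uS cS wS)) // free_size.
have inS (a : pred word) : (vspan [seq s <- S | a s] <= vspan S)%VS.
  by apply: vspan_sub => w; rewrite mem_filter => /andP[].
apply: (cell_exists m_gt0 uS cS fS _ sub); apply: (vspan_full sx) => [w wS k|].
  have [kS|kS] := boolP (rcons w k \in S); first exact: mem_vspan.
  exact: (subvP (inS _)) (sub w k wS kS).
have [nS|nS] := boolP ([::] \in S); first exact: mem_vspan.
by apply: (subvP (inS _)); apply: H => //; rewrite mem_words.
Qed.

End Tree.

Section Nilpotent.
Hypotheses (sx : stable x) (nx : simul_nilpotent x).

(** The recursive call comes first, so an increasing list is examined from the largest word down.
    Closure under parents is not imposed but derived from nilpotency in [greedy_closed]. *)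
Fixpoint greedy W : seq word :=
  if W is w :: W' then
    if vec x w \in vspan (greedy W') then greedy W' else w :: greedy W'
  else [::].

(** The last clause concerns all larger words of [W], chosen or not, because both families have the
    same span; this is the form that [greedy_closed] contradicts. *)
Lemma greedy_spec W : pairwise wlt W ->
  [/\ {subset greedy W <= W}, free (map (vec x) (greedy W)),
      vspan (greedy W) = vspan W,
      forall w, w \in W -> w \notin greedy W ->
        vec x w \in vspan [seq s <- greedy W | wlt w s] &
      forall w, w \in greedy W -> vec x w \notin vspan [seq s <- W | wlt w s]].
Proof.
elim: W => [|w W IHW] /=; first by split=> //; rewrite nil_free.
case/andP=> /allP ltw /IHW[sub fS spE H1 H2].
have fW : [seq s <- W | wlt w s] = W by apply/all_filterP/allP.
have fS' : [seq s <- greedy W | wlt w s] = greedy W.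
  by apply/all_filterP/allP => u /sub /ltw.
have nlt u : u \in W -> wlt u w = false by move=> /ltw /wlt_asym.
case: ifPn => wS; split=> //.
- by move=> u /sub uW; rewrite inE uW orbT.
- rewrite /= span_cons spE; apply/esym/addv_idPr.
  by rewrite -spE -memvE.
- move=> u; rewrite inE => /predU1P[-> _|uW nu]; first by rewrite fS'.
  exact: H1.
- by move=> u uS; rewrite nlt ?H2 // sub.
- by move=> u; rewrite !inE => /predU1P[->|/sub->]; rewrite ?eqxx ?orbT.
- by rewrite /= free_cons wS.
- by rewrite /= !span_cons spE.
- move=> u; rewrite !inE negb_or => /predU1P[->|uW]; first by rewrite eqxx.
  by case/andP=> _ nu /=; rewrite nlt //; exact: H1.
- move=> u; rewrite inE => /predU1P[->|uS]; first by rewrite wlt_irr fW -spE.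
  by rewrite nlt ?H2 // sub.
Qed.

Lemma vec_long w : (d <= size w)%N -> vec x w = 0.
Proof.
move=> dw; rewrite -[w](cat_take_drop d) /vec act_cat act_rep_word.
by rewrite (act_rep_word _ (take d w)) (simul_nilpotent_words (w := rev (take d w))) ?mul0mx ?mulmx0 //
  size_rev size_takel.
Qed.

Lemma act_vspan (N : {vspace 'cV[C]_d}) (u : word) S v :
  (forall s, s \in S -> vec x (s ++ u) \in N) ->
  v \in vspan S -> act x u v \in N.
Proof.
move=> H; apply: (span_ind (P := fun v => act x u v \in N)).
- by rewrite act_rep_word mulmx0 mem0v.
- by move=> a v' w vv vw; rewrite act_linear memvD ?memvZ.
- by move=> _ /mapP[s sS ->]; rewrite /vec -act_cat; exact: H.
Qed.

Let W := words m d.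

(* If a word w is dependent on larger ones, then modulo the span N of the words
   branching off to its right it is a combination of its own proper extensions;
   these have the same property, so by nilpotency they all lie in N. *)
Lemma greedy_closed w : w \in greedy W -> parent_in (greedy W) w.
Proof.
have [sub fS spE H1 H2] := greedy_spec (words_lt m d).
case/lastP: w => // w k wkS; rewrite parent_in_rcons; apply: contraT => nS.
have wkW := sub _ wkS; have wW : w \in W.
  by move: wkW; rewrite !mem_words size_rcons; exact: ltnW.
have wS := H1 w wW nS; pose N := vspan [seq s <- W | right_of w s].
have NE u s : right_of w s -> vec x (s ++ u) \in N.
  move=> ws; have [sd|/vec_long->] := ltnP (size (s ++ u)) d; last exact: mem0v.
  by apply: mem_vspan; rewrite mem_filter right_of_catr // mem_words ltnW.
(* [n] bounds how far [u] is from length [d]. It drops with each nonempty extension, and at [n = 0]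
   the vector is zero by nilpotency. *)
have claim n u : (d <= size u + n)%N -> vec x (w ++ u) \in N.
  elim: n u => [|n IHn] u dn.
    by rewrite vec_long ?mem0v // size_cat; lia.
  rewrite /vec act_cat; apply: act_vspan wS => s; rewrite mem_filter => /andP[ws _].
  case/orP: (wlt_right_of ws) => [/NE//|/prefixP[u' sE]].
  rewrite sE -catA; apply: IHn; rewrite size_cat.
  have : u' != [::] by apply: contraTneq ws => u0; rewrite sE u0 cats0 wlt_irr.
  by case: u' {sE} => //= *; lia.
case/negP: (H2 _ wkS).
have H : vec x (rcons w k) \in N by have := claim d [:: k]; rewrite cats1; apply; lia.
move: H; apply: subvP; apply: vspan_sub => s; rewrite !mem_filter => /andP[ws ->].
by rewrite andbT; apply: right_of_wlt; rewrite -cats1; exact: right_of_catl.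
Qed.

Lemma cell_gt_exists (m_gt0 : (0 < m)%N) : exists2 T, T \in trees m d &
  basis_mx x T.1 \in unitmx /\ @cell m d T wlt (normal_form T.1 x).
Proof.
have [sub fS spE H1 H2] := greedy_spec (words_lt m d).
have uS : uniq (greedy W) by apply: (map_uniq (f := vec x)); exact: free_uniq.
have long w : w \notin W -> vec x w = 0.
  by rewrite mem_words -ltnNge => dw; apply: vec_long; exact: ltnW.
apply: (cell_exists m_gt0 uS greedy_closed fS).
  rewrite spE; apply: (vspan_full sx) => [w wW k|]; last by apply: mem_vspan; rewrite mem_words.
  by have [/mem_vspan|/long->] := boolP (rcons w k \in W); rewrite ?mem0v.
move=> w k wS nS; have [kW|/long->] := boolP (rcons w k \in W); last exact: mem0v.
exact: H1.
Qed.

End Nilpotent.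

End Greedy.

(** * Motives of the Hilbert schemes *)

Section EvalInt.
Variables (A : pzRingType) (x : A).

Lemma eval_int_widen (p : {poly int}) n : (size p <= n)%N ->
  eval_int p x = \sum_(i < n) x ^+ i *~ p`_i.
Proof.
move=> pn; rewrite /eval_int (big_ord_widen n (fun i => x ^+ i *~ p`_i) pn).
rewrite [LHS]big_mkcond; apply: eq_bigr => i _ /=; case: ltnP => // pi.
by rewrite nth_default.
Qed.

Lemma eval_int_sumX (T : Type) (s : seq T) (f : T -> nat) :
  eval_int (\sum_(t <- s) 'X^(f t)) x = \sum_(t <- s) x ^+ f t.
Proof.
elim: s => [|t s IHs]; first by rewrite !big_nil /eval_int size_poly0 big_ord0.
rewrite !big_cons -IHs; set p := \sum_(_ <- _) _; pose n := maxn (f t).+1 (size p).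
have pn : (size p <= n)%N by exact: leq_maxr.
have tn : (f t < n)%N by exact: leq_maxl.
have sn : (size ('X^(f t) + p)%R <= n)%N.
  by apply: leq_trans (size_polyD _ _) _; rewrite size_polyXn geq_max tn pn.
rewrite (eval_int_widen sn) (eval_int_widen pn).
under eq_bigr => i _ do rewrite coefD coefXn mulrzDr.
rewrite big_split /=; congr (_ + _).
rewrite (bigD1 (Ordinal tn)) //= eqxx big1 ?addr0 // => i ne.
by rewrite (_ : (i == f t :> nat) = false) //; apply/negbTE.
Qed.

End EvalInt.

Section OrbitSpaceMotive.
Variables (m d : nat) (m_gt0 : (0 < m)%N) (Z : rep m d -> Prop) (r : rel (seq 'I_m)).
Variables (K : eqType) (key : tree m -> K) (lt : rel K).
Hypotheses (Zinv : forall x y, same_orbit x y -> Z x -> Z y) (cZ : is_closed Z).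
Hypotheses (lt_irr : irreflexive lt) (lt_trans : transitive lt).
Hypotheses (lt_total : forall a b, a != b -> lt a b || lt b a).
Hypothesis (key_inj : {in trees m d &, injective key}).
Hypothesis (cellZ : forall T y, T \in trees m d -> basis_mx y T.1 = 1%:M -> cell T r y -> Z y).
Hypothesis (cell_exists : forall x, Z x -> stable x -> exists2 T, T \in trees m d &
  basis_mx x T.1 \in unitmx /\ cell T r (normal_form T.1 x)).
(* A cell only meets the charts of the trees that come after its own. *)
Hypothesis (cell_order : forall T T' (y : rep m d), T \in trees m d -> T' \in trees m d ->
  basis_mx y T.1 = 1%:M -> cell T r y -> basis_mx y T'.1 \in unitmx ->
  key T = key T' \/ lt (key T) (key T')).

(** Treats both schemes at once: [Z] is the closed invariant condition (none, or nilpotency), [r]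
    selects the free coordinates, and [key] orders the trees as the stratification requires. *)
Lemma orbit_space_motive : exists h : is_variety (orbit_space (fun x => Z x /\ stable x)),
  motive (Variety h) = \sum_(T <- trees m d) lefschetz ^+ weight r T.
Proof.
pose X := orbit_space (fun x => Z x /\ stable x).
have [tu _] := trees_uniq m_gt0 d.
have [s ps lts] := sorted_key lt_irr lt_trans lt_total key_inj tu.
have sT T : T \in s -> T \in trees m d by rewrite (perm_mem ps).
have rX : ringed X := lringed_ringed (lringed_orbit_space Z).
pose U (T : tree m) (q : X) : Prop := in_chart T.1 q.
pose cl (T : tree m) (q : X) : Prop := in_chart T.1 q /\ cell T r (coords T.1 q).
have spec T (Ts : T \in s) := trees_spec m_gt0 (sT T Ts).
have exT q : exists2 T, T \in s & cl T q.
  have [Zq sq] := svalP (orbit_rep q).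
  have [T Td [uq cq]] := cell_exists Zq sq.
  by exists T; rewrite ?(perm_mem ps).
have sepX : is_closed (fun p : prod_space X X => p.1 = p.2).
  apply: (separated_orbit_space Zinv) => q; have [T Ts [uq _]] := exT q.
  by exists T.1; split=> //; [exact: (tree_nodes_uniq (spec T Ts))|exact: ts_size (spec T Ts)].
have order T T' q : T \in s -> T' \in s -> cl T q -> U T' q ->
    T = T' \/ lt (key T) (key T').
  move=> Ts Ts' [uq cq] uq'; have [y1 _ _] := coords_spec Zinv uq.
  have uy : basis_mx (coords T.1 q) T'.1 \in unitmx.
    by rewrite (basis_mx_orbit _ (same_orbit_normal_form uq)).
  have [E|] := cell_order (sT _ Ts) (sT _ Ts') y1 cq uy; last by right.
  by left; apply: key_inj => //; exact: sT.
have oU T : T \in s -> opn (U T) by move=> _; exact: opn_in_chart.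
have aU T : T \in s -> is_affine (subspace (U T)).
  by move=> Ts; apply: (is_affine_chart Zinv cZ);
    [exact: (tree_nodes_uniq (spec T Ts))|exact: ts_size (spec T Ts)].
have iC T : T \in s -> iso (subspace (cl T)) (AA (weight r T)).
  move=> Ts; have sp := spec T Ts.
  apply: iso_trans (chart_iso Zinv (tree_nodes_uniq sp) (ts_size sp) (cell T r)) _.
  have -> : (fun y : rep m d => [/\ basis_mx y T.1 = 1%:M, Z y & cell T r y]) =
      (fun y => basis_mx y T.1 = 1%:M /\ cell T r y).
    apply: predext => y; split=> [[]|[y1 cy]] //; split=> //.
    exact: cellZ (sT T Ts) y1 cy.
  exact: cell_iso.
(* For the converse, a point of the chart of [T] outside of all earlier charts lies in some cell. By
   [order] the tree of that cell does not come after [T], and it does not come before, as the cell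
   lies in its own chart. *)
have cE s1 T s2 q : s = s1 ++ T :: s2 ->
    cl T q <-> U T q /\ forall T', T' \in s1 -> ~ U T' q.
  move=> sE; move: lts; rewrite sE pairwise_cat /= => /and4P[/allrelP lt1 _ /allP lt2 _].
  have Ts : T \in s by rewrite sE mem_cat mem_head orbT.
  have asym a b : lt a b -> lt b a -> False.
    by move=> ab /(lt_trans ab); rewrite lt_irr.
  have lt1T T' : T' \in s1 -> lt (key T') (key T) by move=> T's; apply: lt1; rewrite ?mem_head.
  split=> [cq|[uq nq]].
    split=> [|T' T's uq']; first by case: cq.
    have T's' : T' \in s by rewrite sE mem_cat T's.
    have := lt1T _ T's; have [->|TT'] := order T T' q Ts T's' cq uq'; first by rewrite lt_irr.
    by move/asym; apply.
  have [T' T's cq] := exT q; have [<-//|T'T] := order T' T q T's Ts cq uq.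
  move: T's; rewrite sE mem_cat inE => /or3P[T's|/eqP<-//|T's].
    by case: (nq T' T's); case: cq.
  by case: (asym _ _ T'T (lt2 _ T's)).
have UT q : exists2 T, T \in s & U T q by have [T Ts [uq _]] := exT q; exists T.
have h : is_variety X.
  split=> //; exists (size s), (fun i => U (tnth (in_tuple s) i)); split.
  - by move=> i; apply: oU; exact: mem_tnth.
  - move=> q; have [T Ts uq] := UT q; have /tnthP[i iE] : T \in in_tuple s by [].
    by exists i; rewrite -iE.
  - by move=> i; apply: aU; exact: mem_tnth.
exists h; rewrite -(perm_big _ ps) /=.
have h' := is_variety_union rX sepX oU aU.
rewrite -(motive_union (N := weight r) rX sepX oU aU iC cE h').
by apply: motive_eq; apply: iso_sym; apply: (iso_subspaceT rX).
Qed.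

End OrbitSpaceMotive.

Lemma Hilb_motive (m d : nat) (m_gt0 : (0 < m)%N) : exists h : is_variety (Hilb m d),
  motive (Variety h) = \sum_(T <- trees m d) lefschetz ^+ weight_lt T.
Proof.
have -> : Hilb m d = orbit_space (fun x : rep m d => True /\ stable x).
  by congr orbit_space; apply: predext => x; split=> [|[]].
apply: (orbit_space_motive m_gt0 (r := fun c w => wlt w c) (key := fst) (lt := slt wlt)) => //.
- exact/closed_cst/ringed_affine_space.
- exact/slt_irr/wlt_irr.
- exact/slt_trans/wlt_trans.
- exact/slt_total/wlt_total.
- by have [] := trees_uniq m_gt0 d.
- by move=> x _ sx; exact: cell_lt_exists.
- move=> T T' y Td T'd y1 cy; apply: (cell_lt_order (trees_spec m_gt0 Td) y1) => //.
  exact: (trees_spec m_gt0 T'd).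
Qed.

Lemma Hilb0_motive (m d : nat) (m_gt0 : (0 < m)%N) : exists h : is_variety (Hilb0 m d),
  motive (Variety h) = \sum_(T <- trees m d) lefschetz ^+ weight_gt T.
Proof.
apply: (orbit_space_motive m_gt0 (r := wlt) (key := fun T => rev T.1)
  (lt := slt (fun w c => wlt c w))).
- exact: simul_nilpotent_orbit.
- exact: closed_simul_nilpotent.
- exact/slt_irr/wlt_irr.
- by apply: slt_trans => w c u cw uc; exact: wlt_trans uc cw.
- by apply: slt_total => w c; rewrite orbC; exact: wlt_total.
- have [_ inj] := trees_uniq m_gt0 d.
  by move=> T T' Td T'd /(can_inj revK); exact: inj.
- by move=> T y Td y1; exact: cell_gt_nilpotent (trees_spec m_gt0 Td) _ y1.
- by move=> x nx sx; exact: cell_gt_exists.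
- move=> T T' y Td T'd y1 cy uy.
  have [->|] := cell_gt_order (trees_spec m_gt0 Td) y1 (trees_spec m_gt0 T'd) cy uy.
    by left.
  by right.
Qed.

Theorem corollary4p2 (m : nat) (hm : (1 <= m)%N) :
  exists (hvar : forall d, is_variety (Hilb m d))
         (hvar0 : forall d, is_variety (Hilb0 m d)),
    let F : nat -> K0loc := fun d =>
      lefschetz_inv ^+ (m.-1 * (d * d.-1)./2) * motive (Variety (hvar0 d)) in
    [/\ F 0%N = 1,
        functional_equation m F &
        forall G : nat -> K0loc,
          G 0%N = 1 -> functional_equation m G -> G = F] /\
    exists h h0 : nat -> {poly int}, forall d,
      [/\ motive (Variety (hvar0 d)) = eval_int (h0 d) lefschetz,
          motive (Variety (hvar d)) = eval_int (h d) lefschetz &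
          tofrac (h0 d) =
            tofrac 'X ^+ (m.-1 * d ^ 2 + d) * eval_int (h d) (tofrac 'X)^-1].
Proof.
exists (fun d => sval (cid (Hilb_motive d hm))), (fun d => sval (cid (Hilb0_motive d hm))).
move=> F; have FE : F = tree_series lefschetz lefschetz_inv m.
  apply: funext => d; rewrite /F; case: cid => h /= ->; reflexivity.
split.
  have FF : functional_equation m F.
    by rewrite FE; exact: (tree_series_functional lefschetzV hm).
  have F0 : F 0%N = 1 by rewrite FE tree_series0.
  split=> // G G0 GG; apply: funext.
  by apply: (functional_equation_uniq (Li := lefschetz_inv) (k := m)) => //; rewrite G0 F0.
exists (fun d => \sum_(T <- trees m d) 'X^(weight_lt T)),
  (fun d => \sum_(T <- trees m d) 'X^(weight_gt T)) => d.
rewrite !eval_int_sumX; split; try by case: cid.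
(* The relation holds tree by tree: the two weights add up to $(m-1)d^2+d$, so multiplying by that
   power of $q$ turns $q^{-1}$ to the one weight into $q$ to the other. *)
rewrite rmorph_sum mulr_sumr; apply: eq_big_seq => T Td.
rewrite rmorphXn -(weight_gt_lt hm Td) exprD -mulrA -exprMn divff ?expr1n ?mulr1 //.
by rewrite tofrac_eq0 polyX_eq0.
Qed.
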